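(* Let $d=2$, let $\Gamma$ be a $2\times2$ symmetric positive definite matrix and let $R$ be a $2\times 2$ $\mathcal{P}$-matrix. For each $r\in(0,1)$ let $\delta^{(r)}=(r,r^2)^\prime$ and $\mu^{(r)}=-R\,\delta^{(r)}$, and let $Z^{(r)}=(Z_1^{(r)},Z_2^{(r)})$ be a random vector distributed according to the stationary distribution of the SRBM on $\mathbb{R}_+^2$ associated with $(\mu^{(r)},\Gamma,R)$. Then, as $r\to0$, $$\big(rZ^{(r)}_1,\,r^2Z^{(r)}_2\big)\Rightarrow(Z_1^*,Z_2^* )$$ in distribution, where $Z_1^*,Z_2^*$ are independent and each $Z_k^*$ is exponential with mean $m_k=\dfrac{u_k^\prime\Gamma u_k}{2u_k^\prime R_{:,k}}>0$, $k=1,2$. Here $u_1=[1,0]^\prime$ and $u_2=[w_{12},1]^\prime$, where $w_{12}$ is the unique solution of $w_{12}R_{11}+R_{21}=0$.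
   Context: Notation: $^\prime$ denotes transpose; $R_{:,k}$ is the $k$th column of $R$; $\mathbb{R}_+^d=\{x\in\mathbb{R}^d:x\ge0\}$. A square matrix is a $\mathcal{P}$-matrix if all of its principal minors are positive. SRBM: given $\mu\in\mathbb{R}^d$, a symmetric positive definite $d\times d$ matrix $\Gamma$ and a $d\times d$ matrix $R$, an SRBM (semimartingale reflecting Brownian motion) associated with $(\mu,\Gamma,R)$ is a continuous $\mathbb{F}$-adapted $d$-dimensional process $Z=\{Z(t),t\ge0\}$ together with a family of probability measures $\{\mathbb{P}_x:x\in\mathbb{R}_+^d\}$ on a filtered space $(\Omega,\mathscr{F},\mathbb{F})$ such that, under $\mathbb{P}_x$, $Z(t)=X(t)+RY(t)\in\mathbb{R}_+^d$ for all $t\ge0$, where $X$ is a $d$-dimensional $\mathbb{F}$-Brownian motion with drift $\mu$, covariance matrix $\Gamma$ and $X(0)=x$ a.s., and $Y$ is an $\mathbb{F}$-adapted $d$-dimensional process such that each component $Y_i$ is continuous and nondecreasing with $Y_i(0)=0$ and $\int_0^tZ_i(s)\,dY_i(s)=0$ for all $t\ge0$. For the matrices $R$ considered here such a process exists and is unique in law. Known fact (Hobson and Rogers 1993; Harrison and Hasenbein 2009): for $d=2$, $R$ a $\mathcal{P}$-matrix and $-R^{-1}\mu>0$ componentwise, the SRBM is positive recurrent and has a unique stationary distribution; this applies to every $r\in(0,1)$ here. *)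

(* Defs.v *)
From HB Require Import structures.
From mathcomp Require Import all_boot all_order all_algebra.
From mathcomp Require Import all_classical all_reals all_analysis.
From mathcomp Require Import measurable_realfun.

Set Implicit Arguments.
Unset Strict Implicit.
Unset Printing Implicit Defensive.

Import Order.TTheory GRing.Theory Num.Theory.
Import numFieldNormedType.Exports.

Local Open Scope classical_set_scope.
Local Open Scope ring_scope.

(* The column vectors 'cV[R]_n with their Borel sigma-algebra. *)
Notation borelV R n := (g_sigma_algebraType (@open 'cV[R]_n)).

Section Matrices.
Variables (R : realType) (n : nat).
Implicit Types (A : 'M[R]_n) (u v : 'cV[R]_n).

Definition dotV u v : R := (u^T *m v) ord0 ord0.

Definition sym_posdef A : Prop :=
  A^T = A /\ forall v, v != 0 -> 0 < dotV v (A *m v).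

(* The empty set of indices only contributes the trivial minor 1. *)
Definition Pmatrix A : Prop :=
  forall I : {set 'I_n},
    0 < \det (mxsub (@enum_val _ (mem I)) (@enum_val _ (mem I)) A).

Definition orthant : set 'cV[R]_n := [set v | forall i, 0 <= v i ord0].

End Matrices.

Section Processes.
Variables (R : realType) (n : nat) (d : measure_display) (T : measurableType d).

(* Time is [0, +oo[; nothing is required of a process or of a filtration at
   negative times. *)

Definition filtration (F : R -> set (set T)) : Prop :=
  (forall t : R, 0 <= t -> sigma_algebra setT (F t) /\ F t `<=` measurable) /\
  (forall s t : R, 0 <= s -> s <= t -> F s `<=` F t).

Definition adapted (F : R -> set (set T)) (X : R -> T -> 'cV[R]_n) : Prop :=
  forall t : R, 0 <= t ->
  forall B : set (borelV R n), measurable B -> F t (X t @^-1` B).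

Definition continuous_path (x : R -> 'cV[R]_n) : Prop :=
  {within `[0, +oo[%classic, continuous x}.

(* The law N(m, S), for S positive definite, defined by its one-dimensional
   projections. The direction 0 is excluded because normal_prob is a dummy
   (uniform) law when its standard deviation is 0. *)
Definition gaussian_vector (P : probability T R) (X : T -> 'cV[R]_n)
    (m : 'cV[R]_n) (S : 'M[R]_n) : Prop :=
  forall u : 'cV[R]_n, u != 0 ->
  forall B : set R, measurable B ->
    P [set w | B (dotV u (X w))] =
    normal_prob (dotV u m) (Num.sqrt (dotV u (S *m u))) B.

Record brownian_motion (P : probability T R) (F : R -> set (set T))
    (mu : 'cV[R]_n) (Gamma : 'M[R]_n) (x : 'cV[R]_n)
    (X : R -> T -> 'cV[R]_n) : Prop := {
  bm_adapted : adapted F X ;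
  bm_continuous : {ae P, forall w, continuous_path (X^~ w)} ;
  bm_start : {ae P, forall w, X 0 w = x} ;
  bm_independent : forall s t : R, 0 <= s -> s < t ->
    forall A, F s A ->
    forall B : set (borelV R n), measurable B ->
      P (A `&` [set w | B (X t w - X s w)%R]) =
      (P A * P [set w | B (X t w - X s w)%R])%E ;
  bm_gaussian : forall s t : R, 0 <= s -> s < t ->
    gaussian_vector P (fun w => X t w - X s w)
      ((t - s) *: mu) ((t - s) *: Gamma) }.

(* int_0^t z(s) dy(s) = 0 for all t >= 0, as a Lebesgue-Stieltjes integral;
   y is extended to ]-oo, 0] by the constant y(0), so that the measure dy
   charges neither ]-oo, 0[ nor {0}. *)
Definition complementary (z y : R -> R) : Prop :=
  exists g : cumulative R R, (forall s, g s = y (Num.max 0 s)) /\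
    forall t : R, 0 <= t ->
      (\int[lebesgue_stieltjes_measure g]_(s in `[0%R, t]) (z s)%:E = 0)%E.

Record regulator (P : probability T R) (F : R -> set (set T))
    (Z Y : R -> T -> 'cV[R]_n) : Prop := {
  reg_adapted : adapted F Y ;
  reg_continuous : {ae P, forall w, continuous_path (Y^~ w)} ;
  reg_nondecreasing : {ae P, forall w, forall i (s t : R),
    0 <= s -> s <= t -> Y s w i ord0 <= Y t w i ord0} ;
  reg_start : {ae P, forall w, Y 0 w = 0} ;
  reg_complementary : {ae P, forall w, forall i,
    complementary (fun s => Z s w i ord0) (fun s => Y s w i ord0)} }.

(* The semimartingale reflecting Brownian motion (Z, {P_x}) associated with
   (mu, Gamma, Rfl) on the filtered space (T, F); P x is only relevant for x
   in the orthant, and the decomposition Z = X + Rfl Y may depend on x. *)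
Record srbm (mu : 'cV[R]_n) (Gamma Rfl : 'M[R]_n) (F : R -> set (set T))
    (Z : R -> T -> 'cV[R]_n) (P : 'cV[R]_n -> probability T R) : Prop := {
  srbm_filtration : filtration F ;
  srbm_adapted : adapted F Z ;
  srbm_continuous : forall w, continuous_path (Z^~ w) ;
  srbm_decomposition : forall x, orthant x ->
    exists X Y : R -> T -> 'cV[R]_n,
    [/\ brownian_motion (P x) F mu Gamma x X,
        regulator (P x) F Z Y &
        {ae P x, forall w, forall t : R, 0 <= t ->
           Z t w = X t w + Rfl *m Y t w /\ orthant (Z t w)}] }.

(* Invariance of pi under the transition function P_x(Z(t) \in B). *)
Definition invariant_law (Z : R -> T -> 'cV[R]_n)
    (P : 'cV[R]_n -> probability T R) (pi : probability (borelV R n) R) : Prop :=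
  pi (@orthant R n) = 1%E /\
  forall t : R, 0 <= t -> forall B : set (borelV R n), measurable B ->
    measurable_fun (@orthant R n : set (borelV R n))
      ((fun x => P x (Z t @^-1` B)) : borelV R n -> \bar R) /\
    (\int[pi]_(x in @orthant R n) P x (Z t @^-1` B) = pi B)%E.

End Processes.

Definition srbm_stationary_distribution (R : realType) (n : nat)
    (mu : 'cV[R]_n) (Gamma Rfl : 'M[R]_n)
    (pi : probability (borelV R n) R) : Prop :=
  exists (d : measure_display) (T : measurableType d) (F : R -> set (set T))
         (Z : R -> T -> 'cV[R]_n) (P : 'cV[R]_n -> probability T R),
    srbm mu Gamma Rfl F Z P /\ invariant_law Z P pi.

Section Laws.
Variable R : realType.

Definition independent2 (d : measure_display) (T : measurableType d)
    (P : probability T R) (X Y : T -> R) : Prop :=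
  forall A B : set R, measurable A -> measurable B ->
    P (X @^-1` A `&` Y @^-1` B) = (P (X @^-1` A) * P (Y @^-1` B))%E.

Definition exponential_mean (d : measure_display) (T : measurableType d)
    (P : probability T R) (X : T -> R) (m : R) : Prop :=
  forall A : set R, measurable A -> P (X @^-1` A) = exponential_prob m^-1 A.

(* Convergence in distribution of random vectors W i, each defined on its own
   probability space, along the filter G on the index i. *)
Definition cvg_in_distribution (n : nat) (I : Type) (G : set_system I)
    (d : I -> measure_display) (T : forall i, measurableType (d i))
    (P : forall i, probability (T i) R) (W : forall i, T i -> 'cV[R]_n)
    (d' : measure_display) (T' : measurableType d')
    (P' : probability T' R) (W' : T' -> 'cV[R]_n) : Prop :=
  forall f : 'cV[R]_n -> R, continuous f ->
    (exists C, forall x, `|f x| <= C) ->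
    ('E_(P i)[fun w => f (W i w)] @[i --> G] --> 'E_P'[fun w => f (W' w)])%E.

End Laws.

(* Main.v *)
Require Import Defs.
From HB Require Import structures.
From mathcomp Require Import all_boot all_order all_algebra.
From mathcomp Require Import all_classical all_reals all_analysis.
From mathcomp Require Import measurable_realfun giry.
From mathcomp Require Import ring lra.

(** Write p, q, s, t for the entries of the reflection matrix, row by row,
    e_(a,b)(z) for exp (- (a z1 + b z2)) with a, b >= 0, and phi_r(a, b) for
    the mean of e_(a,b) under the stationary law pi_r. The proof never leaves
    Laplace transforms.

    Stationarity enters through the basic adjoint relation
      Q(a,b) phi_r(a,b) + r (a p + b s) (phi_r(a,b) - A_r(b))
        + r^2 (a q + b t) (phi_r(a,b) - B_r(a)) = 0,
    where Q(a,b) is half of the quadratic form of Gamma and A_r, B_r are the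
    Laplace transforms of the normalised boundary measures on z1 = 0 and on
    z2 = 0 (basic_adjoint_relation). It is usually read off Ito's formula for
    e_(a,b)(Z); here time is cut into dyadic intervals instead. On such an
    interval, e_(a,b)(Z) changes by a factor due to the increment of the
    Brownian motion and by a jump due to the growth of Y. The first changes
    sum up to a martingale, bounded in L2 because the increments are
    independent and Gaussian, plus a drift with the explicit rate given by the
    normal moment generating function (one_step_l2). The jumps converge, path
    by path, to Stieltjes integrals in which the vanishing coordinate has
    disappeared: this is how complementarity is used (jump_sum_cvg). Bounded L2
    norms and pointwise convergence give convergence of the means
    (boundary_terms), and integrating over the initial state makes the
    telescoping part disappear.

    Given these relations the limit is found analytically (laplace_cvg), along
    an ultrafilter finer than r -> 0+, so that every bounded expression has a
    limit. At (r x, r y) the relation shows that r Z1 becomes exponential and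
    that r Z2 escapes to infinity (escape), whatever the sign of s. On the
    boundary z2 = 0, too, Z1 is of smaller order than r^-2: B_r(r^2 b) tends to
    1 (boundary_concentrates); this is where p t - q s > 0 is used. At (r x, r^2 y) the limit factorises (G_product),
    and in the direction (w, 1), orthogonal to the first column of the matrix,
    the relation determines its second factor (G_at0). When s > 0 that direction
    leaves the quadrant, where phi_r is not available; two relations at points
    of the quadrant are then combined.

    Convergence of the Laplace transforms yields convergence in distribution
    (laplace_continuity): in the coordinates exp (- z1), exp (- z2) a bounded
    continuous function is approximated by Bernstein polynomials, uniformly on
    compact sets, and the mass outside is controlled by the Laplace transform
    itself. *)

Set Implicit Arguments.
Unset Strict Implicit.
Unset Printing Implicit Defensive.

Import Order.TTheory GRing.Theory Num.Theory.
Import numFieldNormedType.Exports.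

Local Open Scope classical_set_scope.
Local Open Scope ring_scope.

(** * Limits along ultrafilters *)

Section UltraLimits.
Variables (R : realType) (U : set_system R) (UU : UltraFilter U).

Let PU : ProperFilter U := @ultra_proper _ _ UU.

(** Compactness of [-C, C]: an ultrafilter concentrated on it has a limit, and
    no subsequence has to be extracted. *)
Lemma ultra_cvg_bounded (f : R -> R) (C : R) :
  (\forall r \near U, `|f r| <= C) -> exists l : R, f @ U --> l.
Proof.
move=> fC.
have := @segment_compact R (- C) C => /(_ (f @ U) _).
case=> [|l [_ cl]].
  by apply: filterS fC => r /=; rewrite in_itv /= ler_norml.
exists l => N Nl.
have [//|UN] := in_ultra_setVsetC (f @^-1` N) UU.
have [y [/= nNy Ny]] := cl (~` N) N UN Nl.
by case: nNy.
Qed.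

Definition ulim (f : R -> R) : R := get [set l : R | f @ U --> l].

Lemma cvg_ulim (f : R -> R) (C : R) :
  (\forall r \near U, `|f r| <= C) -> f @ U --> ulim f.
Proof.
move=> /ultra_cvg_bounded[l fl].
by have := @getI _ [set l : R | f @ U --> l] l fl.
Qed.

Lemma ultra_unique (f : R -> R) (l m : R) : f @ U --> l -> f @ U --> m -> l = m.
Proof. by move=> fl fm; apply: (cvg_unique _ fl fm). Qed.

Lemma cvg_near_eq0 (f : R -> R) (l : R) :
  f @ U --> l -> (\forall r \near U, f r = 0) -> l = 0.
Proof.
move=> fl f0; apply: (ultra_unique fl).
apply: cvg_near_cst; exact: f0.
Qed.

End UltraLimits.

(** Convergence of an expression built by sums, differences and products from
    constants and from functions whose convergence is in the context; the limit
    in the goal has to display the same operations. *)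
Ltac cvgs := repeat
  match goal with
  | H : ?G |- ?G => exact H
  | |- context [fmap (fun r => ?c)] => exact (@cvg_cst _ _ _ _ _)
  | |- context [fmap (fun r => (@?f r + - @?g r)%R)] => refine (@cvgB _ _ _ _ _ f g _ _ _ _)
  | |- context [fmap (fun r => (@?f r + @?g r)%R)] => refine (@cvgD _ _ _ _ _ f g _ _ _ _)
  | |- context [fmap (fun r => (- @?f r)%R)] => refine (@cvgN _ _ _ _ _ f _ _)
  | |- context [fmap (fun r => (@?f r * @?g r)%R)] => refine (@cvgM _ _ _ _ f g _ _ _ _)
  end.

(** If the preimage of a neighbourhood N of l were not in G, then G and the
    complement of this preimage would generate a proper filter, and an
    ultrafilter finer than it would contradict the hypothesis. *)
Lemma cvg_ultra (R : realType) (G : set_system R) (PG : ProperFilter G)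
    (f : R -> R) (l : R) :
  (forall U, UltraFilter U -> G `<=` U -> f @ U --> l) -> f @ G --> l.
Proof.
move=> H N Nl; apply: contrapT => GN.
pose G' : set_system R := [set A | exists2 B, G B & B `&` (~` (f @^-1` N)) `<=` A].
have G'F : ProperFilter G'.
  apply: Build_ProperFilter.
    move=> [B GB] BN; apply: GN.
    suff : G (f @^-1` N) by [].
    apply: filterS GB => r Br.
    by apply: contrapT => nN; exact: (BN r).
  split.
  - by exists setT; [exact: filterT|].
  - move=> A1 A2 [B1 G1 S1] [B2 G2 S2]; exists (B1 `&` B2); first exact: filterI.
    by move=> r [[r1 r2] r3]; split; [apply: S1|apply: S2].
  - by move=> A1 A2 S [B GB SB]; exists B => //; exact: subset_trans SB S.
have [U [UU sU]] := ultraFilterLemma G'F.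
have GU : G `<=` U by move=> A GA; apply: sU; exists A => // r [].
have UN : U (f @^-1` N) by exact: (H U UU GU N Nl).
have UN' : U (~` (f @^-1` N)) by apply: sU; exists setT; [exact: filterT|move=> r []].
have PU := @ultra_proper _ _ UU.
by apply: (@filter_not_empty _ U PU); rewrite -(setICr (f @^-1` N)); exact: filterI.
Qed.

(** * Laplace transforms at the two scales *)

(** The inequalities between Laplace transforms used in the asymptotics. Each
    one is the mean of a pointwise inequality between exponentials of z1 >= 0
    and z2 >= 0. The concavity fields say that (1 - exp (- x z1)) / x is
    nonincreasing in x, under the weights exp (- b z2) and 1 - exp (- b z2);
    the last field is the mean of exp (- b z2) (1 - exp (- a z1))^2. *)
Record joint_laplace (R : realType) (phi : R -> R -> R) : Prop := JointLaplace {
  laplace_at0 : phi 0 0 = 1 ;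
  laplace_ge0 : forall a b, 0 <= a -> 0 <= b -> 0 <= phi a b ;
  laplace_antitone : forall a a' b b', 0 <= a -> a <= a' -> 0 <= b -> b <= b' ->
    phi a' b' <= phi a b ;
  laplace_increment : forall a b, 0 <= a -> 0 <= b ->
    phi 0 b - phi a b <= 1 - phi a 0 ;
  laplace_concave : forall a k b, 0 <= a -> a <= k -> 0 <= b ->
    a * (phi 0 b - phi k b) <= k * (phi 0 b - phi a b) ;
  laplace_concaveC : forall a k b, 0 <= a -> a <= k -> 0 <= b ->
    a * ((1 - phi k 0) - (phi 0 b - phi k b)) <=
    k * ((1 - phi a 0) - (phi 0 b - phi a b)) ;
  laplace_convex : forall a b, 0 <= a -> 0 <= b ->
    0 <= phi 0 b - 2 * phi a b + phi (2 * a) b }.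

Lemma le0_of_le_linear (R : realType) (u K y : R) : 0 < y ->
  (forall z, 0 < z -> z <= y -> u <= K * z) -> u <= 0.
Proof.
move=> y0 H; rewrite leNgt; apply/negP => u0.
have K0 : 0 < K by have := H y y0 (lexx _); nra.
pose z := Num.min y (u / (2 * K)).
have z0 : 0 < z by rewrite lt_min y0 divr_gt0// mulr_gt0.
have := H z z0; rewrite ge_min lexx => /(_ isT).
have : K * z <= K * (u / (2 * K)) by rewrite ler_pM2l// ge_min lexx orbT.
have -> : K * (u / (2 * K)) = u / 2 by field; rewrite gt_eqF.
lra.
Qed.

Section Asymptotics.
Variables (R : realType) (g11 g12 g22 p q s t : R).
Let quad (a b : R) := g11 * a ^+ 2 / 2 + g12 * a * b + g22 * b ^+ 2 / 2.
Hypothesis quad_gt0 : forall a b, (a != 0) || (b != 0) -> 0 < quad a b.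
Hypotheses (p0 : 0 < p) (t0 : 0 < t) (det0 : 0 < p * t - q * s).
Variables (phi : R -> R -> R -> R) (A B : R -> R -> R).
Hypothesis hphi : forall r, 0 < r < 1 -> joint_laplace (phi r).
Hypothesis hA : forall r b, 0 < r < 1 -> 0 <= b -> 0 <= A r b <= 1.
Hypothesis hB : forall r b, 0 < r < 1 -> 0 <= b -> 0 <= B r b <= 1.
Hypothesis hA0 : forall r, 0 < r < 1 -> A r 0 = 1.
Hypothesis hB0 : forall r, 0 < r < 1 -> B r 0 = 1.
(* The basic adjoint relation: A and B are Laplace transforms of boundary
   measures, on which one coordinate vanishes. *)
Hypothesis bar : forall r a b, 0 < r < 1 -> 0 <= a -> 0 <= b ->
  quad a b * phi r a b + r * (a * p + b * s) * (phi r a b - A r b)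
    + r ^+ 2 * (a * q + b * t) * (phi r a b - B r a) = 0.

Section AlongUltra.
Variables (U : set_system R) (UU : UltraFilter U).
Hypothesis U0 : (0:R)^'+ `<=` U.

Let PU : ProperFilter U := @ultra_proper _ _ UU.

Lemma near_small (e : R) : 0 < e -> \forall r \near U, 0 < r < e.
Proof.
move=> e0; apply: U0.
by apply: filterS2 (nbhs_right_gt 0) (nbhs_right_lt e0) => r -> ->.
Qed.

Let near01 : \forall r \near U, 0 < r < 1. Proof. exact: near_small. Qed.

Lemma cvg_idU : (fun r : R => r) @ U --> (0 : R).
Proof.
apply: cvg_trans (_ : (fun r : R => r) @ (0:R)^'+ --> (0:R)).
  by move=> N; exact: U0.
by apply: cvg_within_filter.
Qed.

Lemma phi01 r a b : 0 < r < 1 -> 0 <= a -> 0 <= b -> 0 <= phi r a b <= 1.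
Proof.
move=> r01 a0 b0; have L := hphi r01; rewrite (laplace_ge0 L)//=.
by rewrite -(laplace_at0 L); apply: (laplace_antitone L).
Qed.

Lemma cvg_phi (x y : R -> R) :
  (\forall r \near U, (0 <= x r) && (0 <= y r)) ->
  (fun r => phi r (x r) (y r)) @ U --> ulim U (fun r => phi r (x r) (y r)).
Proof.
move=> xy; apply: (@cvg_ulim _ _ _ _ 1).
apply: filterS2 near01 xy => r r01 /andP[x0 y0].
have /andP[? ?] := phi01 r01 x0 y0.
by rewrite ger0_norm.
Qed.

Lemma cvg_AB (C : R -> R -> R) (x : R -> R) :
  (forall r b, 0 < r < 1 -> 0 <= b -> 0 <= C r b <= 1) ->
  (\forall r \near U, 0 <= x r) ->
  (fun r => C r (x r)) @ U --> ulim U (fun r => C r (x r)).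
Proof.
move=> hC xy; apply: (@cvg_ulim _ _ _ _ 1).
apply: filterS2 near01 xy => r r01 x0.
have /andP[? ?] := hC _ _ r01 x0.
by rewrite ger0_norm.
Qed.

Lemma near_eq (f : R -> R) (l : R) : f @ U --> l ->
  (forall r, 0 < r < 1 -> f r = 0) -> l = 0.
Proof.
by move=> fl f0; apply: (cvg_near_eq0 UU fl); apply: filterS near01.
Qed.

Lemma near_geW (f : R -> R) (l : R) : f @ U --> l ->
  (\forall r \near U, 0 <= f r) -> 0 <= l.
Proof. by move=> fl; exact: (cvgr_to_ge fl). Qed.

Lemma near_ge (f : R -> R) (l : R) : f @ U --> l ->
  (forall r, 0 < r < 1 -> 0 <= f r) -> 0 <= l.
Proof.
by move=> fl f0; apply: (cvgr_to_ge fl); apply: filterS near01.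
Qed.

Lemma near_ge_small (f : R -> R) (l e : R) : 0 < e -> f @ U --> l ->
  (forall r, 0 < r < 1 -> r < e -> 0 <= f r) -> 0 <= l.
Proof.
move=> e0 fl f0; apply: (cvgr_to_ge fl).
by apply: filterS2 near01 (near_small e0) => r r01 /andP[? ?]; exact: f0.
Qed.

(* Both coordinates at the scale r^-1 of the first one. *)
Let F x y := ulim U (fun r => phi r (r * x) (r * y)).
Let a1 y := ulim U (fun r => A r (r * y)).

Lemma cvgF x y : 0 <= x -> 0 <= y ->
  (fun r => phi r (r * x) (r * y)) @ U --> F x y.
Proof.
move=> x0 y0; apply: cvg_phi; apply: filterS near01 => r /andP[r0 _].
by rewrite !mulr_ge0 ?(ltW r0).
Qed.

Lemma cvga1 y : 0 <= y -> (fun r => A r (r * y)) @ U --> a1 y.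
Proof.
move=> y0; apply: cvg_AB => //; apply: filterS near01 => r /andP[r0 _].
by rewrite !mulr_ge0 ?(ltW r0).
Qed.

(** The relation at (r x, r y), divided by r^2: the boundary z2 = 0 keeps a
    factor r and disappears. *)
Lemma eqF x y : 0 <= x -> 0 <= y ->
  quad x y * F x y + (x * p + y * s) * (F x y - a1 y) = 0.
Proof.
move=> x0 y0.
have cB : (fun r => B r (r * x)) @ U --> ulim U (fun r => B r (r * x)).
  apply: cvg_AB => //; apply: filterS near01 => r /andP[r0 _].
  by rewrite !mulr_ge0 ?(ltW r0).
have cF := cvgF x0 y0; have cA := cvga1 y0; have ci := cvg_idU.
set b := ulim U _ in cB.
suff : quad x y * F x y + (x * p + y * s) * (F x y - a1 y)
   + 0 * ((x * q + y * t) * (F x y - b)) = 0 by rewrite mul0r addr0.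
apply: (@near_eq (fun r => quad x y * phi r (r * x) (r * y) +
   (x * p + y * s) * (phi r (r * x) (r * y) - A r (r * y)) +
   r * ((x * q + y * t) * (phi r (r * x) (r * y) - B r (r * x))))).
  by cvgs.
move=> r /andP[r0 r1].
have := @bar r (r * x) (r * y); rewrite r0 r1 !mulr_ge0 ?(ltW r0)// => /(_ isT isT isT) E.
apply: (@mulfI _ (r ^+ 2)); first by rewrite expf_neq0// gt_eqF.
rewrite mulr0 -[RHS]E /quad; ring.
Qed.

Lemma A_at0 : a1 0 = 1.
Proof.
apply: (ultra_unique UU (cvga1 (lexx 0))); apply: cvg_near_cst.
by apply: filterS near01 => r r01; rewrite mulr0 hA0.
Qed.

Lemma F_at0 x : 0 <= x -> F x 0 * (g11 * x / 2 + p) = p.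
Proof.
rewrite le_eqVlt => /orP[/eqP <-|x0].
  rewrite mulr0 mul0r add0r; suff -> : F 0 0 = 1 by rewrite mul1r.
  apply: (ultra_unique UU (cvgF (lexx 0) (lexx 0))); apply: cvg_near_cst.
  by apply: filterS near01 => r r01; rewrite mulr0; exact: (laplace_at0 (hphi r01)).
have := eqF (ltW x0) (lexx 0); rewrite A_at0 => E.
apply: (@mulfI _ x); first by rewrite gt_eqF.
apply/eqP; rewrite -subr_eq0 -[X in _ == X]E /quad; apply/eqP; ring.
Qed.

Let g11_gt0 : 0 < g11.
Proof. have := @quad_gt0 1 0; rewrite oner_neq0 /quad => /(_ isT); lra. Qed.

Let g22_gt0 : 0 < g22.
Proof. have := @quad_gt0 0 1; rewrite oner_neq0 orbT /quad => /(_ isT); lra. Qed.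

Let K := g11 / (2 * p).
Let K0 : 0 < K. Proof. by rewrite divr_gt0// mulr_gt0. Qed.
Let pK : p * K = g11 / 2. Proof. rewrite /K; field; exact: lt0r_neq0. Qed.

Lemma F_ge0 x y : 0 <= x -> 0 <= y -> 0 <= F x y.
Proof.
move=> x0 y0; apply: (near_ge (cvgF x0 y0)) => r /[dup] r01 /andP[r0 _].
by apply: (laplace_ge0 (hphi r01)); rewrite mulr_ge0 ?(ltW r0).
Qed.

(** The limit of r Z1 has mean at most K. *)
Lemma F_at0_le x : 0 <= x -> 1 - F x 0 <= K * x.
Proof.
move=> x0; have E := F_at0 x0.
rewrite -(ler_pM2l p0); have -> : p * (K * x) = g11 * x / 2 by rewrite mulrA pK; ring.
have -> : p * (1 - F x 0) = F x 0 * (g11 * x / 2).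
  by transitivity (F x 0 * (g11 * x / 2 + p) - p * F x 0); [rewrite E|]; ring.
rewrite ler_piMl//; first by rewrite !mulr_ge0// ltW.
have c0 : 0 <= g11 * x / 2 by rewrite !mulr_ge0// ltW.
rewrite -subr_le0 -(pmulr_lle0 _ (ltr_wpDl c0 p0)) mulrBl mul1r E; lra.
Qed.

Lemma F_increment x y : 0 <= x -> 0 <= y -> F 0 y - F x y <= 1 - F x 0.
Proof.
move=> x0 y0; rewrite -subr_ge0.
have c1 := cvgF (lexx 0) y0; have c2 := cvgF x0 y0; have c3 := cvgF x0 (lexx 0).
apply: (@near_ge (fun r => (1 - phi r (r * x) (r * 0)) -
  (phi r (r * 0) (r * y) - phi r (r * x) (r * y)))); first by cvgs.
move=> r /[dup] r01 /andP[r0 _].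
by rewrite mulr0 subr_ge0; apply: (laplace_increment (hphi r01)); rewrite mulr_ge0 ?(ltW r0).
Qed.

Lemma F_antitone x x' y y' : 0 <= x -> x <= x' -> 0 <= y -> y <= y' ->
  F x' y' <= F x y.
Proof.
move=> x0 xx y0 yy; rewrite -subr_ge0.
have c1 := cvgF x0 y0; have c2 := cvgF (le_trans x0 xx) (le_trans y0 yy).
apply: (@near_ge (fun r => phi r (r * x) (r * y) - phi r (r * x') (r * y'))).
  by cvgs.
move=> r /[dup] r01 /andP[r0 _]; rewrite subr_ge0.
by apply: (laplace_antitone (hphi r01)); rewrite ?mulr_ge0 ?(ltW r0)// ler_pM2l.
Qed.

Lemma F_convex x y : 0 <= x -> 0 <= y -> 0 <= F 0 y - 2 * F x y + F (2 * x) y.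
Proof.
move=> x0 y0; have x20 : 0 <= 2 * x by rewrite mulr_ge0.
have c1 := cvgF (lexx 0) y0; have c2 := cvgF x0 y0; have c3 := cvgF x20 y0.
apply: (@near_ge (fun r => phi r (r * 0) (r * y) - 2 * phi r (r * x) (r * y)
  + phi r (r * (2 * x)) (r * y))); first by cvgs.
move=> r /[dup] r01 /andP[r0 _]; rewrite mulr0 mulrCA.
by apply: (laplace_convex (hphi r01)); rewrite mulr_ge0 ?(ltW r0).
Qed.

(** The direction (w, 1), w = - s / p, is orthogonal to the first column of
    the reflection matrix and lies in the quadrant since s <= 0; along it eqF
    reads quad * F = 0. Small points of that direction are close to the axis,
    where F 0 is compared with F by F_increment. *)
Lemma escape_le y : s <= 0 -> 0 < y -> F 0 y <= 0.
Proof.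
move=> s0 y0; pose w := - s / p.
have w0 : 0 <= w by rewrite divr_ge0 ?oppr_ge0 ?(ltW p0).
apply: (@le0_of_le_linear _ _ (K * w) y) => // z z0 zy.
have zw0 : 0 <= z * w by rewrite mulr_ge0// ltW.
have := eqF zw0 (ltW z0).
have -> : z * w * p + z * s = 0 by rewrite /w; field; exact: lt0r_neq0.
rewrite mul0r addr0 => /eqP; rewrite mulf_eq0 gt_eqF/=; last first.
  by apply: quad_gt0; rewrite (gt_eqF z0) orbT.
move=> /eqP Fz.
have := F_increment zw0 (ltW z0); rewrite Fz subr0.
move=> /le_trans /(_ (F_at0_le zw0)); rewrite [z * w]mulrC mulrA => H.
by apply: le_trans H; apply: F_antitone => //; exact: ltW.
Qed.

(** The direction (s, - p) orthogonal to the first column now leaves the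
    quadrant. Writing F 0 z, F z z and F (2 z) z in terms of a1 z by eqF, the
    second difference of F_convex becomes F 0 z * z * (C2 * z - L1) up to
    positive factors, with L1 = 2 * quad s (- p) > 0: it would be negative for
    small z if F 0 were positive near 0. *)
Lemma escape_gt y : 0 < s -> 0 < y -> F 0 y <= 0.
Proof.
move=> s0 y0; rewrite leNgt; apply/negP => Fy.
pose Q1 := quad 1 1; pose Q2 := quad 2 1.
have Q10 : 0 < Q1 by apply: quad_gt0; rewrite oner_neq0.
have Q20 : 0 < Q2 by apply: quad_gt0; rewrite oner_neq0 orbT.
pose C2 := s * Q1 * Q2 - (p + s) * g22 * Q2 + (2 * p + s) * (g22 / 2) * Q1.
pose L1 := s ^+ 2 * g11 - 2 * s * p * g12 + p ^+ 2 * g22.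
have L10 : 0 < L1.
  have := @quad_gt0 s (- p); rewrite oppr_eq0 (gt_eqF p0) orbT => /(_ isT).
  by rewrite /quad /L1; nra.
suff : L1 <= 0 by rewrite leNgt L10.
apply: (@le0_of_le_linear _ _ C2 y) => // z z0 zy.
have Fz : 0 < F 0 z by apply: lt_le_trans Fy _; apply: F_antitone => //; exact: ltW.
have E0 := eqF (lexx 0) (ltW z0).
have E1 := eqF (ltW z0) (ltW z0).
have z20 : 0 <= 2 * z by rewrite mulr_ge0// ltW.
have E2 := eqF z20 (ltW z0).
have V := F_convex (ltW z0) (ltW z0).
have {}E0 : s * a1 z = F 0 z * (g22 * z / 2 + s).
  apply: (@mulfI _ z); first by rewrite gt_eqF.
  by apply/eqP; rewrite eq_sym -subr_eq0 -[X in _ == X]E0 /quad; apply/eqP; ring.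
have {}E1 : F z z * (z * Q1 + p + s) = (p + s) * a1 z.
  apply: (@mulfI _ z); first by rewrite gt_eqF.
  by apply/eqP; rewrite -subr_eq0 -[X in _ == X]E1 /quad /Q1 /quad; apply/eqP; ring.
have {}E2 : F (2 * z) z * (z * Q2 + 2 * p + s) = (2 * p + s) * a1 z.
  apply: (@mulfI _ z); first by rewrite gt_eqF.
  by apply/eqP; rewrite -subr_eq0 -[X in _ == X]E2 /quad /Q2 /quad; apply/eqP; ring.
have D1 : 0 < z * Q1 + p + s by rewrite !addr_gt0// mulr_gt0.
have D2 : 0 < z * Q2 + 2 * p + s by rewrite !addr_gt0 ?mulr_gt0.
set d1 := z * Q1 + p + s in D1 E1 *; set d2 := z * Q2 + 2 * p + s in D2 E2 *.
have : 0 <= s * (d1 * d2) * (F 0 z - 2 * F z z + F (2 * z) z).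
  by rewrite mulr_ge0// mulr_ge0 ?ltW// mulr_gt0.
have -> : s * (d1 * d2) * (F 0 z - 2 * F z z + F (2 * z) z) =
  F 0 z * (s * d1 * d2) - 2 * (p + s) * (s * a1 z) * d2 + (2 * p + s) * (s * a1 z) * d1.
  transitivity (F 0 z * (s * d1 * d2) - 2 * s * (F z z * d1) * d2 + s * (F (2 * z) z * d2) * d1).
    by ring.
  by rewrite E1 E2; ring.
rewrite E0.
have -> : F 0 z * (s * d1 * d2) - 2 * (p + s) * (F 0 z * (g22 * z / 2 + s)) * d2
  + (2 * p + s) * (F 0 z * (g22 * z / 2 + s)) * d1 = (F 0 z * z) * (C2 * z - L1).
  by rewrite /d1 /d2 /C2 /L1 /Q1 /Q2 /quad; field.
by rewrite pmulr_rge0 ?subr_ge0// mulr_gt0.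
Qed.

Lemma escape x y : 0 <= x -> 0 < y -> F x y = 0.
Proof.
move=> x0 y0; apply/eqP; rewrite eq_le F_ge0 ?(ltW y0)// andbT.
apply: (@le_trans _ _ (F 0 y)); first by apply: F_antitone; rewrite ?(ltW y0).
by have [/escape_le|/escape_gt] := leP s 0; apply.
Qed.

(** The same holds under the boundary measure on z1 = 0: by eqF, at any x with
    x p + y s > 0. *)
Lemma escapeA y : 0 < y -> a1 y = 0.
Proof.
move=> y0; pose x := `|s| * y / p + 1.
have x0 : 0 <= x by rewrite addr_ge0// !mulr_ge0 ?invr_ge0// ltW.
have := eqF x0 (ltW y0); rewrite escape// mulr0 add0r => /eqP.
rewrite mulf_eq0 sub0r oppr_eq0 gt_eqF => [/eqP//|].
have -> : x * p + y * s = (`|s| + s) * y + p by rewrite /x; field; exact: lt0r_neq0.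
rewrite ltr_wpDl// mulr_ge0 ?(ltW y0)//.
by rewrite -(opprK s) normrN subr_ge0 ler_norm.
Qed.

(** Z1 is of order r^-1 by F_at0_le, so r^2 Z1 vanishes in the limit. *)
Lemma phi_slow_cvg1 b : 0 <= b -> (fun r => phi r (r ^+ 2 * b) 0) @ U --> (1 : R).
Proof.
move=> b0.
have c : (fun r => phi r (r ^+ 2 * b) 0) @ U --> ulim U (fun r => phi r (r ^+ 2 * b) 0).
  by apply: cvg_phi; apply: filterS near01 => r _; rewrite lexx andbT mulr_ge0// sqr_ge0.
suff -> : 1 = ulim U (fun r => phi r (r ^+ 2 * b) 0) by [].
apply/eqP; rewrite eq_le; apply/andP; split; last first.
  rewrite -subr_ge0; apply: (@near_ge (fun r => 1 - phi r (r ^+ 2 * b) 0)); first by cvgs.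
  move=> r r01; rewrite subr_ge0.
  have /andP[_ //] := @phi01 r (r ^+ 2 * b) 0 r01 (mulr_ge0 (sqr_ge0 _) b0) (lexx 0).
rewrite -subr_le0.
apply: (@le0_of_le_linear _ _ K 1) => // z z0 _.
apply: le_trans (F_at0_le (ltW z0)).
rewrite -subr_ge0; have cz := cvgF (ltW z0) (lexx 0).
apply: (@near_ge_small (fun r => 1 - phi r (r * z) (r * 0) - (1 - phi r (r ^+ 2 * b) 0))
   _ (z / (b + 1))).
- by rewrite divr_gt0// ltr_wpDl.
- by cvgs.
move=> r /[dup] r01 /andP[r0 _]; rewrite ltr_pdivlMr ?ltr_wpDl// => rz.
rewrite mulr0 opprB addrC addrA subrK subr_ge0.
apply: (laplace_antitone (hphi r01)); rewrite ?mulr_ge0 ?(ltW r0) ?sqr_ge0//.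
by rewrite expr2 -mulrA ler_pM2l//; nra.
Qed.

Lemma phi_slow_diff b (c : R -> R) (l : R) : 0 <= b -> (\forall r \near U, 0 <= c r) ->
  (fun r => phi r 0 (c r)) @ U --> l -> (fun r => phi r (r ^+ 2 * b) (c r)) @ U --> l.
Proof.
move=> b0 c0 cl.
have nn : \forall r \near U, (0 <= r ^+ 2 * b) && (0 <= c r).
  by apply: filterS c0 => r ->; rewrite mulr_ge0// sqr_ge0.
have cb := cvg_phi nn.
suff -> : l = ulim U (fun r => phi r (r ^+ 2 * b) (c r)) by [].
have c1 := phi_slow_cvg1 b0.
apply/eqP; rewrite eq_le; apply/andP; split; rewrite -subr_ge0.
  have -> : ulim U (fun r => phi r (r ^+ 2 * b) (c r)) - l =
     (1 - 1) - (l - ulim U (fun r => phi r (r ^+ 2 * b) (c r))) by ring.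
  apply: (@near_geW (fun r => (1 - phi r (r ^+ 2 * b) 0) -
     (phi r 0 (c r) - phi r (r ^+ 2 * b) (c r)))); first by cvgs.
  apply: filterS2 near01 nn => r r01 /andP[? ?].
  by rewrite subr_ge0; exact: (laplace_increment (hphi r01)).
apply: (@near_geW (fun r => phi r 0 (c r) - phi r (r ^+ 2 * b) (c r))).
  by cvgs.
apply: filterS2 near01 nn => r r01 /andP[? ?].
by rewrite subr_ge0; exact: (laplace_antitone (hphi r01)).
Qed.

Section Boundary2.
Variables (b : R).
Hypothesis b0 : 0 < b.
Let cB := ulim U (fun r => B r (r ^+ 2 * b)).
Let l := 1 - cB.

Lemma r2b_ge0 r : 0 <= r ^+ 2 * b.
Proof. by rewrite mulr_ge0 ?sqr_ge0 ?ltW. Qed.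

Lemma cvg_cB : (fun r => B r (r ^+ 2 * b)) @ U --> cB.
Proof. by apply: cvg_AB => //; apply: filterS near01 => r _; exact: r2b_ge0. Qed.

Lemma boundary_defect_ge0 : 0 <= l.
Proof.
have := cvg_cB => c; apply: (@near_ge (fun r => 1 - B r (r ^+ 2 * b))); first by cvgs.
by move=> r r01; rewrite subr_ge0; have /andP[] := hB r01 (r2b_ge0 r).
Qed.

(** The relation at (r^2 b, 0). The limit is b times the mean g11 / (2 p)
    of the limit of r Z1, plus q l / p if a part l of the mass of B escapes. *)
Lemma slow_increment_cvg :
  (fun r => (1 - phi r (r ^+ 2 * b) 0) / r) @ U --> (q * l + g11 * b / 2) / p.
Proof.
have cb := cvg_cB; have cp := phi_slow_cvg1 (ltW b0).
have : (fun r => (q * (phi r (r ^+ 2 * b) 0 - B r (r ^+ 2 * b)) +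
   g11 * b / 2 * phi r (r ^+ 2 * b) 0) / p) @ U --> (q * (1 - cB) + g11 * b / 2 * 1) / p.
  by cvgs.
rewrite mulr1; apply: cvg_trans; apply: near_eq_cvg.
apply: filterS near01 => r /[dup] r01 /andP[r0 _].
have := bar r01 (r2b_ge0 r) (lexx 0); rewrite hA0// => E.
apply: (@mulfI _ (r ^+ 4 * b * p)).
  by rewrite !mulf_neq0// ?expf_neq0 ?gt_eqF.
apply/eqP; rewrite -subr_eq0 -[X in _ == X]E /quad; apply/eqP.
by field; rewrite !gt_eqF.
Qed.

(** Let l >= 0 be the mass of B that escapes. At the scale y of r Z2, let d be
    the limit of the increment phi(0, r y) - phi(r^2 b, r y) divided by r.
    Subtracting the relations at (0, r y) and (r^2 b, r y) gives
    (g22 y / 2 + s) d = t l. Since r Z2 escapes, the weight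
    exp (- r y Z2) leaves to d only the part of Z1 beyond the order r^-1; by
    concavity, p d <= q l. For small y this contradicts p t - q s > 0 unless
    l = 0. *)
Lemma boundary_concentrates : cB = 1.
Proof.
suff : l <= 0.
  by move=> l0; apply/eqP; rewrite eq_sym -subr_eq0 eq_le l0 boundary_defect_ge0.
rewrite leNgt; apply/negP => l0.
pose X := (q * l + g11 * b / 2) / p.
have main y : 0 < y -> exists d, [/\ 0 <= d, p * d <= q * l & (g22 * y / 2 + s) * d = t * l].
  move=> y0.
  pose D r := phi r 0 (r * y) - phi r (r ^+ 2 * b) (r * y).
  pose d := ulim U (fun r => D r / r).
  have cX := slow_increment_cvg.
  have D0 r : 0 < r < 1 -> 0 <= D r.
    move=> /[dup] r01 /andP[r0 _]; rewrite subr_ge0.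
    apply: (laplace_antitone (hphi r01)); rewrite ?lexx ?r2b_ge0 ?mulr_ge0 ?(ltW r0) ?(ltW y0)//.
  have cd : (fun r => D r / r) @ U --> d.
    apply: (@cvg_ulim _ _ _ _ (X + 1)).
    have H : \forall r \near U, (1 - phi r (r ^+ 2 * b) 0) / r < X + 1.
      by apply: (cvgr_lt X) => //; rewrite ltrDl.
    apply: filterS2 near01 H => r /[dup] r01 /andP[r0 _] H.
    rewrite ger0_norm ?divr_ge0 ?D0 ?(ltW r0)//.
    apply: le_trans (ltW H); rewrite ler_pM2r ?invr_gt0//.
    by apply: (laplace_increment (hphi r01)); rewrite ?r2b_ge0// mulr_ge0 ?(ltW r0)// ltW.
  have c0 : (fun r => phi r 0 (r * y)) @ U --> (0 : R).
    have := cvgF (lexx 0) (ltW y0); rewrite (escape (lexx 0) y0).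
    by apply: cvg_trans; apply: near_eq_cvg; apply: filterS near01 => r _; rewrite mulr0.
  have cb : (fun r => phi r (r ^+ 2 * b) (r * y)) @ U --> (0 : R).
    apply: phi_slow_diff => //; first exact: ltW.
    by apply: filterS near01 => r /andP[r0 _]; rewrite mulr_ge0 ?(ltW r0) ?(ltW y0).
  have cA : (fun r => A r (r * y)) @ U --> (0 : R).
    by have := cvga1 (ltW y0); rewrite escapeA.
  have ccB := cvg_cB; have ci := cvg_idU.
  have cD : (fun r => D r) @ U --> (0 - 0 : R) by rewrite /D; cvgs.
  exists d; split.
  - by apply: (near_ge cd) => r /[dup] r01 /andP[r0 _]; rewrite divr_ge0 ?D0 ?(ltW r0).
  - have cmp k : 0 < k -> b * g11 / 2 - p * (X - d) <= (X - d) * g11 / 2 * k.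
      move=> k0; have ck := cvgF (ltW k0) (lexx 0); have cky := cvgF (ltW k0) (ltW y0).
      rewrite (escape (ltW k0) y0) in cky.
      have H : 0 <= k * (X - d) - b * ((1 - F k 0) - (0 - 0)).
        apply: (@near_ge_small (fun r => k * ((1 - phi r (r ^+ 2 * b) 0) / r - D r / r)
          - b * ((1 - phi r (r * k) (r * 0)) - (phi r 0 (r * y) - phi r (r * k) (r * y)))) _ (k / b)).
        + by rewrite divr_gt0.
        + by cvgs.
        move=> r /[dup] r01 /andP[r0 _]; rewrite ltr_pdivlMr// mulr0 => rk.
        have le1 : r ^+ 2 * b <= r * k by rewrite expr2 -mulrA ler_pM2l// ltW.
        have ry0 : 0 <= r * y by rewrite mulr_ge0 ?(ltW r0) ?(ltW y0).
        have := laplace_concaveC (hphi r01) (r2b_ge0 r) le1 ry0.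
        rewrite -subr_ge0.
        rewrite /D; set P1 := phi r (r * k) 0; set P2 := phi r (r ^+ 2 * b) 0.
        set P3 := phi r 0 (r * y); set P4 := phi r (r * k) (r * y); set P5 := phi r (r ^+ 2 * b) (r * y).
        have -> : r * k * (1 - P2 - (P3 - P5)) - r ^+ 2 * b * (1 - P1 - (P3 - P4)) =
          r ^+ 2 * (k * ((1 - P2) / r - (P3 - P5) / r) - b * (1 - P1 - (P3 - P4))).
          by field; rewrite gt_eqF.
        by rewrite pmulr_rge0// exprn_gt0.
      have := F_at0 (ltW k0); set f := F k 0 in H *.
      move=> E; have g0 : 0 < g11 * k / 2 + p by rewrite addr_gt0// !mulr_gt0.
      move: H; rewrite subr0 subr0 -(pmulr_lge0 _ g0).
      have -> : (k * (X - d) - b * (1 - f)) * (g11 * k / 2 + p) =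
        k * (X - d) * (g11 * k / 2 + p) - b * (g11 * k / 2 + p) + b * (f * (g11 * k / 2 + p)) by ring.
      rewrite E.
      have -> : k * (X - d) * (g11 * k / 2 + p) - b * (g11 * k / 2 + p) + b * p =
        k * ((X - d) * g11 / 2 * k - (b * g11 / 2 - p * (X - d))) by ring.
      by rewrite pmulr_rge0// subr_ge0.
    have := @le0_of_le_linear _ _ _ 1 ltr01 (fun k k0 _ => cmp k k0).
    have -> : b * g11 / 2 - p * (X - d) = p * d - q * l.
      by rewrite /X; field; rewrite gt_eqF.
    by rewrite subr_le0.
  apply/eqP; rewrite -subr_eq0; apply/eqP.
  have -> : (g22 * y / 2 + s) * d - t * l =
    (g22 * y / 2 + s) * d + t * ((0 - 0) - (1 - cB)) -
    ((g11 * 0 * b ^+ 2 / (2 * y) + g12 * b) * 0) - b * p / y * (0 - 0) - 0 * b * q / y * (0 - cB).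
    by rewrite /l; ring.
  apply: (@near_eq (fun r => (g22 * y / 2 + s) * (D r / r) + t * (D r - (1 - B r (r ^+ 2 * b))) -
    ((g11 * r * b ^+ 2 / (2 * y) + g12 * b) * phi r (r ^+ 2 * b) (r * y))
     - b * p / y * (phi r (r ^+ 2 * b) (r * y) - A r (r * y))
     - r * b * q / y * (phi r (r ^+ 2 * b) (r * y) - B r (r ^+ 2 * b)))).
    by cvgs.
  move=> r /[dup] r01 /andP[r0 _].
  have ry0 : 0 <= r * y by rewrite mulr_ge0 ?(ltW r0) ?(ltW y0).
  have E1 := bar r01 (lexx 0) ry0.
  have E2 := bar r01 (r2b_ge0 r) ry0.
  apply: (@mulfI _ (r ^+ 3 * y)); first by rewrite mulf_neq0 ?expf_neq0 ?gt_eqF.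
  rewrite mulr0 -[RHS](subrr 0) -{2}E2 -[X in _ = X - _]E1 /D /quad hB0//.
  by field; rewrite !gt_eqF.
have [d [d0 dq E]] := main 1 ltr01.
have tl : 0 < t * l by rewrite mulr_gt0.
have dp : 0 < d by rewrite lt_neqAle d0 andbT; apply/eqP => d00; rewrite -E -d00 mulr0 ltxx in tl.
have q0 : 0 < q.
  have : 0 < q * l by apply: lt_le_trans dq; rewrite mulr_gt0.
  by rewrite pmulr_lgt0.
(* the y for which (g22 y / 2 + s) q is halfway between s q and p t *)
have [d' [d'0 d'q E']] := main ((p * t - q * s) / (g22 * q)) (divr_gt0 det0 (mulr_gt0 g22_gt0 q0)).
have : p * (t * l) = (g22 * ((p * t - q * s) / (g22 * q)) / 2 + s) * (p * d').
  by rewrite -E'; ring.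
have -> : g22 * ((p * t - q * s) / (g22 * q)) / 2 + s = (p * t + q * s) / (2 * q).
  by field; rewrite !gt_eqF.
move=> E2.
have c0 : 0 < (p * t + q * s) / (2 * q).
  rewrite ltNge; apply/negP => c0.
  have : 0 < p * (t * l) by rewrite mulr_gt0.
  by rewrite E2 ltNge mulr_le0_ge0// mulr_ge0// ltW.
have : p * (t * l) <= (p * t + q * s) / (2 * q) * (q * l) by rewrite E2 ler_pM2l.
have -> : (p * t + q * s) / (2 * q) * (q * l) = (p * t + q * s) / 2 * l.
  by field; rewrite gt_eqF.
rewrite mulrA ler_pM2r// => H; move: det0 H; rewrite -subr_ge0; lra.
Qed.

End Boundary2.

(* Each coordinate at its own scale. *)
Let G x y := ulim U (fun r => phi r (r * x) (r ^+ 2 * y)).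

Lemma cvgG x y : 0 <= x -> 0 <= y ->
  (fun r => phi r (r * x) (r ^+ 2 * y)) @ U --> G x y.
Proof.
move=> x0 y0; apply: cvg_phi; apply: filterS near01 => r /andP[r0 _].
by rewrite !mulr_ge0 ?sqr_ge0 ?(ltW r0).
Qed.

Lemma cvgG0 y : 0 <= y -> (fun r => phi r 0 (r ^+ 2 * y)) @ U --> G 0 y.
Proof.
move=> y0; have := cvgG (lexx 0) y0.
by apply: cvg_trans; apply: near_eq_cvg; apply: filterS near01 => r _; rewrite mulr0.
Qed.

(** In the relation at (r x, r^2 y) only the terms in x survive, so the factor
    in x is the one found at y = 0: this is the asymptotic independence. *)
Lemma G_product x y : 0 <= x -> 0 <= y -> G x y * (g11 * x / 2 + p) = p * G 0 y.
Proof.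
move=> x0 y0; pose a2 := ulim U (fun r => A r (r ^+ 2 * y)).
have cA : (fun r => A r (r ^+ 2 * y)) @ U --> a2.
  by apply: cvg_AB => //; apply: filterS near01 => r _; rewrite mulr_ge0// sqr_ge0.
have ci := cvg_idU; have c0 := cvgG0 y0.
have eqG z : 0 < z -> G z y * (g11 * z / 2 + p) = p * a2.
  move=> z0; have cz := cvgG (ltW z0) y0.
  have cB : (fun r => B r (r * z)) @ U --> ulim U (fun r => B r (r * z)).
    apply: cvg_AB => //; apply: filterS near01 => r /andP[r0 _].
    by rewrite mulr_ge0 ?(ltW r0) ?(ltW z0).
  set bz := ulim U _ in cB.
  apply: (@mulfI _ z); first by rewrite gt_eqF.
  apply/eqP; rewrite -subr_eq0; apply/eqP.
  have -> : z * (G z y * (g11 * z / 2 + p)) - z * (p * a2) =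
    (g11 * z ^+ 2 / 2 + 0 * (g12 * z * y) + 0 * 0 * (g22 * y ^+ 2 / 2)) * G z y +
    (z * p + 0 * y * s) * (G z y - a2) + 0 * (z * q + 0 * y * t) * (G z y - bz) by ring.
  apply: (@near_eq (fun r => (g11 * z ^+ 2 / 2 + r * (g12 * z * y) +
      r * r * (g22 * y ^+ 2 / 2)) * phi r (r * z) (r ^+ 2 * y) +
    (z * p + r * y * s) * (phi r (r * z) (r ^+ 2 * y) - A r (r ^+ 2 * y)) +
     r * (z * q + r * y * t) * (phi r (r * z) (r ^+ 2 * y) - B r (r * z)))).
    by cvgs.
  move=> r /[dup] r01 /andP[r0 _].
  have := @bar r (r * z) (r ^+ 2 * y) r01; rewrite !mulr_ge0 ?sqr_ge0 ?(ltW r0) ?(ltW z0)//.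
  move=> /(_ isT isT) E; apply: (@mulfI _ (r ^+ 2)); first by rewrite expf_neq0 ?gt_eqF.
  by rewrite mulr0 -[RHS]E /quad; ring.
have G0 z : 0 <= z -> 0 <= G z y <= 1.
  move=> z0; have cz := cvgG z0 y0; apply/andP; split; [|rewrite -subr_ge0].
    apply: (near_ge cz) => r /[dup] r01 /andP[r0 _].
    by apply: (laplace_ge0 (hphi r01)); rewrite mulr_ge0 ?sqr_ge0 ?(ltW r0).
  apply: (@near_ge (fun r => 1 - phi r (r * z) (r ^+ 2 * y))); first by cvgs.
  move=> r /[dup] r01 /andP[r0 _]; rewrite subr_ge0.
  have r1 : 0 <= r * z by rewrite mulr_ge0 ?(ltW r0).
  have r2 : 0 <= r ^+ 2 * y by rewrite mulr_ge0 ?sqr_ge0.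
  by have /andP[] := phi01 r01 r1 r2.
have G00 : a2 = G 0 y.
  have /andP[g0 g1] := G0 0 (lexx 0).
  apply/eqP; rewrite eq_le; apply/andP; split; rewrite -subr_le0.
    apply: (@le0_of_le_linear _ _ K 1) => // z z0 _.
    have E := eqG z z0; have /andP[Gz0 Gz1] := G0 z (ltW z0).
    have cz := cvgG (ltW z0) y0.
    have le1 : G z y <= G 0 y.
      rewrite -subr_ge0; apply: (@near_ge (fun r => phi r 0 (r ^+ 2 * y) - phi r (r * z) (r ^+ 2 * y))).
        by cvgs.
      move=> r /[dup] r01 /andP[r0 _]; rewrite subr_ge0.
      by apply: (laplace_antitone (hphi r01)); rewrite ?mulr_ge0 ?sqr_ge0 ?(ltW r0) ?(ltW z0).
    rewrite -(ler_pM2l p0) mulrBr -E mulrA pK.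
    have : G z y * (g11 * z / 2) <= g11 * z / 2.
      by rewrite ler_piMl// !mulr_ge0// ltW.
    have : p * G z y <= p * G 0 y by rewrite ler_pM2l.
    have -> : G z y * (g11 * z / 2 + p) = G z y * (g11 * z / 2) + p * G z y by ring.
    have -> : g11 / 2 * z = g11 * z / 2 by ring.
    lra.
  apply: (@le0_of_le_linear _ _ K 1) => // z z0 _.
  have E := eqG z z0; have /andP[Gz0 Gz1] := G0 z (ltW z0).
  have cz := cvgG (ltW z0) y0; have fz := cvgF (ltW z0) (lexx 0).
  have le1 : G 0 y - G z y <= 1 - F z 0.
    rewrite -subr_ge0; apply: (@near_ge (fun r => 1 - phi r (r * z) (r * 0) -
       (phi r 0 (r ^+ 2 * y) - phi r (r * z) (r ^+ 2 * y)))).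
      by cvgs.
    move=> r /[dup] r01 /andP[r0 _]; rewrite subr_ge0 mulr0.
    by apply: (laplace_increment (hphi r01)); rewrite ?mulr_ge0 ?sqr_ge0 ?(ltW r0) ?(ltW z0).
  have le2 : G z y <= a2.
    rewrite -(ler_pM2l p0) -E.
    have : 0 <= G z y * (g11 * z / 2) by rewrite !mulr_ge0// ltW.
    have -> : G z y * (g11 * z / 2 + p) = G z y * (g11 * z / 2) + p * G z y by ring.
    lra.
  have := F_at0_le (ltW z0); lra.
move: x0; rewrite le_eqVlt => /orP[/eqP <-|x0]; last by rewrite eqG// G00.
by ring.
Qed.

(** Asymptotic independence at a finer level: the weight exp (- r^2 y Z2) only
    contributes the factor G 0 y to the limit of slow_increment_cvg, where l = 0
    by boundary_concentrates. The increment r^2 b is compared with r k, k small,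
    by concavity under the weight (lower bound) and under its complement (upper
    bound). *)
Lemma slow_increment_weighted b y : 0 < b -> 0 <= y ->
  (fun r => (phi r 0 (r ^+ 2 * y) - phi r (r ^+ 2 * b) (r ^+ 2 * y)) / r) @ U -->
  b * g11 / (2 * p) * G 0 y.
Proof.
move=> b0 y0.
pose D r := phi r 0 (r ^+ 2 * y) - phi r (r ^+ 2 * b) (r ^+ 2 * y).
have cX : (fun r => (1 - phi r (r ^+ 2 * b) 0) / r) @ U --> b * g11 / (2 * p).
  have -> : b * g11 / (2 * p) = (q * (1 - 1) + g11 * b / 2) / p.
    by field; exact: lt0r_neq0.
  by have := slow_increment_cvg b0; rewrite boundary_concentrates.
have r2y r : 0 <= r ^+ 2 * y by rewrite mulr_ge0 ?sqr_ge0.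
set X := b * g11 / (2 * p) in cX *.
pose e := ulim U (fun r => D r / r).
have D0 r : 0 < r < 1 -> 0 <= D r.
  move=> /[dup] r01 /andP[r0 _]; rewrite subr_ge0.
  by apply: (laplace_antitone (hphi r01)); rewrite ?lexx ?(r2b_ge0 b0).
have ce : (fun r => D r / r) @ U --> e.
  apply: (@cvg_ulim _ _ _ _ (X + 1)).
  have H : \forall r \near U, (1 - phi r (r ^+ 2 * b) 0) / r < X + 1.
    by apply: (cvgr_lt X) => //; rewrite ltrDl.
  apply: filterS2 near01 H => r /[dup] r01 /andP[r0 _] H.
  rewrite ger0_norm ?divr_ge0 ?D0 ?(ltW r0)//.
  apply: le_trans (ltW H); rewrite ler_pM2r ?invr_gt0//.
  by apply: (laplace_increment (hphi r01)); rewrite ?(r2b_ge0 b0).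
suff <- : e = X * G 0 y by [].
have step k : 0 < k -> b * (G 0 y - G k y) <= k * e /\
    b * ((1 - F k 0) - (G 0 y - G k y)) <= k * (X - e).
  move=> k0; have ck := cvgG (ltW k0) y0; have c0 := cvgG0 y0.
  have cF := cvgF (ltW k0) (lexx 0).
  split; rewrite -subr_ge0.
    apply: (@near_ge_small (fun r => k * (D r / r) -
       b * (phi r 0 (r ^+ 2 * y) - phi r (r * k) (r ^+ 2 * y))) _ (k / b)).
    + by rewrite divr_gt0.
    + by cvgs.
    move=> r /[dup] r01 /andP[r0 _]; rewrite ltr_pdivlMr// => rk.
    have le1 : r ^+ 2 * b <= r * k by rewrite expr2 -mulrA ler_pM2l// ltW.
    have := laplace_concave (hphi r01) (r2b_ge0 b0 r) le1 (r2y r); rewrite -subr_ge0 /D.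
    set P3 := phi r 0 _; set P4 := phi r (r * k) _; set P5 := phi r (r ^+ 2 * b) _.
    have -> : r * k * (P3 - P5) - r ^+ 2 * b * (P3 - P4) =
      r ^+ 2 * (k * ((P3 - P5) / r) - b * (P3 - P4)) by field; rewrite gt_eqF.
    by rewrite pmulr_rge0// exprn_gt0.
  apply: (@near_ge_small (fun r => k * ((1 - phi r (r ^+ 2 * b) 0) / r - D r / r) -
     b * ((1 - phi r (r * k) (r * 0)) - (phi r 0 (r ^+ 2 * y) - phi r (r * k) (r ^+ 2 * y)))) _ (k / b)).
  + by rewrite divr_gt0.
  + by cvgs.
  move=> r /[dup] r01 /andP[r0 _]; rewrite ltr_pdivlMr// mulr0 => rk.
  have le1 : r ^+ 2 * b <= r * k by rewrite expr2 -mulrA ler_pM2l// ltW.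
  have := laplace_concaveC (hphi r01) (r2b_ge0 b0 r) le1 (r2y r); rewrite -subr_ge0 /D.
  set P1 := phi r (r * k) 0; set P2 := phi r (r ^+ 2 * b) 0.
  set P3 := phi r 0 _; set P4 := phi r (r * k) _; set P5 := phi r (r ^+ 2 * b) _.
  have -> : r * k * (1 - P2 - (P3 - P5)) - r ^+ 2 * b * (1 - P1 - (P3 - P4)) =
      r ^+ 2 * (k * ((1 - P2) / r - (P3 - P5) / r) - b * (1 - P1 - (P3 - P4))).
    by field; rewrite gt_eqF.
  by rewrite pmulr_rge0// exprn_gt0.
have pX : p * X = b * g11 / 2 by rewrite /X; field; exact: lt0r_neq0.
have gk k : 0 < k -> 0 < g11 * k / 2 + p by move=> k0; rewrite addr_gt0// !mulr_gt0.
apply/eqP; rewrite eq_le; apply/andP; split; rewrite -subr_le0 -(pmulr_rle0 _ p0).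
  apply: (@le0_of_le_linear _ _ ((X - e) * g11 / 2) 1) => // k k0 _.
  have [_] := step k k0; have E1 := F_at0 (ltW k0); have E2 := G_product (ltW k0) y0.
  rewrite -subr_ge0 -(pmulr_lge0 _ (gk _ k0)).
  have -> : (k * (X - e) - b * (1 - F k 0 - (G 0 y - G k y))) * (g11 * k / 2 + p) =
    k * (X - e) * (g11 * k / 2 + p) - b * (g11 * k / 2 + p) +
    b * (F k 0 * (g11 * k / 2 + p)) + b * (G 0 y * (g11 * k / 2 + p)) -
    b * (G k y * (g11 * k / 2 + p)) by ring.
  rewrite E1 E2.
  have -> : k * (X - e) * (g11 * k / 2 + p) - b * (g11 * k / 2 + p) + b * p +
    b * (G 0 y * (g11 * k / 2 + p)) - b * (p * G 0 y) =
    k * ((X - e) * g11 / 2 * k - (p * e - b * g11 / 2 * G 0 y)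
         + (p * X - b * g11 / 2)) by ring.
  rewrite pX subrr addr0 pmulr_rge0// subr_ge0; apply: le_trans.
  by rewrite mulrBr mulrA pX.
apply: (@le0_of_le_linear _ _ (e * g11 / 2) 1) => // k k0 _.
have [+ _] := step k k0; have E2 := G_product (ltW k0) y0.
rewrite -subr_ge0 -(pmulr_lge0 _ (gk _ k0)).
have -> : (k * e - b * (G 0 y - G k y)) * (g11 * k / 2 + p) =
  k * e * (g11 * k / 2 + p) - b * (G 0 y * (g11 * k / 2 + p)) +
  b * (G k y * (g11 * k / 2 + p)) by ring.
rewrite E2.
have -> : k * e * (g11 * k / 2 + p) - b * (G 0 y * (g11 * k / 2 + p)) + b * (p * G 0 y) =
  k * (e * g11 / 2 * k - (b * g11 / 2 * G 0 y - p * e)) by ring.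
by rewrite pmulr_rge0// subr_ge0; apply: le_trans; rewrite mulrBr mulrA pX.
Qed.

Let w := - s / p.

Lemma reflection2_gt0 : 0 < w * q + t.
Proof.
have -> : w * q + t = (p * t - q * s) / p by rewrite /w; field; exact: lt0r_neq0.
by rewrite divr_gt0.
Qed.

(** Along r^2 y (w, 1) the boundary z1 = 0 contributes nothing to the relation.
    If s > 0 this direction leaves the quadrant; twice the relation at
    (0, r^2 y), minus the relation at (r^2 b, r^2 y) with b = - y w, also gets
    rid of A, at the price of an increment in the first argument, whose limit
    is slow_increment_weighted. *)
Lemma G_at0 y : 0 <= y -> G 0 y * (y * quad w 1 + (w * q + t)) = w * q + t.
Proof.
rewrite le_eqVlt => /orP[/eqP <-|y0].
  suff -> : G 0 0 = 1 by rewrite mul0r add0r mul1r.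
  apply: (ultra_unique UU (cvgG (lexx 0) (lexx 0))); apply: cvg_near_cst.
  by apply: filterS near01 => r r01; rewrite !mulr0; exact: (laplace_at0 (hphi r01)).
have c0 := cvgG0 (ltW y0).
have r2y r : 0 <= r ^+ 2 * y by rewrite mulr_ge0 ?sqr_ge0// ltW.
have [s0|s0] := leP s 0.
  have w0 : 0 <= y * w by rewrite mulr_ge0 ?(ltW y0)// divr_ge0 ?oppr_ge0 ?(ltW p0).
  have cB : (fun r => B r (r ^+ 2 * (y * w))) @ U --> (1 : R).
    move: w0; rewrite le_eqVlt => /orP[/eqP <-|w0].
      by apply: cvg_near_cst; apply: filterS near01 => r r01; rewrite mulr0 hB0.
    by have := cvg_cB w0; rewrite boundary_concentrates.
  have cw : (fun r => phi r (r ^+ 2 * (y * w)) (r ^+ 2 * y)) @ U --> G 0 y.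
    by apply: phi_slow_diff => //; apply: filterS near01.
  apply/eqP; rewrite -subr_eq0; apply/eqP.
  have -> : G 0 y * (y * quad w 1 + (w * q + t)) - (w * q + t) =
    y * quad w 1 * G 0 y + (w * q + t) * (G 0 y - 1) by ring.
  apply: (@near_eq (fun r => y * quad w 1 * phi r (r ^+ 2 * (y * w)) (r ^+ 2 * y) +
    (w * q + t) * (phi r (r ^+ 2 * (y * w)) (r ^+ 2 * y) - B r (r ^+ 2 * (y * w))))).
    by cvgs.
  move=> r /[dup] r01 /andP[r0 _].
  have wr : 0 <= r ^+ 2 * (y * w) by rewrite mulr_ge0 ?sqr_ge0.
  have := bar r01 wr (r2y r).
  have -> : r ^+ 2 * (y * w) * p + r ^+ 2 * y * s = 0.
    by rewrite /w; field; exact: lt0r_neq0.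
  rewrite mulr0 mul0r addr0 => E.
  apply: (@mulfI _ (r ^+ 4 * y)); first by rewrite mulf_neq0 ?expf_neq0 ?gt_eqF.
  by rewrite mulr0 -[RHS]E /quad; ring.
pose b := y * (- w).
have b0 : 0 < b by rewrite mulr_gt0// oppr_gt0 /w mulNr oppr_lt0 divr_gt0.
have cB : (fun r => B r (r ^+ 2 * b)) @ U --> (1 : R).
  by have := cvg_cB b0; rewrite boundary_concentrates.
have cb : (fun r => phi r (r ^+ 2 * b) (r ^+ 2 * y)) @ U --> G 0 y.
  by apply: phi_slow_diff => //; [exact: ltW|exact: filterS near01].
have cD := slow_increment_weighted b0 (ltW y0).
apply: (@mulfI _ y); first by rewrite gt_eqF.
apply/eqP; rewrite -subr_eq0; apply/eqP.
have -> : y * (G 0 y * (y * quad w 1 + (w * q + t))) - y * (w * q + t) =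
  g22 * y ^+ 2 * G 0 y - quad b y * G 0 y + 2 * y * s * (b * g11 / (2 * p) * G 0 y)
   + (2 * y * t * (G 0 y - 1) - (b * q + y * t) * (G 0 y - 1)).
  by rewrite /quad /b /w; field; exact: lt0r_neq0.
apply: (@near_eq (fun r => g22 * y ^+ 2 * phi r 0 (r ^+ 2 * y) -
  quad b y * phi r (r ^+ 2 * b) (r ^+ 2 * y) +
  2 * y * s * ((phi r 0 (r ^+ 2 * y) - phi r (r ^+ 2 * b) (r ^+ 2 * y)) / r) +
  (2 * y * t * (phi r 0 (r ^+ 2 * y) - 1) -
   (b * q + y * t) * (phi r (r ^+ 2 * b) (r ^+ 2 * y) - B r (r ^+ 2 * b))))).
  by cvgs.
move=> r /[dup] r01 /andP[r0 _].
have E1 := bar r01 (lexx 0) (r2y r).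
have E2 := bar r01 (r2b_ge0 b0 r) (r2y r).
apply: (@mulfI _ (r ^+ 4)); first by rewrite expf_neq0 ?gt_eqF.
have E3 : b * p = y * s by rewrite /b /w; field; exact: lt0r_neq0.
move: E2; have -> : r ^+ 2 * b * p + r ^+ 2 * y * s = 2 * r ^+ 2 * (y * s).
  by rewrite -mulrA E3; ring.
move=> E2.
transitivity (2 * 0 - 0 : R); last by rewrite mulr0 mulr0 subr0.
have := congr2 (fun u v : R => 2 * u - v) E1 E2 => /= <-; rewrite /quad hB0//.
by field; rewrite !gt_eqF.
Qed.

Lemma laplace_cvg_ultra x y : 0 <= x -> 0 <= y ->
  (fun r => phi r (r * x) (r ^+ 2 * y)) @ U -->
  (1 + g11 / (2 * p) * x)^-1 * (1 + quad w 1 / (w * q + t) * y)^-1.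
Proof.
move=> x0 y0; suff <- : G x y = (1 + g11 / (2 * p) * x)^-1 * (1 + quad w 1 / (w * q + t) * y)^-1.
  exact: cvgG.
have E1 := G_product x0 y0; have E2 := G_at0 y0.
have Qw : 0 < quad w 1 by apply: quad_gt0; rewrite oner_neq0 orbT.
have r2 := reflection2_gt0.
have k1 : 0 < g11 * x / 2 + p by rewrite ltr_wpDl// !mulr_ge0// ltW.
have k2 : 0 < y * quad w 1 + (w * q + t) by rewrite ltr_wpDl// mulr_ge0// ltW.
have -> : G x y = p * G 0 y / (g11 * x / 2 + p) by rewrite -E1 mulfK// gt_eqF.
have -> : G 0 y = (w * q + t) / (y * quad w 1 + (w * q + t)) by apply: (canRL (mulfK _)) => //; rewrite gt_eqF.
set Qq := quad w 1 in Qw k2 *; set v := w * q + t in r2 k2 *.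
by field; rewrite !gt_eqF//; lra.
Qed.

End AlongUltra.

Theorem laplace_cvg x y : 0 <= x -> 0 <= y ->
  (fun r => phi r (r * x) (r ^+ 2 * y)) @ (0:R)^'+ -->
  (1 + g11 / (2 * p) * x)^-1 * (1 + quad (- s / p) 1 / (- s / p * q + t) * y)^-1.
Proof.
by move=> x0 y0; apply: cvg_ultra => U UU U0; exact: laplace_cvg_ultra.
Qed.
End Asymptotics.

(** * Riemann-Stieltjes sums over dyadic partitions *)

Section DyadicSums.
Variable R : realType.
Implicit Types (f g y z : R -> R) (n m : nat).

Definition dyadic n (i : nat) : R := i%:R / 2 ^+ n.

Lemma dyadic01 n i : (i <= 2 ^ n)%N -> 0 <= dyadic n i <= 1.
Proof.
move=> le_i; rewrite divr_ge0 ?exprn_ge0//= ler_pdivrMr ?exprn_gt0// mul1r.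
by rewrite -natrX ler_nat.
Qed.

Lemma dyadic0 n : dyadic n 0 = 0. Proof. by rewrite /dyadic mul0r. Qed.

Lemma dyadic1 n : dyadic n (2 ^ n) = 1.
Proof. by rewrite /dyadic natrX divff// expf_neq0. Qed.

Lemma dyadicD n m i : dyadic (n + m) (i * 2 ^ m) = dyadic n i.
Proof.
by rewrite /dyadic natrM natrX exprD invfM mulrACA divff ?mulr1// expf_neq0.
Qed.

Lemma ler_dyadic n i j : (i <= j)%N -> dyadic n i <= dyadic n j.
Proof. by move=> ij; rewrite ler_pM2r ?invr_gt0 ?exprn_gt0// ler_nat. Qed.

Lemma dyadicB n i j : (i <= j)%N -> dyadic n j - dyadic n i = dyadic n (j - i).
Proof. by move=> ij; rewrite /dyadic -mulrBl -natrB. Qed.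

Lemma dyadic_step n i : dyadic n i.+1 - dyadic n i = (2 ^+ n)^-1.
Proof. by rewrite dyadicB// subSnn /dyadic mul1r. Qed.

Definition unif_cont01 f := forall e : R, 0 < e -> exists N, forall s t,
  0 <= s <= 1 -> 0 <= t <= 1 -> `|s - t| <= (2 ^+ N)^-1 -> `|f s - f t| <= e.

Lemma half_exp_small (e : R) : 0 < e -> exists N, (2 ^+ N)^-1 < e.
Proof.
move=> e0; exists (Num.truncn e^-1).
rewrite invf_plt ?posrE ?exprn_gt0//.
apply: lt_le_trans (Num.Theory.truncnS_gt _) _.
by rewrite -natrX ler_nat ltn_expl.
Qed.

(** Heine's theorem, from the covering form of the compactness of [0, 1]. *)
Lemma within_unif_cont01 f : {within `[0, 1]%classic, continuous f} -> unif_cont01 f.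
Proof.
move=> /subspace_continuousP cf e e0.
have := (@segment_compact R 0 1) => /compact_near_coveringP /near_covering_withinP.
move=> /(_ nat \oo (fun N s => forall t, 0 <= t <= 1 ->
   `|s - t| <= (2 ^+ N)^-1 -> `|f s - f t| <= e)).
case.
  move=> x /= x01.
  have e2 : 0 < e / 2 by rewrite divr_gt0.
  have /(cvgr_dist_le) /(_ _ e2) := cf x x01.
  rewrite near_withinE => /nbhs_ballP[d /= d0 dP].
  have [N hN] := half_exp_small (divr_gt0 d0 (ltr0n R 2)).
  exists (ball x (d / 2), [set n | (N <= n)%N]).
    split => /=; first by apply: nbhsx_ballx; rewrite divr_gt0.
    by exists N.
  move=> [s n] /= [xs Nn] s01 t t01 st.
  have E1 : `|f x - f s| <= e / 2.
    apply: dP; last exact: s01.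
    by apply: le_ball xs; move: d0; lra.
  have E2 : `|f x - f t| <= e / 2.
    apply: dP; last by rewrite /= in_itv.
    rewrite /ball /= in xs *.
    rewrite -(subrKA s) (le_lt_trans (ler_normD _ _))// [ltRHS](splitr d).
    apply: ltr_leD => //; apply: le_trans st _; apply: le_trans (ltW hN).
    by rewrite lef_pV2 ?posrE ?exprn_gt0// ler_weXn2l// ler1n.
  rewrite -(subrKA (f x)) (le_trans (ler_normD _ _))// [leRHS](splitr e).
  by rewrite lerD// distrC.
move=> N _ /(_ N (leqnn N)) H; exists N => s t s01 t01 st.
by apply: (H s) => //=; rewrite in_itv.
Qed.

Definition rs_term g y n i :=
  g (dyadic n i.+1) * (y (dyadic n i.+1) - y (dyadic n i)).

Definition rs_sum g y n := \sum_(0 <= i < 2 ^ n) rs_term g y n i.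

Definition nondecreasing01 y := forall s t, 0 <= s -> s <= t -> t <= 1 -> y s <= y t.

Lemma increment_ge0 y n i : nondecreasing01 y -> (i < 2 ^ n)%N ->
  0 <= y (dyadic n i.+1) - y (dyadic n i).
Proof.
move=> ym lt_i; rewrite subr_ge0; apply: ym; last by case/andP: (dyadic01 lt_i).
  by rewrite divr_ge0 ?exprn_ge0.
by apply: ler_dyadic.
Qed.

Lemma sum_increments y n :
  \sum_(0 <= i < 2 ^ n) (y (dyadic n i.+1) - y (dyadic n i)) = y 1 - y 0.
Proof.
by rewrite telescope_sumr// dyadic1 dyadic0.
Qed.

Lemma sum_increments_le (c : nat -> R) (e : R) y n : nondecreasing01 y ->
  (forall i, (i < 2 ^ n)%N -> 0 < y (dyadic n i.+1) - y (dyadic n i) -> `|c i| <= e) ->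
  `|\sum_(0 <= i < 2 ^ n) c i * (y (dyadic n i.+1) - y (dyadic n i))|
    <= e * (y 1 - y 0).
Proof.
move=> ym ce; rewrite -(sum_increments y n) mulr_sumr.
apply: le_trans (ler_norm_sum _ _ _) _.
rewrite big_nat_cond [leRHS]big_nat_cond.
apply: ler_sum => i; rewrite andbT => /andP[_ lt_i].
have := increment_ge0 ym lt_i; rewrite le_eqVlt => /orP[/eqP <-|d0].
  by rewrite !mulr0 normr0.
by rewrite normrM (gtr0_norm d0) ler_pM2r// ce.
Qed.

(** Both sums are sums over the finer partition; the points where g is evaluated
    differ by at most one step of the coarser one. *)
Lemma rs_sum_refine g y n m (e : R) : nondecreasing01 y ->
  (forall s t, 0 <= s <= 1 -> 0 <= t <= 1 -> `|s - t| <= (2 ^+ n)^-1 ->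
     `|g s - g t| <= e) ->
  `|rs_sum g y (n + m) - rs_sum g y n| <= e * (y 1 - y 0).
Proof.
move=> ym ge.
have p2 : (0 < 2 ^ m)%N by rewrite expn_gt0.
have -> : rs_sum g y n = \sum_(0 <= j < 2 ^ (n + m))
    g (dyadic n (j %/ 2 ^ m).+1) * (y (dyadic (n + m) j.+1) - y (dyadic (n + m) j)).
  rewrite expnD big_nat_mul; apply: eq_big_nat => i _.
  rewrite [RHS](_ : _ = \sum_(i * 2 ^ m <= j < i.+1 * 2 ^ m)
    g (dyadic n i.+1) * (y (dyadic (n + m) j.+1) - y (dyadic (n + m) j))).
    rewrite -mulr_sumr telescope_sumr ?leq_mul2r ?leqnSn ?orbT//.
    by rewrite !dyadicD.
  apply: eq_big_nat => j /andP[ij ji]; congr (g (dyadic n _.+1) * _).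
  apply/eqP; rewrite eqn_leq leq_divRL// ij andbT -ltnS ltn_divLR//.
rewrite /rs_sum -sumrB.
under eq_bigr do rewrite /rs_term -mulrBl.
apply: sum_increments_le => // j lt_j _; apply: ge.
- exact: dyadic01.
- by apply: dyadic01; rewrite ltn_divLR// -expnD.
rewrite -(dyadicD n m).
have h1 : (j.+1 <= (j %/ 2 ^ m).+1 * 2 ^ m)%N by rewrite -ltn_divLR.
have h2 : ((j %/ 2 ^ m).+1 * 2 ^ m - j.+1 <= 2 ^ m)%N.
  by rewrite mulSn leq_subLR [leqLHS]addnC leq_add2r leqW// leq_divM.
rewrite distrC ger0_norm ?subr_ge0 ?ler_dyadic// dyadicB//.
have -> : (2 ^+ n)^-1 = dyadic (n + m) (1 * 2 ^ m) by rewrite dyadicD /dyadic mul1r.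
by rewrite ler_dyadic// mul1n.
Qed.

Definition rs_int g y := lim (rs_sum g y @ \oo).

Lemma rs_sum_cvg g y : unif_cont01 g -> nondecreasing01 y ->
  rs_sum g y @ \oo --> rs_int g y.
Proof.
move=> gu ym; apply: cauchy_cvg; apply: cauchy_exP => e e0.
have y0 : 0 <= y 1 - y 0 by rewrite subr_ge0 ym.
have [N hN] := gu (e / (y 1 - y 0 + 1)) (divr_gt0 e0 (ltr_wpDl y0 ltr01)).
exists (rs_sum g y N); exists N => // n /= Nn.
rewrite /ball /= distrC -(subnKC Nn).
apply: le_lt_trans (rs_sum_refine _ ym hN) _.
rewrite mulrAC ltr_pdivrMr ?ltr_wpDl// ltr_pM2l//; lra.
Qed.

End DyadicSums.

(** * Jumps of an exponential along a reflected path *)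

Section ReflectedPaths.
Variable R : realType.
Implicit Types (y z : R -> R).

Lemma cvg_dist_eps (u v : nat -> R) (l K : R) :
  v @ \oo --> l ->
  (forall e, 0 < e -> exists N, forall n, (N <= n)%N -> `|u n - v n| <= K * e) ->
  u @ \oo --> l.
Proof.
move=> vl H; have [k [k0 Kk]] : exists k : R, 0 < k /\ K <= k.
  by exists (`|K| + 1); rewrite ltr_wpDl//; split => //; rewrite ler_wpDr// ler_norm.
have uv : (fun n => u n - v n) @ \oo --> (0 : R).
  apply/cvgrPdist_le => e e0.
  have [N hN] := H (e / k) (divr_gt0 e0 k0).
  exists N => // n /= /hN h; rewrite sub0r normrN; apply: le_trans h _.
  rewrite mulrCA -[leRHS]mulr1 ler_pM2l// ler_pdivrMr// mul1r//.
rewrite -[l]add0r (_ : u = fun n => (u n - v n) + v n); first by cvgs.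
by apply/funext => n; rewrite subrK.
Qed.

Lemma expRN_dist (u v : R) : 0 <= u -> 0 <= v -> `|expR (- u) - expR (- v)| <= `|u - v|.
Proof.
wlog uv : u v / u <= v.
  move=> H u0 v0; have [uv|/ltW vu] := leP u v; first exact: H.
  by rewrite distrC [leRHS]distrC; exact: H.
move=> u0 v0; rewrite ger0_norm ?subr_ge0 ?ler_expR ?lerN2// ler0_norm ?subr_le0//.
have -> : expR (- v) = expR (- u) * expR (- (v - u)) by rewrite -expRD; congr expR; ring.
have h1 : 1 - expR (- (v - u)) <= v - u by have := expR_ge1Dx (- (v - u)); lra.
have h2 : expR (- u) <= 1 by rewrite expR_le1 oppr_le0.
have h3 : 0 <= 1 - expR (- (v - u)) by rewrite subr_ge0 expR_le1 oppr_le0 subr_ge0.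
have h4 : expR (- u) * (1 - expR (- (v - u))) <= 1 - expR (- (v - u)) by rewrite ler_piMl.
by move: h1 h4; set w := expR (- (v - u)); lra.
Qed.

(** From 1 + v <= exp v and exp v <= 1 / (1 - v). *)
Lemma expR_taylor1 (v : R) : `|v| <= 1 / 2 -> `|1 - expR v + v| <= 2 * v ^+ 2.
Proof.
rewrite ler_norml => /andP[v1 v2].
have h1 := expR_ge1Dx v.
have h2 : expR v * (1 - v) <= 1.
  have := expR_ge1Dx (- v); rewrite expRN => h.
  by rewrite -ler_pdivlMl ?expR_gt0// mulr1.
rewrite ler_norml; apply/andP; split; last by nra.
suff : expR v <= 1 + v + 2 * v ^+ 2 by lra.
rewrite leNgt; apply/negP => h3.
have : (1 + v + 2 * v ^+ 2) * (1 - v) < 1 by apply: lt_le_trans h2; rewrite ltr_pM2r//; lra.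
have : 0 <= v ^+ 2 * (1 - 2 * v) by rewrite mulr_ge0 ?sqr_ge0//; lra.
lra.
Qed.

Lemma unif_cont_expRN z (b : R) : 0 <= b -> (forall s, 0 <= s <= 1 -> 0 <= z s) ->
  unif_cont01 z -> unif_cont01 (fun s => expR (- (b * z s))).
Proof.
move=> b0 z0 uz e e0.
have [N hN] := uz (e / (b + 1)) (divr_gt0 e0 (ltr_wpDl b0 ltr01)).
exists N => s t s01 t01 /hN => /(_ s01 t01) h.
apply: le_trans (expRN_dist _ _) _; rewrite ?mulr_ge0 ?z0//.
rewrite -mulrBr normrM (ger0_norm b0); apply: le_trans (ler_wpM2l b0 h) _.
rewrite mulrCA ger_pMr// ler_pdivrMr ?ltr_wpDl//; lra.
Qed.

(** What is used of the complementarity of z and y: the support of dy is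
    contained in the zeros of z. *)
Definition grows_at_zero z y := forall s t, 0 <= s -> s <= t -> t <= 1 ->
  y s < y t -> exists u, s <= u <= t /\ z u = 0.

Lemma inv_exp2_le n m : (n <= m)%N -> (2 ^+ m)^-1 <= (2 ^+ n)^-1 :> R.
Proof. by move=> nm; rewrite lef_pV2 ?posrE ?exprn_gt0// ler_weXn2l// ler1n. Qed.

(** On a dyadic interval where y grows, z vanishes somewhere; by uniform
    continuity the term a * z is small there. *)
Lemma boundary_sum_cvg z z' y (a b : R) : 0 <= a -> 0 <= b ->
  (forall s, 0 <= s <= 1 -> 0 <= z s) -> (forall s, 0 <= s <= 1 -> 0 <= z' s) ->
  unif_cont01 z -> unif_cont01 z' -> nondecreasing01 y -> grows_at_zero z y ->
  rs_sum (fun s => expR (- (a * z s + b * z' s))) y @ \oo -->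
  rs_int (fun s => expR (- (b * z' s))) y.
Proof.
move=> a0 b0 z0 z'0 uz uz' ym gz.
have y0 : 0 <= y 1 - y 0 by rewrite subr_ge0 ym.
apply: (@cvg_dist_eps _ _ _ (a * (y 1 - y 0)) (rs_sum_cvg (unif_cont_expRN b0 z'0 uz') ym)).
move=> e e0; have [N hN] := uz e e0; exists N => n Nn.
rewrite /rs_sum -sumrB; under eq_bigr do rewrite /rs_term -mulrBl.
rewrite -mulrA [(y 1 - y 0) * e]mulrC mulrA.
apply: sum_increments_le => // i lt_i; rewrite subr_gt0 => yi.
have /andP[t0 t1] := dyadic01 R lt_i; have /andP[s0 s1] := dyadic01 R (ltnW lt_i).
have st := ler_dyadic R n (leqnSn i).
have [u [/andP[su ut] zu]] := gz _ _ s0 st t1 yi.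
have t01 : 0 <= dyadic R n i.+1 <= 1 by rewrite t0 t1.
apply: le_trans (expRN_dist _ _) _; rewrite ?addr_ge0 ?mulr_ge0 ?z0 ?z'0//.
rewrite addrK normrM (ger0_norm a0) ler_wpM2l//.
rewrite -[z _]subr0 -zu; apply: hN => //.
  by rewrite (le_trans s0 su) (le_trans ut t1).
apply: le_trans (inv_exp2_le Nn); rewrite -(dyadic_step R n i) ger0_norm ?subr_ge0//.
by rewrite lerB.
Qed.

Lemma rs_int0 z y : nondecreasing01 y ->
  rs_int (fun s => expR (- (0 * z s))) y = y 1 - y 0.
Proof.
move=> ym; apply/cvg_lim => //; apply: cvg_near_cst; exists 0%N => // n _.
rewrite -(sum_increments y n); apply: eq_bigr => i _.
by rewrite /rs_term mul0r oppr0 expR0 mul1r.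
Qed.

Lemma rs_int_bounds z y (b M : R) : 0 <= b -> nondecreasing01 y ->
  unif_cont01 z -> (forall s, 0 <= s <= 1 -> 0 <= z s <= M) ->
  expR (- (b * M)) * (y 1 - y 0) <= rs_int (fun s => expR (- (b * z s))) y <= y 1 - y 0.
Proof.
move=> b0 ym uz zM.
have z0 s : 0 <= s <= 1 -> 0 <= z s by move=> /zM /andP[].
have c := rs_sum_cvg (unif_cont_expRN b0 z0 uz) ym.
apply/andP; split.
  apply: (cvgr_to_ge c); exists 0%N => // n _.
  rewrite -(sum_increments y n) mulr_sumr [leLHS]big_nat_cond [leRHS]big_nat_cond.
  apply: ler_sum => i; rewrite andbT => /andP[_ lt_i].
  rewrite ler_wpM2r ?increment_ge0// ler_expR lerN2 ler_wpM2l//.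
  by have /andP[] := zM _ (dyadic01 R lt_i).
apply: (cvgr_to_le c); exists 0%N => // n _.
rewrite -(sum_increments y n) [leLHS]big_nat_cond [leRHS]big_nat_cond.
apply: ler_sum => i; rewrite andbT => /andP[_ lt_i].
rewrite /rs_term ler_piMl ?increment_ge0// expR_le1 oppr_le0 mulr_ge0//.
exact: z0 (dyadic01 R lt_i).
Qed.

Lemma unif_contD f g : unif_cont01 f -> unif_cont01 g ->
  unif_cont01 (fun s : R => f s + g s : R).
Proof.
move=> uf ug e e0; have e2 : 0 < e / 2 by rewrite divr_gt0.
have [N hN] := uf _ e2; have [M hM] := ug _ e2.
exists (maxn N M) => s t s01 t01 st.
rewrite opprD addrACA [leRHS](splitr e) (le_trans (ler_normD _ _))// lerD//.
  by apply: hN => //; apply: le_trans st _; rewrite inv_exp2_le// leq_maxl.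
by apply: hM => //; apply: le_trans st _; rewrite inv_exp2_le// leq_maxr.
Qed.

Section TwoDimensional.
Variables (z1 z2 y1 y2 : R -> R) (p q s t a b : R).
Hypotheses (a0 : 0 <= a) (b0 : 0 <= b).
Hypothesis z1_ge0 : forall u, 0 <= u <= 1 -> 0 <= z1 u.
Hypothesis z2_ge0 : forall u, 0 <= u <= 1 -> 0 <= z2 u.
Hypotheses (uz1 : unif_cont01 z1) (uz2 : unif_cont01 z2).
Hypotheses (uy1 : unif_cont01 y1) (uy2 : unif_cont01 y2).
Hypotheses (my1 : nondecreasing01 y1) (my2 : nondecreasing01 y2).
Hypotheses (gy1 : grows_at_zero z1 y1) (gy2 : grows_at_zero z2 y2).

Let e u := expR (- (a * z1 u + b * z2 u)).
Let l1 := a * p + b * s.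
Let l2 := a * q + b * t.
Let dy y n i := y (dyadic R n i.+1) - y (dyadic R n i).

Definition jump_sum n := \sum_(0 <= i < 2 ^ n) e (dyadic R n i.+1) *
  (1 - expR (l1 * dy y1 n i + l2 * dy y2 n i)).

(** The exponential is expanded to the first order. The remainders are quadratic
    in the increments of y1 + y2, so that their sum is at most a multiple of the
    largest of these increments, which tends to 0 by uniform continuity. *)
Lemma jump_sum_cvg : jump_sum @ \oo -->
  - (l1 * rs_int (fun u => expR (- (b * z2 u))) y1 +
     l2 * rs_int (fun u => expR (- (a * z1 u))) y2).
Proof.
have c1 := boundary_sum_cvg a0 b0 z1_ge0 z2_ge0 uz1 uz2 my1 gy1.
have c2 := boundary_sum_cvg b0 a0 z2_ge0 z1_ge0 uz2 uz1 my2 gy2.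
have {}c2 : rs_sum e y2 @ \oo --> rs_int (fun u => expR (- (a * z1 u))) y2.
  by rewrite (_ : e = fun s => expR (- (b * z2 s + a * z1 s)))//; apply/funext => u; rewrite /e addrC.
have c : (fun n => - (l1 * rs_sum e y1 n + l2 * rs_sum e y2 n)) @ \oo -->
  - (l1 * rs_int (fun u => expR (- (b * z2 u))) y1 +
     l2 * rs_int (fun u => expR (- (a * z1 u))) y2).
  by cvgs.
pose L := `|l1| + `|l2| + 1.
have L1 : 0 < L by rewrite ltr_wpDl// addr_ge0.
pose yy u := y1 u + y2 u.
have uyy : unif_cont01 yy by exact: unif_contD.
have myy : nondecreasing01 yy by move=> u v u0 uv v1; rewrite lerD ?my1 ?my2.
apply: (@cvg_dist_eps _ _ _ (2 * L * (yy 1 - yy 0)) c).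
move=> d d0.
(* expR_taylor1 needs exponents of size at most 1 / 2 *)
pose d' := Num.min d (1 / 2).
have d'0 : 0 < d' by rewrite lt_min d0 divr_gt0.
have [N hN] := uyy (d' / L) (divr_gt0 d'0 L1).
exists N => n Nn.
have -> : jump_sum n - - (l1 * rs_sum e y1 n + l2 * rs_sum e y2 n) =
  \sum_(0 <= i < 2 ^ n) e (dyadic R n i.+1) *
   (1 - expR (l1 * dy y1 n i + l2 * dy y2 n i) + (l1 * dy y1 n i + l2 * dy y2 n i)).
  rewrite opprK /rs_sum !mulr_sumr -!big_split/=; apply: eq_bigr => i _.
  by rewrite /rs_term /dy; ring.
apply: le_trans (ler_norm_sum _ _ _) _.
have -> : 2 * L * (yy 1 - yy 0) * d =
  \sum_(0 <= i < 2 ^ n) 2 * L * ((yy (dyadic R n i.+1) - yy (dyadic R n i)) * d).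
  by rewrite -mulr_sumr -mulr_suml sum_increments mulrA.
rewrite big_nat_cond [leRHS]big_nat_cond.
apply: ler_sum => i; rewrite andbT => /andP[_ lt_i].
have D1 : 0 <= dy y1 n i := increment_ge0 my1 lt_i.
have D2 : 0 <= dy y2 n i := increment_ge0 my2 lt_i.
set v := l1 * dy y1 n i + l2 * dy y2 n i.
have -> : yy (dyadic R n i.+1) - yy (dyadic R n i) = dy y1 n i + dy y2 n i by rewrite /yy /dy; ring.
have vL : `|v| <= L * (dy y1 n i + dy y2 n i).
  apply: le_trans (ler_normD _ _) _; rewrite !normrM (ger0_norm D1) (ger0_norm D2).
  have n1 := normr_ge0 l1; have n2 := normr_ge0 l2; rewrite /L; nra.
have Dd : L * (dy y1 n i + dy y2 n i) <= d'.
  rewrite mulrC -ler_pdivlMr//.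
  have -> : dy y1 n i + dy y2 n i = `|yy (dyadic R n i.+1) - yy (dyadic R n i)|.
    by rewrite ger0_norm ?increment_ge0// /yy /dy; ring.
  apply: hN; [exact: dyadic01 | exact: dyadic01 (ltnW lt_i)|].
  by rewrite dyadic_step ger0_norm ?inv_exp2_le// invr_ge0 exprn_ge0.
have v2 : `|v| <= 1 / 2 by rewrite (le_trans vL)// (le_trans Dd)// /d' ge_min lexx orbT.
have vd : `|v| <= d by rewrite (le_trans vL)// (le_trans Dd)// /d' ge_min lexx.
rewrite normrM ger0_norm ?expR_ge0//.
apply: (@le_trans _ _ (2 * v ^+ 2)).
  apply: le_trans (expR_taylor1 v2); rewrite ler_piMl// expR_le1 oppr_le0 addr_ge0//.
    by rewrite mulr_ge0// z1_ge0// dyadic01.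
  by rewrite mulr_ge0// z2_ge0// dyadic01.
have -> : v ^+ 2 = `|v| * `|v| by rewrite -normrM -expr2 ger0_norm// sqr_ge0.
have -> : 2 * L * ((dy y1 n i + dy y2 n i) * d) = 2 * (L * (dy y1 n i + dy y2 n i) * d) by ring.
by rewrite ler_pM2l// ler_pM.
Qed.

End TwoDimensional.
End ReflectedPaths.

(** * Complementarity *)

Lemma stieltjes_ocitv (R : realType) (g : cumulative R R) (s t : R) : s <= t ->
  lebesgue_stieltjes_measure g `]s, t]%classic = (g t - g s)%:E.
Proof.
move=> st; rewrite /lebesgue_stieltjes_measure/= /measure_extension/=.
rewrite measurable_mu_extE//=; last exact: is_ocitv.
rewrite wlength_itv/= lte_fin.
move: st; rewrite le_eqVlt => /predU1P[->|->]; last by rewrite EFinB.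
by rewrite ltxx subrr.
Qed.

(** If z had no zero on [s, t] it would be at least some c > 0 there, and the
    integral of z dy over [0, t] would be at least c (y t - y s) > 0. *)
Lemma complementary_grows_at_zero (R : realType) (z y : R -> R) :
  {within `[0, +oo[%classic, continuous z} -> (forall s, 0 <= s -> 0 <= z s) ->
  complementary z y -> grows_at_zero z y.
Proof.
move=> cz z0 [g [gy H]] s t s0 st t1 yst; apply: contrapT => nz.
have t0 := le_trans s0 st.
have sub0 : `[s, t]%classic `<=` `[0, +oo[%classic.
  by move=> u /=; rewrite !in_itv/= andbT => /andP[su _]; exact: le_trans su.
have [c cst cmin] := EVT_min st (continuous_subspaceW sub0 cz).
have c0 : 0 < z c.
  move: cst; rewrite in_itv/= => /andP[sc ct].
  rewrite lt_neqAle z0 ?(le_trans s0)// andbT eq_sym; apply/eqP => zc.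
  by apply: nz; exists c; rewrite sc ct.
have mz : measurable_fun `[0, t]%classic (fun u => (z u)%:E).
  apply/measurable_EFinP; apply: subspace_continuous_measurable_fun => //.
  apply: continuous_subspaceW cz => u /=.
  by rewrite !in_itv/= andbT => /andP[].
have : (0 < \int[lebesgue_stieltjes_measure g]_(u in `[0%R, t]) (z u)%:E)%E.
  apply: (@lt_le_trans _ _ (\int[lebesgue_stieltjes_measure g]_(u in `]s, t]) (z u)%:E)%E); last first.
    apply: ge0_subset_integral => //.
      by move=> u /=; rewrite in_itv/= lee_fin => /andP[u0 _]; exact: z0.
    move=> u /=; rewrite !in_itv/= => /andP[su ->]; rewrite andbT.
    by rewrite (le_trans s0)// ltW.
  apply: (@lt_le_trans _ _ (\int[lebesgue_stieltjes_measure g]_(u in `]s, t]) (z c)%:E)%E).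
    rewrite integral_cst//; apply: mule_gt0; first by rewrite lte_fin.
    have E := stieltjes_ocitv g st; rewrite !gy !max_r// in E.
    by apply: (@lt_le_trans _ _ (y t - y s)%:E); [rewrite lte_fin subr_gt0|rewrite -E].
  apply: ge0_le_integral => //.
  - by move=> u _; rewrite lee_fin ltW.
  - apply: measurable_funS mz => // u /=; rewrite !in_itv/= => /andP[su ->].
    by rewrite andbT (le_trans s0)// ltW.
  - move=> u /=; rewrite in_itv/= => /andP[su ut]; rewrite lee_fin; apply: cmin.
    by rewrite in_itv/= ut andbT ltW.
by rewrite H// ltxx.
Qed.

(** * Expectations of products *)

Section Independence.
Context (d : measure_display) (T : measurableType d) (R : realType).
Variable P : probability T R.

Definition indep (f u : T -> R) : Prop :=
  forall A B : set R, measurable A -> measurable B ->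
    P ((f @^-1` A) `&` (u @^-1` B)) = (P (f @^-1` A) * P (u @^-1` B))%E.

Lemma indep_comp (g : R -> R) f u : measurable_fun setT g ->
  indep f u -> indep (g \o f) u.
Proof.
move=> mg fu A B mA mB; apply: (fu (g @^-1` A) B) => //.
by rewrite -[X in measurable X]setTI; exact: mg.
Qed.

Lemma mfun_of (f : T -> R) : measurable_fun setT f ->
  exists F : {mfun T >-> R}, F = f :> (T -> R).
Proof.
move=> mf; pose F : {mfun T >-> R} := HB.pack f (isMeasurableFun.Build _ _ _ _ f mf).
by exists F.
Qed.

(** Tonelli's theorem for the joint law, which is the product of the two laws. *)
Lemma ge0_indep_expectation (f u : T -> R) :
  measurable_fun setT f -> measurable_fun setT u ->
  (forall w, 0 <= f w) -> (forall w, 0 <= u w) -> indep f u ->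
  (\int[P]_w (f w * u w)%:E = (\int[P]_w (f w)%:E) * (\int[P]_w (u w)%:E))%E.
Proof.
move=> mf mu f0 u0 fu.
have [F FE] := mfun_of mf; have [V VE] := mfun_of mu; subst f u.
pose h w := (F w, V w).
have mh : measurable_fun setT h by exact: measurable_fun_pair.
pose H : {mfun T >-> (R * R)%type} := HB.pack h (isMeasurableFun.Build _ _ _ _ h mh).
pose g (z : R * R) := (`|z.1| * `|z.2|)%:E.
have g0 z : (0 <= g z)%E by rewrite lee_fin mulr_ge0.
have mg : measurable_fun setT g.
  apply/measurable_EFinP; apply: measurable_funM.
    by apply: measurableT_comp => //; exact: measurable_fst.
  by apply: measurableT_comp => //; exact: measurable_snd.
transitivity (\int[distribution P H]_z g z)%E.
  rewrite ge0_integral_distribution//; apply: eq_integral => w _ /=.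
  by rewrite /g /h /= !ger0_norm.
transitivity (\int[(distribution P F \x distribution P V)%E]_z g z)%E.
  apply: eq_measure_integral => A mA _; apply/esym.
  apply: (@product_measure_unique _ _ _ _ _ _ _ (distribution P H)) ; last exact: mA.
  by move=> A1 A2 m1 m2; exact: fu.
rewrite fubini_tonelli1// /fubini_F /g /=.
have mV : measurable_fun setT (fun y : R => (`|y|)%:E).
  by apply/measurable_EFinP; exact: normr_measurable.
have EV : (\int[distribution P V]_y `|y|%:E = \int[P]_w (V w)%:E)%E.
  rewrite ge0_integral_distribution//.
  by apply: eq_integral => w _ /=; rewrite ger0_norm.
have EF : (\int[distribution P F]_y `|y|%:E = \int[P]_w (F w)%:E)%E.
  rewrite ge0_integral_distribution//.
  by apply: eq_integral => w _ /=; rewrite ger0_norm.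
have EV0 : (0 <= \int[distribution P V]_y `|y|%:E)%E.
  by apply: integral_ge0 => y _; rewrite lee_fin.
rewrite -EV -EF -ge0_integralZr//=.
apply: eq_integral => x _.
by rewrite -ge0_integralZl_EFin.
Qed.

Lemma integrable_finite (f : T -> R) : measurable_fun setT f ->
  (\int[P]_w `|f w|%:E < +oo)%E -> P.-integrable setT (EFin \o f).
Proof. by move=> mf fi; apply/integrableP; split; [exact/measurable_EFinP|]. Qed.

(** Decompose f into its positive and negative parts. *)
Lemma indep_expectation (f u : T -> R) :
  P.-integrable setT (EFin \o f) -> P.-integrable setT (EFin \o u) ->
  (forall w, 0 <= u w) -> indep f u ->
  P.-integrable setT (EFin \o (fun w => f w * u w)) /\
  \int[P]_w (f w * u w) = (\int[P]_w f w) * (\int[P]_w u w).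
Proof.
move=> fi ui u0 fu.
have mf : measurable_fun setT f by have /integrableP[/measurable_EFinP] := fi.
have mu : measurable_fun setT u by have /integrableP[/measurable_EFinP] := ui.
have u_fin : (\int[P]_w (u w)%:E)%E \is a fin_num by exact: integrable_fin_num ui.
pose fp w := Num.max (f w) 0; pose fn w := Num.max (- f w) 0.
have part (c : R -> R) : measurable_fun setT c -> (forall x, 0 <= c x <= `|x|) ->
  P.-integrable setT (EFin \o (c \o f)) /\
  P.-integrable setT (EFin \o (fun w => c (f w) * u w)) /\
  \int[P]_w (c (f w) * u w) = (\int[P]_w c (f w)) * (\int[P]_w u w).
  move=> mc cb; have c0 x : 0 <= c x by case/andP: (cb x).
  have mcf : measurable_fun setT (c \o f) by exact: measurableT_comp.
  have icf : P.-integrable setT (EFin \o (c \o f)).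
    apply: le_integrable fi => //; first exact/measurable_EFinP.
    by move=> w _ /=; rewrite lee_fin ger0_norm//; case/andP: (cb (f w)).
  have E := ge0_indep_expectation mcf mu (fun w => c0 _) u0 (indep_comp mc fu).
  have cf_fin : (\int[P]_w (c (f w))%:E)%E \is a fin_num by exact: integrable_fin_num icf.
  split=> //; split; last by rewrite /Rintegral E fineM.
  apply: integrable_finite; first exact: measurable_funM.
  under eq_integral do rewrite ger0_norm ?mulr_ge0//.
  by rewrite E ltey_eq fin_numM.
have [| |ip [ipu Ep]] := part (fun x => Num.max x 0).
- by apply: measurable_maxr.
- by move=> x; rewrite le_max lexx orbT ge_max ler_norm normr_ge0.
have [| |im [imu Em]] := part (fun x => Num.max (- x) 0).
- by apply: measurable_maxr => //; exact: oppr_measurable.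
- by move=> x; rewrite le_max lexx orbT ge_max -normrN ler_norm normr_ge0.
have dec (x : R) : x = Num.max x 0 - Num.max (- x) 0.
  have [h|h] := leP 0 x; first by rewrite max_r ?oppr_le0// subr0.
  by rewrite max_l ?oppr_ge0 ?ltW// sub0r opprK.
have Eu : (fun w => f w * u w) =
   (fun w => Num.max (f w) 0 * u w - Num.max (- f w) 0 * u w).
  by apply/funext => w; rewrite {1}(dec (f w)) mulrBl.
split; first by rewrite Eu; exact: (integrableB _ ipu imu).
rewrite Eu RintegralB// Ep Em -mulrBl; congr (_ * _).
by rewrite -RintegralB//; apply: eq_Rintegral => w _; rewrite -dec.
Qed.

End Independence.

(** * Normal and exponential laws *)

Section Densities.
Context (d : measure_display) (T : measurableType d) (R : realType).
Variables (nu : {finite_measure set T -> \bar R})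
  (mu : {sigma_finite_measure set T -> \bar R}) (g : T -> R).
Hypothesis mg : measurable_fun setT g.
Hypothesis nuE : forall A, measurable A -> nu A = (\int[mu]_(x in A) (g x)%:E)%E.

(** By uniqueness, g is almost everywhere the Radon-Nikodym derivative of nu. *)
Lemma ge0_integral_density (f : T -> \bar R) :
  (forall x, 0 <= f x)%E -> measurable_fun setT f ->
  (\int[nu]_x f x = \int[mu]_x (f x * (g x)%:E))%E.
Proof.
move=> f0 mf.
have mgE : measurable_fun setT (fun x => (g x)%:E) by exact/measurable_EFinP.
have dom : nu `<< mu.
  apply/null_content_dominatesP => A mA muA.
  by rewrite nuE//; apply: null_set_integral => //; exact: measurable_funTS.
rewrite -(Radon_Nikodym_SigmaFinite.change_of_variables dom f0 measurableT mf).
have mh : measurable_fun setT (Radon_Nikodym_SigmaFinite.f nu mu).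
  exact: measurable_int (Radon_Nikodym_SigmaFinite.f_integrable dom).
apply: ae_eq_integral => //; [exact: emeasurable_funM|exact: emeasurable_funM|].
apply: ae_eqe_mul2l; apply: integral_ae_eq => //.
  exact: Radon_Nikodym_SigmaFinite.f_integrable.
by move=> A _ mA; rewrite -Radon_Nikodym_SigmaFinite.f_integral// nuE.
Qed.
End Densities.

(** exp times the density of N(m, s^2) is a multiple of the density of
    N(m + s^2, s^2). *)
Lemma normal_mgf (R : realType) (m s : R) : s != 0 ->
  (\int[normal_prob m s]_x (expR x)%:E = (expR (m + s ^+ 2 / 2))%:E)%E.
Proof.
move=> s0.
have mpdf := measurable_normal_pdf m s.
have e0 x : (0 <= (expR x)%:E :> \bar R)%E by rewrite lee_fin expR_ge0.
have me : measurable_fun setT (fun x : R => (expR x)%:E) by exact/measurable_EFinP.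
rewrite (@ge0_integral_density _ _ _ (normal_prob m s) lebesgue_measure _ mpdf _ _ e0 me)//.
transitivity (\int[lebesgue_measure]_x
    ((expR (m + s ^+ 2 / 2))%:E * (normal_pdf (m + s ^+ 2) s x)%:E))%E.
  apply: eq_integral => x _; rewrite -!EFinM; congr EFin.
  rewrite !normal_pdfE// /normal_fun mulrCA [RHS]mulrCA; congr (_ * _).
  by rewrite -!expRD; congr expR; field.
rewrite ge0_integralZl_EFin ?expR_ge0//=.
+ by rewrite integral_normal_pdf// mule1.
+ by move=> x _; rewrite lee_fin normal_pdf_ge0.
+ by apply/measurable_EFinP; exact: measurable_normal_pdf.
Qed.

(** exponential_prob with its probability structure, which needs l > 0. *)
Definition exponential_law (R : realType) (l : R) (l0 : 0 < l) : probability _ R :=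
  exponential_distribution_exponential_prob__canonical__probability_measure_Probability l0.

(** The integrand times the density is a multiple of the density of parameter
    l + a. *)
Lemma exponential_laplace (R : realType) (l a : R) (l0 : 0 < l) : 0 <= a ->
  (\int[exponential_law l0]_x (expR (- (a * `|x|)))%:E = (l / (l + a))%:E)%E.
Proof.
move=> a0; have la0 : 0 < l + a by rewrite ltr_wpDr.
have mpdf := measurable_exponential_pdf l.
have e0 (x : R) : (0 <= (expR (- (a * `|x|)))%:E :> \bar R)%E by rewrite lee_fin expR_ge0.
have me : measurable_fun setT (fun x : R => (expR (- (a * `|x|)))%:E).
  apply/measurable_EFinP; apply: measurableT_comp => //.
  by apply: measurableT_comp => //; apply: measurable_funM => //.
rewrite (@ge0_integral_density _ _ _ (exponential_law l0) lebesgue_measure _ mpdf _ _ e0 me)//.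
transitivity (\int[lebesgue_measure]_x
    ((l / (l + a))%:E * (exponential_pdf (l + a) x)%:E))%E.
  apply: eq_integral => x _; rewrite -!EFinM; congr EFin.
  have [x0|x0] := ltP x 0; first by rewrite !lt0_exponential_pdf// !mulr0.
  rewrite !exponential_pdfE// ger0_norm// mulrCA -expRD.
  rewrite [RHS]mulrA divfK ?gt_eqF//; congr (_ * expR _); ring.
rewrite ge0_integralZl_EFin ?divr_ge0 ?(ltW l0) ?(ltW la0)//=.
+ by rewrite integral_exponential_pdf// mule1.
+ by move=> x _; rewrite lee_fin exponential_pdf_ge0// ltW.
+ by apply/measurable_EFinP; exact: measurable_exponential_pdf.
Qed.

(** * Real expectations and a martingale transform *)

Section RealExpectation.
Context (d : measure_display) (T : measurableType d) (R : realType).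
Variable P : probability T R.
Implicit Types f g : T -> R.

Definition intg f := P.-integrable setT (EFin \o f).

Lemma intg_meas f : intg f -> measurable_fun setT f.
Proof. by move=> /integrableP[/measurable_EFinP]. Qed.

Lemma intgD f g : intg f -> intg g -> intg (fun w => f w + g w).
Proof. by move=> fi gi; exact: (integrableD _ fi gi). Qed.

Lemma intgB f g : intg f -> intg g -> intg (fun w => f w - g w).
Proof. by move=> fi gi; exact: (integrableB _ fi gi). Qed.

Lemma intgZ k f : intg f -> intg (fun w => k * f w).
Proof. by move=> fi; exact: (integrableZl _ k fi). Qed.

Lemma intg_cst k : intg (fun=> k).
Proof.
apply: (@measurable_bounded_integrable _ _ _ _ (fun=> k)) => //.
  by apply: (le_lt_trans (probability_le1 P measurableT)); rewrite ltry.
by exists `|k|; split; [exact: num_real|move=> x kx w _ /=; exact: ltW].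
Qed.

Lemma intg_sum (I : Type) (s : seq I) (F : I -> T -> R) :
  (forall i, intg (F i)) -> intg (fun w => \sum_(i <- s) F i w).
Proof.
move=> Fi; elim: s => [|i s ih].
  by rewrite (_ : (fun w => _) = fun=> 0); [exact: intg_cst|apply/funext => w; rewrite big_nil].
rewrite (_ : (fun w => _) = fun w => F i w + \sum_(j <- s) F j w); first exact: intgD.
by apply/funext => w; rewrite big_cons.
Qed.

Lemma intg_le f g : measurable_fun setT f -> intg g -> (forall w, `|f w| <= g w) -> intg f.
Proof.
move=> mf gi fg; apply: le_integrable gi => //; first exact/measurable_EFinP.
by move=> w _ /=; rewrite lee_fin (le_trans (fg w))// ler_norm.
Qed.

Lemma intg_bounded f k : measurable_fun setT f -> (forall w, `|f w| <= k) -> intg f.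
Proof. by move=> mf fk; apply: intg_le (intg_cst k) _. Qed.

Lemma Rintegral_cstT k : \int[P]_w k = k.
Proof.
rewrite Rintegral_cst// [X in fine X](_ : _ = 1%E) ?mulr1//.
exact: probability_setT.
Qed.

Lemma Rintegral_sumT (I : Type) (s : seq I) (F : I -> T -> R) :
  (forall i, intg (F i)) ->
  \int[P]_w (\sum_(i <- s) F i w) = \sum_(i <- s) \int[P]_w F i w.
Proof.
move=> Fi; elim: s => [|i s ih].
  by rewrite big_nil -[RHS]Rintegral_cstT; apply: eq_Rintegral => w _; rewrite big_nil.
rewrite big_cons -ih -(RintegralD measurableT (Fi i) (intg_sum s Fi)).
by apply: eq_Rintegral => w _; rewrite big_cons.
Qed.

Lemma EFin_Rintegral f : intg f -> ((\int[P]_w f w)%:E = \int[P]_w (f w)%:E)%E.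
Proof. by move=> fi; rewrite /Rintegral fineK//; exact: integrable_fin_num fi. Qed.

End RealExpectation.

Section SubSigmaAlgebra.
Context (d : measure_display) (T : measurableType d) (R : realType).

(** Measurability for a sub-sigma-algebra given as a bare family of sets, as in
    a filtration. *)
Definition fmeas (F : set (set T)) (f : T -> R) :=
  forall B : set R, measurable B -> F (f @^-1` B).

Lemma fmeasP (F : set (set T)) (f : T -> R) : sigma_algebra setT F ->
  fmeas F f <-> measurable_fun setT (f : g_sigma_algebraType F -> R).
Proof.
move=> sF; have E : measurable = F :> set (set (g_sigma_algebraType F)).
  by rewrite -[RHS](sigma_algebra_id sF).
split=> [H _ B mB|H B mB].
  by rewrite setTI E; exact: H.
by have := H measurableT B mB; rewrite setTI E.
Qed.

Lemma fmeasW (F G : set (set T)) (f : T -> R) : F `<=` G -> fmeas F f -> fmeas G f.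
Proof. by move=> FG H B mB; apply: FG; exact: H. Qed.

Lemma fmeas_measurable (F : set (set T)) (f : T -> R) : F `<=` measurable ->
  fmeas F f -> measurable_fun setT f.
Proof. by move=> FG H _ B mB; rewrite setTI; apply: FG; exact: H. Qed.

End SubSigmaAlgebra.

Section MartingaleTransform.
Context (d : measure_display) (T : measurableType d) (R : realType).
Variables (P : probability T R) (F : nat -> set (set T)).
Variables (g xi : nat -> T -> R) (c c2 : R) (N : nat).
Hypothesis sF : forall i, (i <= N)%N -> sigma_algebra setT (F i).
Hypothesis Fm : forall i, (i <= N)%N -> F i `<=` measurable.
Hypothesis FS : forall i, (i < N)%N -> F i `<=` F i.+1.
Hypothesis gF : forall i, (i < N)%N -> fmeas (F i) (g i).
Hypothesis g01 : forall i w, 0 <= g i w <= 1.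
Hypothesis xiF : forall i, (i < N)%N -> fmeas (F i.+1) (xi i).
Hypothesis xi0 : forall i w, 0 <= xi i w.
Hypothesis xi_indep : forall i, (i < N)%N -> forall A (B : set R), F i A -> measurable B ->
  P (A `&` xi i @^-1` B) = (P A * P (xi i @^-1` B))%E.
Hypothesis xi_int : forall i, (i < N)%N -> intg P (xi i).
Hypothesis xi2_int : forall i, (i < N)%N -> intg P (fun w => xi i w ^+ 2).
Hypothesis xi_mean : forall i, (i < N)%N -> \int[P]_w xi i w = c.
Hypothesis xi2_mean : forall i, (i < N)%N -> \int[P]_w (xi i w ^+ 2) = c2.

Definition mart n w := \sum_(0 <= i < n) g i w * (xi i w - c).

Lemma martS n w : mart n.+1 w = mart n w + g n w * (xi n w - c).
Proof. by rewrite /mart big_nat_recr. Qed.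

Lemma mart_meas n : (n <= N)%N -> fmeas (F n) (mart n).
Proof.
elim: n => [|n ih] nN.
  apply/fmeasP; first exact: sF.
  by rewrite (_ : mart 0 = fun=> 0)//; apply/funext => w; rewrite /mart big_geq.
have h1 : fmeas (F n.+1) (mart n) by apply: fmeasW (ih (ltnW nN)); exact: FS.
have h2 : fmeas (F n.+1) (g n) by apply: fmeasW (gF nN); exact: FS.
have h3 := xiF nN; move: h1 h2 h3.
have s := sF nN => /(fmeasP _ s) h1 /(fmeasP _ s) h2 /(fmeasP _ s) h3.
apply/(fmeasP _ s).
rewrite (_ : mart n.+1 = fun w => mart n w + g n w * (xi n w - c)); last first.
  by apply/funext => w; rewrite martS.
by apply: measurable_funD => //; apply: measurable_funM => //; apply: measurable_funB.
Qed.

Lemma mart_increment f n : (n < N)%N -> fmeas (F n) f -> intg P f ->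
  intg P (fun w => f w * (xi n w - c)) /\ \int[P]_w (f w * (xi n w - c)) = 0.
Proof.
move=> nN fF fi.
have ind : indep P f (xi n) by move=> A B mA mB; apply: xi_indep => //; exact: fF.
have [fxi E] := indep_expectation fi (xi_int nN) (xi0 n) ind.
have -> : (fun w => f w * (xi n w - c)) = (fun w => f w * xi n w - c * f w).
  by apply/funext => w; ring.
split; first by apply: intgB => //; exact: intgZ.
rewrite RintegralB//; last exact: intgZ.
by rewrite E RintegralZl// xi_mean// mulrC subrr.
Qed.

Lemma g_meas n : (n < N)%N -> measurable_fun setT (g n).
Proof. by move=> nN; apply: fmeas_measurable (gF nN); exact: Fm (ltnW nN). Qed.

Lemma xi_meas n : (n < N)%N -> measurable_fun setT (xi n).
Proof. by move=> nN; apply: fmeas_measurable (xiF nN); exact: Fm. Qed.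

Lemma mart_norm_le_sq x : `|x| <= 1 + x ^+ 2 :> R.
Proof.
have := sqr_ge0 (`|x| - 1); have := normr_ge0 x.
by rewrite -[x ^+ 2]real_normK ?num_real//; nra.
Qed.

(** The increments g (xi - c) are orthogonal, by independence, and each has second
    moment at most the variance of xi, as 0 <= g <= 1. *)
Lemma mart_l2 n : (n <= N)%N ->
  [/\ intg P (mart n), intg P (fun w => mart n w ^+ 2), \int[P]_w mart n w = 0 &
      \int[P]_w (mart n w ^+ 2) <= n%:R * (c2 - c ^+ 2)].
Proof.
elim: n => [|n ih] nN.
  rewrite (_ : mart 0 = fun=> 0); last by apply/funext => w; rewrite /mart big_geq.
  rewrite (_ : (fun w => _ ^+ 2) = fun=> 0); last by apply/funext => w; rewrite expr0n.
  by split; rewrite ?Rintegral_cstT ?mul0r//; exact: intg_cst.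
have [Mi M2i M0 M2] := ih (ltnW nN).
have Mm : measurable_fun setT (mart n).
  by apply: fmeas_measurable (mart_meas (ltnW nN)); exact: Fm (ltnW nN).
have gm := g_meas nN; have xm := xi_meas nN.
have g_int : intg P (g n).
  by apply: (@intg_bounded _ _ _ _ _ 1) => // w; have /andP[? ?] := g01 n w; rewrite ger0_norm.
have [D1i D1] := mart_increment nN (gF nN) g_int.
have MgF : fmeas (F n) (fun w => 2 * (mart n w * g n w)).
  have s := sF (ltnW nN); apply/(fmeasP _ s); apply: measurable_funM => //.
  by apply: measurable_funM; apply/(fmeasP _ s); [exact: mart_meas (ltnW nN)|exact: gF].
have Mg_int : intg P (fun w => 2 * (mart n w * g n w)).
  apply: intgZ; apply: (@intg_le _ _ _ _ _ (fun w => 1 + mart n w ^+ 2)).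
  - exact: measurable_funM.
  - by apply: intgD => //; exact: intg_cst.
  - move=> w; have /andP[? ?] := g01 n w; rewrite normrM (ger0_norm (_ : 0 <= g n w))//.
    by apply: le_trans (mart_norm_le_sq _); rewrite ler_piMr.
have [D2i D2] := mart_increment nN MgF Mg_int.
have dev_int : intg P (fun w => (xi n w - c) ^+ 2).
  rewrite (_ : (fun w => _) = fun w => xi n w ^+ 2 - (2 * c) * xi n w + c ^+ 2); last first.
    by apply/funext => w; ring.
  apply: intgD; last exact: intg_cst.
  by apply: intgB; [exact: xi2_int|apply: intgZ; exact: xi_int].
have dev : \int[P]_w ((xi n w - c) ^+ 2) = c2 - c ^+ 2.
  rewrite (_ : (fun w => _) = fun w => xi n w ^+ 2 - (2 * c) * xi n w + c ^+ 2); last first.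
    by apply/funext => w; ring.
  rewrite RintegralD//; last 2 first.
  - by apply: intgB; [exact: xi2_int|apply: intgZ; exact: xi_int].
  - exact: intg_cst.
  rewrite RintegralB//; [|exact: xi2_int|by apply: intgZ; exact: xi_int].
  rewrite RintegralZl//; last exact: xi_int.
  by rewrite xi_mean// xi2_mean// Rintegral_cstT; ring.
have D3i : intg P (fun w => g n w ^+ 2 * (xi n w - c) ^+ 2).
  apply: (intg_le _ dev_int).
  - apply: measurable_funM; first exact: measurable_funX.
    by apply: measurable_funX; exact: measurable_funB.
  - move=> w; have /andP[? ?] := g01 n w; rewrite ger0_norm ?(mulr_ge0 (sqr_ge0 _) (sqr_ge0 _))//.
    by apply: ler_piMl; [exact: sqr_ge0|rewrite expr_le1].
have D3 : \int[P]_w (g n w ^+ 2 * (xi n w - c) ^+ 2) <= c2 - c ^+ 2.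
  rewrite -dev; apply: (le_Rintegral measurableT D3i dev_int) => w _.
  have /andP[? ?] := g01 n w.
  by apply: ler_piMl; [exact: sqr_ge0|rewrite expr_le1].
have E1 : mart n.+1 = fun w => mart n w + g n w * (xi n w - c).
  by apply/funext => w; rewrite martS.
have E2 : (fun w => mart n.+1 w ^+ 2) = fun w => mart n w ^+ 2 +
   2 * (mart n w * g n w) * (xi n w - c) + g n w ^+ 2 * (xi n w - c) ^+ 2.
  by apply/funext => w; rewrite martS; ring.
split.
- by rewrite E1; exact: intgD.
- by rewrite E2; apply: intgD => //; exact: intgD.
- by rewrite E1 (RintegralD measurableT Mi D1i) M0 D1 addr0.
- rewrite E2 (RintegralD measurableT (intgD M2i D2i) D3i).
  by rewrite (RintegralD measurableT M2i D2i) D2 addr0 -natr1 mulrDl mul1r lerD.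
Qed.

End MartingaleTransform.

(** * Convergence of expectations *)

Section L2Convergence.
Context (d : measure_display) (T : measurableType d) (R : realType).
Variable P : probability T R.

Lemma dominated_cvg_Rintegral (h : nat -> T -> R) (h' g : T -> R) :
  (forall n, measurable_fun setT (h n)) -> intg P g ->
  (forall n w, `|h n w| <= g w) ->
  (forall w, h ^~ w @ \oo --> h' w) ->
  intg P h' /\ (fun n => \int[P]_w h n w) @ \oo --> \int[P]_w h' w.
Proof.
move=> mh gi hg hh'; have mh' : measurable_fun setT h'.
  by apply: (measurable_fun_cvg mh) => w _; exact: hh'.
have [|||||i _ c] := @dominated_convergence _ _ _ P setT measurableT
  (fun n => EFin \o h n) (EFin \o h') (EFin \o g).
- by move=> n; exact/measurable_EFinP.
- exact/measurable_EFinP.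
- by apply: aeW => w _; apply/fine_cvgP; split; [exact: nearW|exact: hh'].
- exact: gi.
- by apply: aeW => w n _; rewrite /= lee_fin.
split => //; have := c.
rewrite -EFin_Rintegral// => /fine_cvgP[_].
by apply: cvg_trans; apply: near_eq_cvg; apply: nearW.
Qed.

Lemma bounded_cvg_Rintegral (h : nat -> T -> R) (h' : T -> R) (k : R) :
  (forall n, measurable_fun setT (h n)) -> (forall n w, `|h n w| <= k) ->
  (forall w, h ^~ w @ \oo --> h' w) ->
  intg P h' /\ (fun n => \int[P]_w h n w) @ \oo --> \int[P]_w h' w.
Proof. by move=> mh; exact: dominated_cvg_Rintegral (intg_cst P k). Qed.

(** A bound in L2 implies uniform integrability: Fatou's lemma bounds the limit,
    the truncated distance min(|h_n - h'|, K) has mean tending to 0, and what is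
    cut off is at most (2 / K) (h_n^2 + h'^2). *)
Lemma l2_bounded_cvg (h : nat -> T -> R) (h' : T -> R) (C : R) :
  (forall n, intg P (h n)) -> (forall n, intg P (fun w => h n w ^+ 2)) ->
  (forall n, \int[P]_w (h n w ^+ 2) <= C) ->
  (forall w, h ^~ w @ \oo --> h' w) ->
  [/\ intg P h', intg P (fun w => h' w ^+ 2), \int[P]_w (h' w ^+ 2) <= C &
      (fun n => \int[P]_w h n w) @ \oo --> \int[P]_w h' w].
Proof.
move=> hi h2i hC hh'.
have mh n : measurable_fun setT (h n) by exact: intg_meas (hi n).
have mh' : measurable_fun setT h'.
  by apply: (measurable_fun_cvg mh) => w _; exact: hh'.
have C0 : 0 <= C by apply: le_trans (hC 0%N); apply: Rintegral_ge0 => w _; exact: sqr_ge0.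
have h2' w : (fun n => (h n w ^+ 2)%:E) @ \oo --> (h' w ^+ 2)%:E.
  apply/fine_cvgP; split; first exact: nearW.
  by rewrite expr2; have := cvgM (hh' w) (hh' w); apply.
have fatouC : (\int[P]_w (h' w ^+ 2)%:E <= C%:E)%E.
  have -> : (\int[P]_w (h' w ^+ 2)%:E = \int[P]_w limn_einf (fun n => (h n w ^+ 2)%:E))%E.
    by apply: eq_integral => w _; have [-> _] := cvg_limn_einf_sup (h2' w).
  apply: le_trans (fatou _ _ _ _) _ => //.
  - by move=> n; apply/measurable_EFinP; exact: measurable_funX.
  - by move=> n w _; rewrite lee_fin sqr_ge0.
  rewrite limn_einf_lim; apply: lime_le; first exact: is_cvg_einfs.
  apply: nearW => n; apply: (@le_trans _ _ (\int[P]_w (h n w ^+ 2)%:E)%E).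
    by apply: ereal_inf_lbound; exists n => /=.
  by rewrite -EFin_Rintegral// lee_fin.
have i2 : intg P (fun w => h' w ^+ 2).
  apply: integrable_finite; first exact: measurable_funX.
  under eq_integral do rewrite ger0_norm ?sqr_ge0//.
  by apply: le_lt_trans fatouC _; rewrite ltry.
have i1 : intg P h'.
  apply: (@intg_le _ _ _ _ _ (fun w => 1 + h' w ^+ 2)) => //.
    by apply: intgD => //; exact: intg_cst.
  by move=> w; exact: mart_norm_le_sq.
have le2 : \int[P]_w (h' w ^+ 2) <= C by rewrite -lee_fin EFin_Rintegral.
split => //.
apply/cvgrPdist_le => e e0.
(* so that (2 / K) * (2 * C) is less than e / 2 *)
pose K := 8 * (C + 1) / e.
have K0 : 0 < K by rewrite divr_gt0// mulr_gt0// ltr_wpDl.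
pose m n w := Num.min `|h n w - h' w| K.
have mm n : measurable_fun setT (m n).
  apply: measurable_minr => //; apply: measurableT_comp => //.
  exact: measurable_funB.
have m0 n w : 0 <= m n w by rewrite le_min normr_ge0 ltW.
have [_ cm] : intg P (fun=> 0) /\ (fun n => \int[P]_w m n w) @ \oo --> \int[P]_w (0:R).
  apply: (@bounded_cvg_Rintegral _ _ K) => //.
    by move=> n w; rewrite ger0_norm// ge_min lexx orbT.
  move=> w; apply/cvgrPdist_le => b b0.
  have /cvgrPdist_le /(_ _ b0) := hh' w.
  apply: filterS => n /= hb; rewrite sub0r normrN ger0_norm//.
  by rewrite (le_trans _ hb)// distrC ge_min lexx.
rewrite Rintegral_cstT in cm.
have e2 : 0 < e / 2 by rewrite divr_gt0.
have /cvgrPdist_le /(_ _ e2) := cm.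
apply: filterS => n /=; rewrite sub0r normrN.
have mi : intg P (m n).
  by apply: (@intg_bounded _ _ _ _ _ K) => // w; rewrite ger0_norm// ge_min lexx orbT.
rewrite ger0_norm; last exact: Rintegral_ge0.
move=> me; rewrite distrC -(RintegralB measurableT (hi n) i1).
apply: le_trans (le_normr_Rintegral measurableT (intgB (hi n) i1)) _.
have absi : intg P (fun w => `|h n w - h' w|).
  apply: (@intg_le _ _ _ _ _ (fun w => 1 + (2 * h n w ^+ 2 + 2 * h' w ^+ 2))).
  - by apply: measurableT_comp => //; exact: measurable_funB.
  - by apply: intgD; [exact: intg_cst|apply: intgD; apply: intgZ].
  - move=> w; rewrite normr_id; apply: le_trans (mart_norm_le_sq _) _; rewrite lerD2l.
    by rewrite -subr_ge0 [X in 0 <= X](_ : _ = (h n w + h' w) ^+ 2) ?sqr_ge0//; ring.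
have sqi : intg P (fun w => (2 / K) * (h n w ^+ 2 + h' w ^+ 2)).
  by apply: intgZ; apply: intgD.
apply: (@le_trans _ _ (\int[P]_w (m n w + (2 / K) * (h n w ^+ 2 + h' w ^+ 2)))).
  apply: (le_Rintegral measurableT absi (intgD mi sqi)) => w _.
  rewrite /m minEle; case: ifPn => [_|]; first by rewrite lerDl mulr_ge0 ?addr_ge0 ?sqr_ge0// divr_ge0// ltW.
  rewrite -ltNge => Kd; set D := `|h n w - h' w| in Kd *.
  have D2 : D * K <= D ^+ 2 by rewrite expr2 ler_pM2l ?(lt_trans K0)// ltW.
  have D3 : D ^+ 2 <= 2 * (h n w ^+ 2 + h' w ^+ 2).
    rewrite /D real_normK ?num_real//.
    by rewrite -subr_ge0 [X in 0 <= X](_ : _ = (h n w + h' w) ^+ 2) ?sqr_ge0//; ring.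
  have : D <= 2 / K * (h n w ^+ 2 + h' w ^+ 2).
    by rewrite mulrAC ler_pdivlMr// (le_trans D2).
  by move/le_trans; apply; rewrite lerDr ltW.
rewrite (RintegralD measurableT mi sqi) (RintegralZl _ measurableT (intgD (h2i n) i2)).
rewrite (RintegralD measurableT (h2i n) i2).
have h1 := hC n; rewrite [leRHS](splitr e) lerD//.
have -> : e / 2 = 2 / K * (2 * (C + 1)).
  by rewrite /K; field; rewrite !gt_eqF// ltr_wpDl.
by rewrite ler_pM2l ?divr_gt0//; lra.
Qed.

End L2Convergence.

(** * The plane *)

Section PlaneVectors.
Variable R : realType.

Lemma dotV2 (u v : 'cV[R]_2) : dotV u v = u 0 0 * v 0 0 + u 1 0 * v 1 0.
Proof.
rewrite /dotV mxE !big_ord_recl big_ord0 addr0 !mxE.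
by congr (u _ _ * v _ _ + u _ _ * v _ _); apply/val_inj.
Qed.

Lemma mul_col2 (M : 'M[R]_2) (v : 'cV[R]_2) k :
  (M *m v) k 0 = M k 0 * v 0 0 + M k 1 * v 1 0.
Proof.
rewrite mxE !big_ord_recl big_ord0 addr0.
by congr (M k _ * v _ 0 + M k _ * v _ 0); apply/val_inj.
Qed.

(** The mean value inequality. *)
Lemma expR_dist1 (x : R) : `|expR x - 1| <= `|x| * expR `|x|.
Proof.
have h1 := expR_ge1Dx x; have h2 := expR_ge1Dx (- x).
have [x0|x0] := leP 0 x.
  rewrite !ger0_norm//; last by lra.
  have : expR x * (1 - x) <= 1.
    by move: h2; rewrite expRN => h2; rewrite -ler_pdivlMl ?expR_gt0// mulr1; lra.
  by set e := expR x; nra.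
have h3 : expR x <= 1 by rewrite expR_le1 ltW.
rewrite ler0_norm ?subr_le0// ltr0_norm//.
have := expR_ge1Dx (- x); have := expR_gt0 (- x); set e := expR (- x); nra.
Qed.

Lemma continuous_borel (n : nat) (f : 'cV[R]_n -> R) (B : set R) :
  continuous f -> measurable B -> measurable (f @^-1` B : set (borelV R n)).
Proof.
move=> cf mB.
have mf : measurable_fun setT (f : borelV R n -> R).
  apply: (measurability _ (RGenOpens.measurableE R)) => _ [_ [a [b ->]] <-].
  rewrite setTI; apply: sub_sigma_algebra.
  by move/continuousP : cf; apply; exact: interval_open.
by have := mf measurableT B mB; rewrite setTI.
Qed.

End PlaneVectors.

Section FullSet.
Context (d : measure_display) (T : measurableType d) (R : realType).
Variables (P : probability T R) (D : set T).
Hypotheses (mD : measurable D) (PD : P (~` D) = 0%E).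

Lemma restrict_meas (f : T -> R) : measurable_fun setT f ->
  measurable_fun setT (fun w => f w * \1_D w).
Proof. by move=> mf; apply: measurable_funM. Qed.

Lemma restrict_intg (f : T -> R) : intg P f ->
  intg P (fun w => f w * \1_D w) /\ \int[P]_w (f w * \1_D w) = \int[P]_w f w.
Proof.
move=> fi; have mf := intg_meas fi.
have i1 : intg P (fun w => f w * \1_D w).
  apply: (@intg_le _ _ _ _ _ (fun w => `|f w|)); first exact: restrict_meas.
    exact: (integrable_norm fi).
  move=> w; rewrite normrM ler_piMr// indicE.
  by case: (w \in D); rewrite ?normr1 ?normr0.
split => //; rewrite /Rintegral; congr fine.
apply: ae_eq_integral => //.
- by apply/measurable_EFinP; exact: restrict_meas.
- exact/measurable_EFinP.
exists (~` D); split => //; first exact: measurableC.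
by move=> w /= H Dw; apply: H => _; rewrite indicE mem_set// mulr1.
Qed.
End FullSet.

(** * The process started at a point *)

Definition cost (R : realType) (a b : R) (v : 'cV[R]_2) : R := a * v 0 0 + b * v 1 0.

(** exp (- (a z1 + b z2)) on the orthant; the absolute values keep it between 0
    and 1 on the whole plane, for all a and b. *)
Definition expcost (R : realType) (a b : R) (v : 'cV[R]_2) : R :=
  expR (- (`|a * v 0 0| + `|b * v 1 0|)).

Definition kquad (R : realType) (Gamma : 'M[R]_2) (a b : R) : R :=
  Gamma 0 0 * a ^+ 2 / 2 + Gamma 0 1 * a * b + Gamma 1 1 * b ^+ 2 / 2.

(** The exponent of the Laplace transform, per unit of time, of the increments
    of a Brownian motion with drift mu and covariance Gamma. *)
Definition kexponent (R : realType) (mu : 'cV[R]_2) (Gamma : 'M[R]_2) (a b : R) : R :=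
  kquad Gamma a b - (a * mu 0 0 + b * mu 1 0).

Section Cost.
Variable R : realType.
Implicit Types (a b : R) (v : 'cV[R]_2).

Lemma continuous_cost a b : continuous (cost a b : 'cV[R]_2 -> R).
Proof.
move=> v; have h k : (fun v' : 'cV[R]_2 => v' k 0) @ v --> v k 0.
  exact: coord_continuous.
have h0 := h 0; have h1 := h 1.
have FF : Filter (nbhs v) := nbhs_filter v.
have ha : (fun v' : 'cV[R]_2 => a * v' 0 0) @ v --> a * v 0 0.
  exact: (@cvgM _ _ (nbhs v) FF _ _ _ _ (cvg_cst _) h0).
have hb : (fun v' : 'cV[R]_2 => b * v' 1 0) @ v --> b * v 1 0.
  exact: (@cvgM _ _ (nbhs v) FF _ _ _ _ (cvg_cst _) h1).
exact: (@cvgD _ _ _ (nbhs v) FF _ _ _ _ ha hb).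
Qed.

Lemma continuous_expcost a b : continuous (expcost a b : 'cV[R]_2 -> R).
Proof.
have h c k : continuous (fun v : 'cV[R]_2 => `|c * v k 0|).
  move=> v; apply: (@continuous_comp _ _ _ (fun v : 'cV[R]_2 => c * v k 0) Num.norm); last exact: norm_continuous.
  have FF : Filter (nbhs v) := nbhs_filter v.
  by apply: (@cvgM _ _ (nbhs v) FF _ _ _ _ (cvg_cst _)); exact: coord_continuous.
move=> v; apply: (@continuous_comp _ _ _ (fun v => - (`|a * v 0 0| + `|b * v 1 0|)) expR).
  have FF : Filter (nbhs v) := nbhs_filter v.
  exact: (@cvgN _ _ _ (nbhs v) FF _ _ (@cvgD _ _ _ (nbhs v) FF _ _ _ _ (h a 0 v) (h b 1 v))).
exact: continuous_expR.
Qed.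

Lemma expcost01 a b v : 0 <= expcost a b v <= 1.
Proof. by rewrite expR_ge0 expR_le1 oppr_le0 addr_ge0. Qed.

Lemma expcost_orthant a b v : 0 <= a -> 0 <= b -> orthant v ->
  expcost a b v = expR (- cost a b v).
Proof.
by move=> a0 b0 v0; rewrite /expcost !ger0_norm// mulr_ge0// v0.
Qed.

Lemma kquadE (Gamma : 'M[R]_2) a b : Gamma^T = Gamma ->
  dotV (\col_(i < 2) [:: a; b]`_i) (Gamma *m (\col_(i < 2) [:: a; b]`_i)) =
  2 * kquad Gamma a b.
Proof.
move=> GT; rewrite dotV2 !mxE !big_ord_recl !big_ord0 !mxE /= /kquad.
have -> : Gamma 1 (lift ord0 ord0) = Gamma 1 1 by congr (Gamma _ _); apply/val_inj.
have -> : Gamma 0 (lift ord0 ord0) = Gamma 0 1 by congr (Gamma _ _); apply/val_inj.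
have -> : Gamma 1 ord0 = Gamma 0 1 by rewrite -{1}GT mxE; congr (Gamma _ _); apply/val_inj.
have -> : Gamma 0 ord0 = Gamma 0 0 by congr (Gamma _ _); apply/val_inj.
by field.
Qed.

Lemma kquad_gt0 (Gamma : 'M[R]_2) a b : sym_posdef Gamma -> (a != 0) || (b != 0) ->
  0 < kquad Gamma a b.
Proof.
move=> [GT Gp] ab; have := Gp (\col_(i < 2) [:: a; b]`_i).
rewrite kquadE// => H; rewrite -(pmulr_rgt0 _ (ltr0n R 2)); apply: H.
apply/eqP => /matrixP E; move: ab.
by have := E 0 0; have := E 1 0; rewrite !mxE /= => -> ->; rewrite eqxx.
Qed.

End Cost.

(** The weights t + s^- and p + q^- turn the two linear forms into a bound of
    both boundary terms: the negative parts of q and s are absorbed because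
    p t - q^- s^- > 0. *)
Lemma boundary_domination (R : realType) (p q s t : R) :
  0 < p -> 0 < t -> 0 < p * t - q * s ->
  exists c1 c2 : R, forall A0 A1 B0 B1, 0 <= A1 <= A0 -> 0 <= B1 <= B0 ->
    A0 + B0 <= c1 * (p * A0 + q * B1) + c2 * (s * A1 + t * B0).
Proof.
move=> p0 t0 det0; pose sm := Num.max 0 (- s); pose qm := Num.max 0 (- q).
have sm0 : 0 <= sm by rewrite le_max lexx.
have qm0 : 0 <= qm by rewrite le_max lexx.
have sms : - s <= sm by rewrite le_max lexx orbT.
have qmq : - q <= qm by rewrite le_max lexx orbT.
pose k := p * t - qm * sm.
have k0 : 0 < k.
  rewrite /k /qm /sm; have [q0|q0] := leP 0 q.
    by rewrite max_l ?oppr_le0// mul0r subr0 mulr_gt0.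
  have [s0|s0] := leP 0 s.
    by rewrite [Num.max 0 (- s)]max_l ?oppr_le0// mulr0 subr0 mulr_gt0.
  by rewrite !max_r ?oppr_ge0 ?ltW// mulrNN.
exists (k^-1 * (t + sm)), (k^-1 * (p + qm)) => A0 A1 B0 B1 /andP[a1 a2] /andP[b1 b2].
rewrite -!mulrA -mulrDr ler_pdivlMl//.
have h1 : - sm * A0 <= s * A1.
  have : - sm * A0 <= - sm * A1 by rewrite !mulNr lerN2 ler_wpM2l.
  by move/le_trans; apply; rewrite ler_wpM2r//; lra.
have h2 : - qm * B0 <= q * B1.
  have : - qm * B0 <= - qm * B1 by rewrite !mulNr lerN2 ler_wpM2l.
  by move/le_trans; apply; rewrite ler_wpM2r//; lra.
have h1' : (p + qm) * (- sm * A0) <= (p + qm) * (s * A1).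
  by rewrite ler_wpM2l// addr_ge0// ltW.
have h2' : (t + sm) * (- qm * B0) <= (t + sm) * (q * B1).
  by rewrite ler_wpM2l// addr_ge0// ltW.
by rewrite /k; lra.
Qed.

Section ReflectedAt.
Context (d : measure_display) (T : measurableType d) (R : realType).
Variables (P : probability T R) (F : R -> set (set T)).
Variables (mu x : 'cV[R]_2) (Gamma Rfl : 'M[R]_2) (Z X Y : R -> T -> 'cV[R]_2).
Hypothesis hG : sym_posdef Gamma.
Hypothesis hF : filtration F.
Hypothesis adZ : adapted F Z.
Hypothesis cZ : forall w, continuous_path (Z^~ w).
Hypothesis hX : brownian_motion P F mu Gamma x X.
Hypothesis hY : regulator P F Z Y.
Hypothesis hZ : {ae P, forall w, forall t : R, 0 <= t ->
  Z t w = X t w + Rfl *m Y t w /\ orthant (Z t w)}.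

Lemma F_sigma t : 0 <= t -> sigma_algebra setT (F t).
Proof. by move=> t0; have [/(_ t t0)[]] := hF. Qed.

Lemma F_meas t : 0 <= t -> F t `<=` measurable.
Proof. by move=> t0; have [/(_ t t0)[]] := hF. Qed.

Lemma F_mono s t : 0 <= s -> s <= t -> F s `<=` F t.
Proof. by move=> s0 st; have [_] := hF; apply. Qed.

Lemma adapted_fmeas (W : R -> T -> 'cV[R]_2) (f : 'cV[R]_2 -> R) t :
  adapted F W -> continuous f -> 0 <= t -> fmeas (F t) (fun w => f (W t w)).
Proof.
move=> adW cf t0 B mB; apply: (adW t t0 (f @^-1` B)).
exact: continuous_borel.
Qed.

Section Direction.
Variables a b : R.
Hypothesis ab : (a != 0) || (b != 0).

Let u : 'cV[R]_2 := \col_(i < 2) [:: - a; - b]`_i.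

Lemma dot_direction v : dotV u v = - cost a b v.
Proof. by rewrite dotV2 !mxE /= /cost; ring. Qed.

Lemma direction_neq0 : u != 0.
Proof.
apply/eqP => /matrixP E; move: ab.
have := E 0 0; have := E 1 0; rewrite !mxE /= => /eqP + /eqP.
by rewrite !oppr_eq0 => -> ->.
Qed.

Lemma costB v v' : cost a b (v - v') = cost a b v - cost a b v'.
Proof. by rewrite /cost !mxE; ring. Qed.

Definition increment_exp s t w := expR (- cost a b (X t w - X s w)).

Lemma increment_fmeas s t : 0 <= s -> s <= t -> fmeas (F t) (increment_exp s t).
Proof.
move=> s0 st; have t0 := le_trans s0 st.
have sF := F_sigma t0.
have h1 : fmeas (F t) (fun w => cost a b (X t w)).
  by apply: adapted_fmeas => //; [exact: bm_adapted hX|exact: continuous_cost].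
have h2 : fmeas (F t) (fun w => cost a b (X s w)).
  apply: fmeasW (F_mono s0 st) _.
  by apply: adapted_fmeas => //; [exact: bm_adapted hX|exact: continuous_cost].
have -> : increment_exp s t = fun w => expR (cost a b (X s w) - cost a b (X t w)).
  by apply/funext => w; rewrite /increment_exp costB opprB.
apply/(fmeasP _ sF); apply: measurableT_comp => //.
by apply: measurable_funB; apply/(fmeasP _ sF).
Qed.

Lemma increment_mgf s t : 0 <= s -> s < t ->
  intg P (increment_exp s t) /\
  \int[P]_w increment_exp s t w = expR ((t - s) * kexponent mu Gamma a b).
Proof.
move=> s0 st; have t0 := le_trans s0 (ltW st).
have H := bm_gaussian hX s0 st direction_neq0.
pose U w := dotV u (X t w - X s w).
have mI : measurable_fun setT (increment_exp s t).
  by apply: fmeas_measurable (increment_fmeas s0 (ltW st)); exact: F_meas.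
have mU : measurable_fun setT U.
  have -> : U = fun w => cost a b (X s w) - cost a b (X t w).
    by apply/funext => w; rewrite /U dot_direction costB opprB.
  have mc r : 0 <= r -> measurable_fun setT (fun w => cost a b (X r w)).
    move=> r0; apply: (fmeas_measurable (F_meas r0)).
    by apply: adapted_fmeas => //; [exact: bm_adapted hX|exact: continuous_cost].
  by apply: measurable_funB; exact: mc.
have mU' : measurable_fun setT (U : T -> measurableTypeR R) by exact: mU.
pose V : {mfun T >-> measurableTypeR R} := HB.pack (U : T -> measurableTypeR R)
  (isMeasurableFun.Build _ _ _ _ (U : T -> measurableTypeR R) mU').
set m := dotV u _ in H; set sg := Num.sqrt _ in H.
have var : dotV u (((t - s) *: Gamma) *m u) = (t - s) * (2 * kquad Gamma a b).
  have [GT _] := hG.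
  have -> : 2 * kquad Gamma a b = 2 * kquad Gamma (- a) (- b) by rewrite /kquad; ring.
  by rewrite -kquadE// -scalemxAl /dotV -scalemxAr mxE.
have var0 : 0 < (t - s) * (2 * kquad Gamma a b).
  by rewrite mulr_gt0 ?subr_gt0// mulr_gt0// kquad_gt0.
have sg0 : sg != 0 by rewrite gt_eqF// sqrtr_gt0 var.
have sg2 : sg ^+ 2 = (t - s) * (2 * kquad Gamma a b).
  by rewrite /sg sqr_sqrtr var// ltW.
have E : (\int[P]_w (increment_exp s t w)%:E =
    (expR ((t - s) * kexponent mu Gamma a b))%:E)%E.
  transitivity (\int[distribution P V]_y (expR y)%:E)%E.
    have me : measurable_fun setT (fun y : measurableTypeR R => (expR y)%:E).
      by apply/measurable_EFinP; exact: measurable_expR.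
    rewrite (ge0_integral_distribution V me); last by move=> y; rewrite lee_fin expR_ge0.
    by apply: eq_integral => w _; rewrite /= /U dot_direction.
  transitivity (\int[normal_prob m sg]_y (expR y)%:E)%E.
    apply: eq_measure_integral => A mA _; exact: (H A mA).
  rewrite normal_mgf//; congr (expR _)%:E.
  by rewrite sg2 /m dot_direction /cost !mxE /kexponent; field.
have i : intg P (increment_exp s t).
  apply: integrable_finite => //.
  under eq_integral do rewrite ger0_norm ?expR_ge0//.
  by rewrite E ltry.
by split => //; rewrite /Rintegral E.
Qed.

Lemma increment_indep s t A (B : set R) : 0 <= s -> s < t -> F s A -> measurable B ->
  P (A `&` increment_exp s t @^-1` B) = (P A * P (increment_exp s t @^-1` B))%E.
Proof.
move=> s0 st FA mB.
pose f v := expR (- cost a b v).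
have cf : continuous f.
  move=> v; apply: (@continuous_comp _ _ _ (fun v => - cost a b v) expR).
    by apply: continuousN; exact: continuous_cost.
  exact: continuous_expR.
by have := bm_independent hX s0 st FA (continuous_borel cf mB).
Qed.

Let g n i w := expcost a b (Z (dyadic R n i) w).
Let xi n i w := increment_exp (dyadic R n i) (dyadic R n i.+1) w.
Let kap := kexponent mu Gamma a b.
Let c n := expR (kap / 2 ^+ n).
Let M n w := mart (g n) (xi n) (c n) (2 ^ n) w.

(** Over a dyadic interval, g * xi is the value that the exponential would have
    reached under the increment of X alone; the difference is due to Y. The mean
    of this sum is computed from one_step_sumE, its limit on the paths from
    one_step_jump. *)
Definition one_step_sum n w := \sum_(0 <= i < 2 ^ n) (g n i.+1 w - g n i w * xi n i w).

Lemma one_step_sumE n w : one_step_sum n w =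
  g n (2 ^ n)%N w - g n 0%N w - M n w - (c n - 1) * \sum_(0 <= i < 2 ^ n) g n i w.
Proof.
rewrite /M /mart -(telescope_sumr (fun i => g n i w))// mulr_sumr -!sumrB.
by apply: eq_bigr => i _; ring.
Qed.

Lemma dyadic_ge0 n i : 0 <= dyadic R n i.
Proof. by rewrite divr_ge0 ?exprn_ge0. Qed.

Lemma dyadic_lt n i : dyadic R n i < dyadic R n i.+1.
Proof. by rewrite -subr_gt0 dyadic_step invr_gt0 exprn_gt0. Qed.

Lemma kexponent2 : kexponent mu Gamma (2 * a) (2 * b) = 2 * kap + 2 * kquad Gamma a b.
Proof. by rewrite /kap /kexponent /kquad; field. Qed.

Lemma xi_sq n i w : xi n i w ^+ 2 =
  expR (- cost (2 * a) (2 * b) (X (dyadic R n i.+1) w - X (dyadic R n i) w)).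
Proof.
by rewrite /xi /increment_exp expr2 -expRD; congr expR; rewrite /cost; ring.
Qed.

End Direction.

Section DirectionL2.
Variables a b : R.
Hypothesis ab : (a != 0) || (b != 0).

Let g n i w := expcost a b (Z (dyadic R n i) w).
Let xi n i w := increment_exp a b (dyadic R n i) (dyadic R n i.+1) w.
Let kap := kexponent mu Gamma a b.
Let c n := expR (kap / 2 ^+ n).
Let M n w := mart (g n) (xi n) (c n) (2 ^ n) w.
Let v := 2 * kquad Gamma a b.

Lemma state_meas t : 0 <= t -> measurable_fun setT (fun w => expcost a b (Z t w)).
Proof.
move=> t0; apply: (fmeas_measurable (F_meas t0)).
by apply: adapted_fmeas => //; exact: continuous_expcost.
Qed.

Lemma state_intg t : 0 <= t -> intg P (fun w => expcost a b (Z t w)).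
Proof.
move=> t0; apply: (@intg_bounded _ _ _ _ _ 1); first exact: state_meas.
by move=> w; have /andP[? ?] := expcost01 a b (Z t w); rewrite ger0_norm.
Qed.

Lemma one_step_mart n : [/\ intg P (M n), intg P (fun w => M n w ^+ 2),
  \int[P]_w M n w = 0 &
  \int[P]_w (M n w ^+ 2) <= (2 ^ n)%:R *
     (expR (kexponent mu Gamma (2 * a) (2 * b) / 2 ^+ n) - c n ^+ 2)].
Proof.
have ab2 : (2 * a != 0) || (2 * b != 0) by rewrite !mulf_eq0 !pnatr_eq0.
apply: (@mart_l2 _ _ _ P (fun i => F (dyadic R n i)) (g n) (xi n) (c n) _ (2 ^ n)) => //.
- by move=> i _; apply: F_sigma; exact: dyadic_ge0.
- by move=> i _; apply: F_meas; exact: dyadic_ge0.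
- by move=> i _; apply: F_mono; [exact: dyadic_ge0|exact: ltW (dyadic_lt n i)].
- move=> i _; apply: adapted_fmeas => //; [exact: continuous_expcost|exact: dyadic_ge0].
- by move=> i w; exact: expcost01.
- by move=> i _; apply: increment_fmeas; [exact: dyadic_ge0|exact: ltW (dyadic_lt n i)].
- by move=> i w; exact: expR_ge0.
- by move=> i _ A B FA mB; apply: increment_indep => //; [exact: dyadic_ge0|exact: dyadic_lt].
- by move=> i _; have [] := increment_mgf ab (dyadic_ge0 n i) (dyadic_lt n i).
- move=> i _; rewrite (_ : (fun w => _) = increment_exp (2 * a) (2 * b) (dyadic R n i) (dyadic R n i.+1)).
    by have [] := increment_mgf ab2 (dyadic_ge0 n i) (dyadic_lt n i).
  by apply/funext => w; exact: xi_sq.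
- move=> i _; have [_ ->] := increment_mgf ab (dyadic_ge0 n i) (dyadic_lt n i).
  by rewrite dyadic_step mulrC.
- move=> i _; rewrite (_ : (fun w => _) = increment_exp (2 * a) (2 * b) (dyadic R n i) (dyadic R n i.+1)).
    have [_ ->] := increment_mgf ab2 (dyadic_ge0 n i) (dyadic_lt n i).
    by rewrite dyadic_step mulrC.
  by apply/funext => w; exact: xi_sq.
Qed.

Lemma inv_exp2_01 n : 0 < ((2 : R) ^+ n)^-1 <= 1.
Proof. by rewrite invr_gt0 exprn_gt0// invf_le1 ?exprn_gt0// exprn_ege1// ler1n. Qed.

(** The 2^n increments have variances of order 2^-n. *)
Lemma one_step_var n : (2 ^ n)%:R *
  (expR (kexponent mu Gamma (2 * a) (2 * b) / 2 ^+ n) - c n ^+ 2) <=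
  expR (2 * `|kap|) * (v * expR v).
Proof.
have /andP[h0 h1] := inv_exp2_01 n; set h := (2 ^+ n)^-1 in h0 h1 *.
have v0 : 0 < v by rewrite mulr_gt0// kquad_gt0.
have -> : expR (kexponent mu Gamma (2 * a) (2 * b) / 2 ^+ n) - c n ^+ 2 =
    expR (2 * kap * h) * (expR (v * h) - 1).
  rewrite kexponent2 -/kap -/v /c -/h expr2 [RHS]mulrBr [X in _ = _ - X]mulr1 -!expRD.
  by congr (expR _ - expR _); ring.
have e1 : expR (v * h) - 1 <= v * h * expR v.
  have vh : 0 <= v * h by rewrite mulr_ge0 ?(ltW v0) ?(ltW h0).
  have := expR_dist1 (v * h); rewrite (ger0_norm vh).
  move/(le_trans (ler_norm _))/le_trans; apply.
  by apply: ler_wpM2l => //; rewrite ler_expR ger_pMr.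
have e2 : expR (2 * kap * h) <= expR (2 * `|kap|).
  rewrite ler_expR -mulrA ler_pM2l// (le_trans (ler_norm _))// normrM (gtr0_norm h0).
  by rewrite ler_piMr.
have e0 : 0 <= expR (v * h) - 1 by rewrite subr_ge0 -expR0 ler_expR mulr_ge0 ?(ltW v0) ?(ltW h0).
apply: (@le_trans _ _ ((2 ^ n)%:R * (expR (2 * `|kap|) * (v * h * expR v)))).
  rewrite ler_pM2l ?ltr0n ?expn_gt0// ler_pM ?expR_ge0//.
have -> : (2 ^ n)%:R * (expR (2 * `|kap|) * (v * h * expR v)) =
   ((2 ^ n)%:R * h) * (expR (2 * `|kap|) * (v * expR v)) by ring.
by rewrite natrX /h divff ?mul1r// expf_neq0.
Qed.

Lemma drift_bound n : (2 ^ n)%:R * `|c n - 1| <= `|kap| * expR `|kap|.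
Proof.
have /andP[h0 h1] := inv_exp2_01 n; set h := (2 ^+ n)^-1 in h0 h1 *.
rewrite /c -/h; apply: (@le_trans _ _ ((2 ^ n)%:R * (`|kap| * h * expR `|kap|))).
  rewrite ler_pM2l ?ltr0n ?expn_gt0//; apply: le_trans (expR_dist1 _) _.
  rewrite normrM (gtr0_norm h0) ler_wpM2l ?mulr_ge0 ?(ltW h0)//.
  by rewrite ler_expR ler_piMr.
have -> : (2 ^ n)%:R * (`|kap| * h * expR `|kap|) =
   ((2 ^ n)%:R * h) * (`|kap| * expR `|kap|) by ring.
by rewrite natrX /h divff ?mul1r// expf_neq0.
Qed.

Lemma drift_sum_bound n w :
  `|(c n - 1) * \sum_(0 <= i < 2 ^ n) g n i w| <= `|kap| * expR `|kap|.
Proof.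
apply: le_trans (drift_bound n); rewrite normrM mulrC ler_wpM2r//.
apply: le_trans (ler_norm_sum _ _ _) _.
rewrite -[X in _ <= X]mulr1 mulr_natl -[X in _ *+ X]subn0 -sumr_const_nat.
by apply: ler_sum => i _; have /andP[? ?] := expcost01 a b (Z (dyadic R n i) w); rewrite ger0_norm.
Qed.

(** The telescoping part and the drift are bounded, the martingale is bounded in
    L2 and centred. *)
Lemma one_step_l2 : exists C, forall n,
  [/\ intg P (one_step_sum a b n), intg P (fun w => one_step_sum a b n w ^+ 2),
      \int[P]_w (one_step_sum a b n w ^+ 2) <= C &
      \int[P]_w one_step_sum a b n w =
        \int[P]_w expcost a b (Z 1 w) - \int[P]_w expcost a b (Z 0 w)
        - (c n - 1) * \sum_(0 <= i < 2 ^ n) \int[P]_w expcost a b (Z (dyadic R n i) w)].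
Proof.
pose K := 1 + `|kap| * expR `|kap|.
exists (2 * K ^+ 2 + 2 * (expR (2 * `|kap|) * (v * expR v))) => n.
have [Mi M2i M0 M2] := one_step_mart n.
have M2' := le_trans M2 (one_step_var n).
have gi i : intg P (g n i) by apply: state_intg; exact: dyadic_ge0.
pose A w := g n (2 ^ n)%N w - g n 0%N w - (c n - 1) * \sum_(0 <= i < 2 ^ n) g n i w.
have sumi : intg P (fun w => \sum_(0 <= i < 2 ^ n) g n i w) by exact: intg_sum.
have Ai : intg P A by apply: intgB; [exact: intgB|exact: intgZ].
have AK w : `|A w| <= K.
  apply: le_trans (ler_normB _ _) _; apply: lerD; last exact: drift_sum_bound.
  have /andP[? ?] := expcost01 a b (Z (dyadic R n (2 ^ n)) w).
  have /andP[? ?] := expcost01 a b (Z (dyadic R n 0) w).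
  by rewrite ler_norml /g; apply/andP; split; lra.
have E : one_step_sum a b n = fun w => A w - M n w.
  by apply/funext => w; rewrite one_step_sumE /A /M /g /xi /c /kap; ring.
have Si : intg P (one_step_sum a b n) by rewrite E; exact: intgB.
have sqb w : one_step_sum a b n w ^+ 2 <= 2 * K ^+ 2 + 2 * M n w ^+ 2.
  rewrite E; have A2 : A w ^+ 2 <= K ^+ 2.
    rewrite -[A w ^+ 2]real_normK ?num_real// ler_pXn2r ?nnegrE//.
    by rewrite addr_ge0// mulr_ge0 ?expR_ge0.
  by have := sqr_ge0 (A w + M n w); nra.
have bi : intg P (fun w => 2 * K ^+ 2 + 2 * M n w ^+ 2).
  by apply: intgD; [exact: intg_cst|exact: intgZ].
have S2i : intg P (fun w => one_step_sum a b n w ^+ 2).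
  apply: (@intg_le _ _ _ _ _ _ _ bi); first by apply: measurable_funX; exact: intg_meas Si.
  by move=> w; rewrite ger0_norm ?sqr_ge0.
split => //.
  apply: le_trans (le_Rintegral measurableT S2i bi (fun w _ => sqb w)) _.
  rewrite (RintegralD measurableT (intg_cst _ _) (intgZ _ M2i)) Rintegral_cstT.
  by rewrite (RintegralZl _ measurableT M2i) lerD2l ler_pM2l.
rewrite E (RintegralB measurableT Ai Mi) M0 subr0.
rewrite (RintegralB measurableT (intgB (gi _) (gi _)) (intgZ _ sumi)).
rewrite (RintegralB measurableT (gi _) (gi _)) (RintegralZl _ measurableT sumi).
by rewrite Rintegral_sumT// /g dyadic1 dyadic0.
Qed.

End DirectionL2.

Section Pathwise.

Definition good w : Prop :=
  [/\ continuous_path (Y^~ w),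
      (forall i (s t : R), 0 <= s -> s <= t -> Y s w i ord0 <= Y t w i ord0),
      (forall i, complementary (fun s => Z s w i ord0) (fun s => Y s w i ord0)) &
      forall t : R, 0 <= t -> Z t w = X t w + Rfl *m Y t w /\ orthant (Z t w)].

Lemma good_ae : exists D, [/\ measurable D, P (~` D) = 0%E & forall w, D w -> good w].
Proof.
have H : {ae P, forall w, good w}.
  have h1 := reg_continuous hY; have h2 := reg_nondecreasing hY.
  have h3 := reg_complementary hY.
  have FF : Filter (almost_everywhere P) by exact: ae_filter_ringOfSetsType.
  have I A B : almost_everywhere P A -> almost_everywhere P B -> almost_everywhere P (A `&` B).
    exact: (@filterI _ _ FF).
  apply: (@filterS _ _ FF _ _ _ (I _ _ (I _ _ h1 h2) (I _ _ h3 hZ))).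
  by move=> w [[? ?] [? ?]]; split.
have [N [mN N0 HN]] := H.
exists (~` N); split; first exact: measurableC; first by rewrite setCK.
by move=> w Nw; apply: contrapT => ng; apply: Nw; exact: HN.
Qed.

Variable w : T.
Hypothesis gw : good w.

Let z k s := Z s w k ord0.
Let y k s := Y s w k ord0.

Lemma coord_path_continuous (W : R -> 'cV[R]_2) k : continuous_path W ->
  {within `[0, +oo[%classic, continuous (fun s => W s k ord0)}.
Proof.
move=> cW u; apply: (@continuous_comp _ _ _ (W : subspace `[0, +oo[%classic -> _) (fun v => v k ord0)).
  exact: cW.
exact: coord_continuous.
Qed.

Lemma coord_unif_cont (W : R -> 'cV[R]_2) k : continuous_path W ->
  unif_cont01 (fun s => W s k ord0).
Proof.
move=> cW0; have cW := @coord_path_continuous W k cW0; apply: within_unif_cont01.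
by apply: continuous_subspaceW cW => u /=; rewrite !in_itv/= => /andP[->].
Qed.

Lemma path_z_unif k : unif_cont01 (z k). Proof. exact: coord_unif_cont. Qed.

Lemma path_y_unif k : unif_cont01 (y k).
Proof. by have [cY _ _ _] := gw; exact: coord_unif_cont cY. Qed.

Lemma path_z_ge0 k s : 0 <= s -> 0 <= z k s.
Proof. by move=> s0; have [_ _ _ H] := gw; have [_] := H s s0; apply. Qed.

Lemma path_y_mono k : nondecreasing01 (y k).
Proof. by move=> s t s0 st _; have [_ H _ _] := gw; exact: H. Qed.

Lemma path_grows k : grows_at_zero (z k) (y k).
Proof.
have [_ _ H _] := gw; apply: complementary_grows_at_zero (H k).
- exact: coord_path_continuous.
- by move=> s; exact: path_z_ge0.
Qed.

Lemma one_step_jump (a b : R) n : 0 <= a -> 0 <= b ->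
  one_step_sum a b n w =
  jump_sum (z 0) (z 1) (y 0) (y 1) (Rfl 0 0) (Rfl 0 1) (Rfl 1 0) (Rfl 1 1) a b n.
Proof.
move=> a0 b0; apply: eq_bigr => i _.
have [_ _ _ H] := gw.
have d0 := dyadic_ge0 n i; have d1 := dyadic_ge0 n i.+1.
have [E0 O0] := H _ d0; have [E1 O1] := H _ d1.
rewrite !expcost_orthant// /increment_exp -expRD mulrBr mulr1 -expRD.
congr (_ - expR _).
rewrite /cost /z /y.
have Ex k : X (dyadic R n i.+1) w k 0 - X (dyadic R n i) w k 0 =
   Z (dyadic R n i.+1) w k 0 - Z (dyadic R n i) w k 0
   - (Rfl k 0 * (Y (dyadic R n i.+1) w 0 0 - Y (dyadic R n i) w 0 0)
    + Rfl k 1 * (Y (dyadic R n i.+1) w 1 0 - Y (dyadic R n i) w 1 0)).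
  by rewrite E0 E1 [in RHS]mxE [in X in _ = _ - X - _]mxE !mul_col2; ring.
rewrite !mxE -!/(_ + _) !Ex; ring.
Qed.

End Pathwise.

Section BoundaryTerms.
Let p := Rfl 0 0. Let q := Rfl 0 1. Let s := Rfl 1 0. Let t := Rfl 1 1.
Hypotheses (p0 : 0 < p) (t0 : 0 < t) (det0 : 0 < p * t - q * s).

Definition boundary_time (k l : 'I_2) (b : R) (w : T) : R :=
  rs_int (fun u => expR (- (b * Z u w l ord0))) (fun u => Y u w k ord0).

Section OnGoodSet.
Variable D : set T.
Hypotheses (mD : measurable D) (PD : P (~` D) = 0%E) (Dg : forall w, D w -> good w).

Let W k l b w := boundary_time k l b w * \1_D w.

Lemma indic_in w : D w -> \1_D w = 1 :> R.
Proof. by move=> Dw; rewrite indicE mem_set. Qed.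

Lemma indic_out w : ~ D w -> \1_D w = 0 :> R.
Proof. by move=> Dw; rewrite indicE memNset. Qed.

Lemma path_max w l : good w -> exists M, 0 <= Z M w l ord0 /\
  forall u, 0 <= u <= 1 -> 0 <= Z u w l ord0 <= Z M w l ord0.
Proof.
move=> gw; have cW := @coord_path_continuous (Z^~ w) l (@cZ w).
have [M M01 HM] : exists2 c, c \in `[0, 1]%R & forall u, u \in `[0, 1]%R -> Z u w l ord0 <= Z c w l ord0.
  apply: (@EVT_max R (fun u => Z u w l ord0)) => //.
  by apply: continuous_subspaceW cW => u /=; rewrite !in_itv/= => /andP[->].
exists M; split.
  by move: M01; rewrite in_itv/= => /andP[M0 _]; exact: path_z_ge0.
move=> u u01; rewrite HM ?in_itv// andbT; apply: path_z_ge0 => //; by case/andP: u01.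
Qed.

Lemma boundary_time0 k l w : good w ->
  boundary_time k l 0 w = Y 1 w k ord0 - Y 0 w k ord0.
Proof.
move=> gw; have := @rs_int0 R (fun u => Z u w l ord0) _ (path_y_mono gw k).
exact.
Qed.

Lemma W_bounds k l b w : 0 <= b -> 0 <= W k l b w <= W k l 0 w.
Proof.
move=> b0; have [Dw|Dw] := pselect (D w); last by rewrite /W indic_out// !mulr0 lexx.
have gw := Dg Dw; rewrite /W indic_in// !mulr1.
have [M [_ zM]] := path_max l gw.
have : expR (- (b * Z M w l ord0)) * (Y 1 w k ord0 - Y 0 w k ord0) <=
    boundary_time k l b w <= Y 1 w k ord0 - Y 0 w k ord0.
  exact: rs_int_bounds b0 (path_y_mono gw k) (@path_z_unif w l) zM.
rewrite (boundary_time0 k l gw) => /andP[h ->].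
rewrite andbT (le_trans _ h)// mulr_ge0 ?expR_ge0// subr_ge0.
exact: (path_y_mono gw k).
Qed.

Lemma W_cvg0 k l w : (fun n => W k l n.+1%:R^-1 w) @ \oo --> W k l 0 w.
Proof.
have [Dw|Dw] := pselect (D w); last first.
  by rewrite /W indic_out// mulr0 (_ : (fun n => _) = fun=> 0); [exact: cvg_cst|apply/funext => n; rewrite mulr0].
have gw := Dg Dw.
have [M [M0 zM]] := path_max l gw.
pose m := Z M w l ord0.
pose dy := Y 1 w k ord0 - Y 0 w k ord0.
have dy0 : 0 <= dy by rewrite subr_ge0; apply: (path_y_mono gw k).
apply: (@cvg_dist_eps _ _ (fun=> W k l 0 w) _ (dy * m)); first exact: cvg_cst.
move=> e e0; exists (Num.truncn e^-1) => n nN.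
have be : n.+1%:R^-1 <= e :> R.
  rewrite invf_ple ?posrE// ltW// (lt_le_trans (Num.Theory.truncnS_gt _))//.
  by rewrite ler_nat ltnS.
have b0 : 0 <= n.+1%:R^-1 :> R by rewrite invr_ge0.
have : expR (- (n.+1%:R^-1 * m)) * dy <= boundary_time k l n.+1%:R^-1 w <= dy.
  exact: rs_int_bounds b0 (path_y_mono gw k) (@path_z_unif w l) zM.
rewrite /W indic_in// !mulr1 (boundary_time0 k l gw) -/dy => /andP[h1 h2].
rewrite distrC ger0_norm ?subr_ge0//.
have h3 : 1 - n.+1%:R^-1 * m <= expR (- (n.+1%:R^-1 * m)) by exact: expR_ge1Dx.
have h4 : dy * (1 - n.+1%:R^-1 * m) <= dy * expR (- (n.+1%:R^-1 * m)) by rewrite ler_wpM2l.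
have h5 : dy * m * n.+1%:R^-1 <= dy * m * e by rewrite ler_wpM2l// mulr_ge0.
move: h1 h4 h5; set E := expR _; set B := boundary_time _ _ _ _; set bn := n.+1%:R^-1.
by nra.
Qed.

Lemma coord_meas (V : R -> T -> 'cV[R]_2) k u : adapted F V -> 0 <= u ->
  measurable_fun setT (fun w => V u w k ord0).
Proof.
move=> adV u0; apply: (fmeas_measurable (F_meas u0)).
by apply: (@adapted_fmeas _ (fun v => v k ord0)) => //; exact: coord_continuous.
Qed.

Lemma W_meas k l b : 0 <= b -> measurable_fun setT (W k l b).
Proof.
move=> b0; pose S n w := rs_sum (fun u => expR (- (b * Z u w l ord0))) (fun u => Y u w k ord0) n * \1_D w.
have mS n : measurable_fun setT (S n).
  apply: measurable_funM => //; apply: measurable_sum => i.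
  apply: measurable_funM.
    apply: measurableT_comp => //; apply: measurableT_comp => //.
    by apply: measurable_funM => //; apply: coord_meas => //; exact: dyadic_ge0.
  by apply: measurable_funB; apply: coord_meas (reg_adapted hY) _; exact: dyadic_ge0.
apply: (measurable_fun_cvg mS) => w _.
have [Dw|Dw] := pselect (D w); last first.
  by rewrite /W indic_out// mulr0 (_ : _ ^~ w = fun=> 0); [exact: cvg_cst|apply/funext => n; rewrite /S indic_out// mulr0].
have gw := Dg Dw; rewrite /W indic_in// mulr1.
rewrite (_ : _ ^~ w = rs_sum (fun u => expR (- (b * Z u w l ord0))) (fun u => Y u w k ord0)); last first.
  by apply/funext => n; rewrite /S indic_in// mulr1.
apply: rs_sum_cvg (path_y_mono gw k); apply: unif_cont_expRN => //; last exact: path_z_unif.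
by move=> u /andP[u0 _]; exact: path_z_ge0.
Qed.

Lemma boundary_identity_pos a b : 0 <= a -> 0 <= b -> (a != 0) || (b != 0) ->
  intg P (fun w => (a * p + b * s) * W 0 1 b w + (a * q + b * t) * W 1 0 a w) /\
  (fun n => \int[P]_w expcost a b (Z 1 w) - \int[P]_w expcost a b (Z 0 w)
    - (expR (kexponent mu Gamma a b / 2 ^+ n) - 1) *
      \sum_(0 <= i < 2 ^ n) \int[P]_w expcost a b (Z (dyadic R n i) w)) @ \oo -->
  - (\int[P]_w ((a * p + b * s) * W 0 1 b w + (a * q + b * t) * W 1 0 a w)).
Proof.
move=> a0 b0 ab; have [C HC] := one_step_l2 ab.
pose h n w := one_step_sum a b n w * \1_D w.
pose h' w := - ((a * p + b * s) * W 0 1 b w + (a * q + b * t) * W 1 0 a w).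
have h1 n : intg P (h n) by have [Si _ _ _] := HC n; have [] := restrict_intg mD PD Si.
have Eh n : (fun w => h n w ^+ 2) = fun w => one_step_sum a b n w ^+ 2 * \1_D w.
  apply/funext => w; rewrite /h exprMn; congr (_ * _).
  by have [Dw|Dw] := pselect (D w); [rewrite indic_in ?expr1n|rewrite indic_out ?expr0n].
have h2 n : intg P (fun w => h n w ^+ 2).
  by rewrite Eh; have [_ S2i _ _] := HC n; have [] := restrict_intg mD PD S2i.
have h3 n : \int[P]_w (h n w ^+ 2) <= C.
  by rewrite Eh; have [_ S2i H _] := HC n; have [_ ->] := restrict_intg mD PD S2i.
have h4 w : h ^~ w @ \oo --> h' w.
  have [Dw|Dw] := pselect (D w); last first.
    rewrite (_ : h ^~ w = fun=> 0); last by apply/funext => n; rewrite /h indic_out// mulr0.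
    by rewrite /h' /W !indic_out// !mulr0 addr0 oppr0; exact: cvg_cst.
  have gw := Dg Dw; rewrite /h' /W !indic_in// !mulr1.
  rewrite (_ : h ^~ w = jump_sum (fun u => Z u w 0 ord0) (fun u => Z u w 1 ord0)
    (fun u => Y u w 0 ord0) (fun u => Y u w 1 ord0) p q s t a b); last first.
    by apply/funext => n; rewrite /h indic_in// mulr1 one_step_jump.
  have zk k u : 0 <= u <= 1 -> 0 <= Z u w k ord0.
    by move=> /andP[u0 _]; exact: path_z_ge0.
  have := @jump_sum_cvg R _ _ _ _ p q s t a b a0 b0 (zk 0) (zk 1) (@path_z_unif w 0) (@path_z_unif w 1)
    (path_y_unif gw 0) (path_y_unif gw 1) (path_y_mono gw 0) (path_y_mono gw 1)
    (path_grows gw (k := 0)) (path_grows gw (k := 1)).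
  exact.
have [i1 _ _ c] := l2_bounded_cvg h1 h2 h3 h4.
have i2 : intg P (fun w => (a * p + b * s) * W 0 1 b w + (a * q + b * t) * W 1 0 a w).
  have -> : (fun w => (a * p + b * s) * W 0 1 b w + (a * q + b * t) * W 1 0 a w) = fun w => (-1) * h' w.
    by apply/funext => w; rewrite /h'; ring.
  exact: intgZ.
split => //.
have -> : - (\int[P]_w ((a * p + b * s) * W 0 1 b w + (a * q + b * t) * W 1 0 a w)) = \int[P]_w h' w.
  rewrite -mulN1r -(RintegralZl _ measurableT i2); apply: eq_Rintegral => w _.
  by rewrite /h' mulN1r.
rewrite [X in X @ _ --> _](_ : _ = fun n => \int[P]_w h n w)//.
apply/funext => n; have [Si _ _ E] := HC n.
by have [_ ->] := restrict_intg mD PD Si; rewrite E.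
Qed.

(** Y has finite mean at time 1: at (1, 0) and (0, 1) the combination of the
    boundary terms is integrable by boundary_identity_pos, and
    boundary_domination compares it with W 0 1 0 + W 1 0 0. *)
Lemma W_intg : intg P (W 0 1 0) /\ intg P (W 1 0 0).
Proof.
have [c1 [c2 dom]] := boundary_domination p0 t0 det0.
have [i10 _] : _ /\ _ := @boundary_identity_pos 1 0 ler01 (lexx 0) ltac:(by rewrite oner_neq0).
have [i01 _] : _ /\ _ := @boundary_identity_pos 0 1 (lexx 0) ler01 ltac:(by rewrite oner_neq0 orbT).
pose f w := c1 * ((1 * p + 0 * s) * W 0 1 0 w + (1 * q + 0 * t) * W 1 0 1 w) +
    c2 * ((0 * p + 1 * s) * W 0 1 1 w + (0 * q + 1 * t) * W 1 0 0 w).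
have fi : intg P f by apply: intgD; exact: intgZ.
have Wf w : W 0 1 0 w + W 1 0 0 w <= f w.
  rewrite /f !mul0r !mul1r !addr0 !add0r; apply: dom; exact: W_bounds.
have h0 k' l' w : 0 <= W k' l' 0 w by have /andP[] := W_bounds k' l' w (lexx (0:R)).
split; apply: (@intg_le _ _ _ _ _ f) => //; try exact: W_meas; move=> w;
  rewrite ger0_norm ?h0//; apply: le_trans (Wf w); rewrite ?lerDl ?lerDr h0//.
Qed.

Lemma W_intg_le k l b : 0 <= b -> intg P (W k l 0) -> intg P (W k l b).
Proof.
move=> b0 i0; apply: (@intg_le _ _ _ _ _ (W k l 0)) => //; first exact: W_meas.
by move=> w; have /andP[h1 h2] := W_bounds k l w b0; rewrite ger0_norm.
Qed.

End OnGoodSet.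

(** The dynamics of the mean of expcost over [0, 1], with the drift still in
    discretised form: a1 b and a2 a are the means of the integrals of
    exp (- b Z2) dY1 and exp (- a Z1) dY2. *)
Lemma boundary_terms : exists a1 a2 : R -> R,
  [/\ forall b, 0 <= b -> 0 <= a1 b <= a1 0,
      forall a, 0 <= a -> 0 <= a2 a <= a2 0,
      (fun n => a1 n.+1%:R^-1) @ \oo --> a1 0,
      (fun n => a2 n.+1%:R^-1) @ \oo --> a2 0 &
      forall a b, 0 <= a -> 0 <= b ->
  (fun n => \int[P]_w expcost a b (Z 1 w) - \int[P]_w expcost a b (Z 0 w)
    - (expR (kexponent mu Gamma a b / 2 ^+ n) - 1) *
      \sum_(0 <= i < 2 ^ n) \int[P]_w expcost a b (Z (dyadic R n i) w)) @ \oo -->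
  - ((a * p + b * s) * a1 b + (a * q + b * t) * a2 a)].
Proof.
have [D [mD PD Dg]] := good_ae.
pose W k l b w := boundary_time k l b w * \1_D w.
have [i1 i2] := W_intg mD PD Dg.
have bnd k l b : 0 <= b -> intg P (W k l 0) ->
    0 <= \int[P]_w W k l b w <= \int[P]_w W k l 0 w.
  move=> b0 i0; have ib := W_intg_le mD Dg b0 i0; apply/andP; split.
    by apply: Rintegral_ge0 => w _; have /andP[] := W_bounds Dg k l w b0.
  by apply: (le_Rintegral measurableT ib i0) => w _; have /andP[] := W_bounds Dg k l w b0.
have cv k l : intg P (W k l 0) ->
    (fun n => \int[P]_w W k l n.+1%:R^-1 w) @ \oo --> \int[P]_w W k l 0 w.
  move=> i0.
  have [] // := @dominated_cvg_Rintegral _ _ _ P (fun n => W k l n.+1%:R^-1) (W k l 0) (W k l 0) _ i0.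
  - by move=> n; apply: W_meas.
  - move=> n w; have b0 : 0 <= n.+1%:R^-1 :> R by rewrite invr_ge0.
    by have /andP[h1 h2] := W_bounds Dg k l w b0; rewrite ger0_norm.
  - by move=> w; exact: W_cvg0.
exists (fun b => \int[P]_w W 0 1 b w), (fun a => \int[P]_w W 1 0 a w); split.
- by move=> b b0; exact: bnd.
- by move=> b b0; exact: bnd.
- exact: cv.
- exact: cv.
move=> a b a0 b0.
have [ab|] := boolP ((a != 0) || (b != 0)).
  have [i c] := boundary_identity_pos mD PD Dg a0 b0 ab.
  have ib := W_intg_le mD Dg b0 i1; have ia := W_intg_le mD Dg a0 i2.
  rewrite -(RintegralZl _ measurableT ib) -(RintegralZl _ measurableT ia).
  by rewrite -(RintegralD measurableT (intgZ _ ib) (intgZ _ ia)).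
rewrite negb_or !negbK => /andP[/eqP -> /eqP ->].
have E w u : expcost 0 0 (Z u w) = 1.
  by rewrite /expcost !mul0r normr0 addr0 oppr0 expR0.
have -> : - ((0 * p + 0 * s) * (\int[P]_w W 0 1 0 w) + (0 * q + 0 * t) * (\int[P]_w W 1 0 0 w)) = 0.
  by rewrite !mul0r addr0 !mul0r addr0 oppr0.
rewrite [X in X @ _ --> _](_ : _ = fun=> 0); first exact: cvg_cst.
apply/funext => n.
have -> : kexponent mu Gamma 0 0 = 0 by rewrite /kexponent /kquad; ring.
rewrite mul0r expR0 subrr mul0r subr0.
by under eq_Rintegral do rewrite E; under [X in _ - X]eq_Rintegral do rewrite E; rewrite subrr.
Qed.

End BoundaryTerms.

End ReflectedAt.

(** * Integration over the initial state *)

Lemma orthant0 (R : realType) n : orthant (0 : 'cV[R]_n).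
Proof. by move=> i; rewrite mxE. Qed.

Lemma orthant_measurable (R : realType) (n : nat) :
  measurable (@orthant R n : set (borelV R n)).
Proof.
rewrite (_ : @orthant R n = \bigcap_(i in [set: 'I_n]) ((fun v : 'cV[R]_n => v i ord0) @^-1` `[0, +oo[)); last first.
  apply/seteqP; split => v /= H i; first by move=> _; rewrite /= in_itv/= andbT H.
  by have := H i I; rewrite /= in_itv/= andbT.
apply: fin_bigcap_measurable => // i _.
by apply: continuous_borel => //; exact: coord_continuous.
Qed.

(** The transition function is only given for starting points in the orthant;
    composed with clip, it is defined everywhere. *)
Definition clip (R : realType) n (x : 'cV[R]_n) : 'cV[R]_n :=
  if `[< orthant x >] then x else 0.

Lemma clip_orthant (R : realType) n (x : 'cV[R]_n) : orthant (clip x).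
Proof. by rewrite /clip; case: asboolP => // _; exact: orthant0. Qed.

Lemma clip_id (R : realType) n (x : 'cV[R]_n) : orthant x -> clip x = x.
Proof. by rewrite /clip; case: asboolP. Qed.

Section Invariance.
Context (R : realType) (n : nat) (d : measure_display) (T : measurableType d).
Variables (Z : R -> T -> 'cV[R]_n) (P : 'cV[R]_n -> probability T R).
Variable pi : probability (borelV R n) R.
Hypothesis hpi : invariant_law Z P pi.
Variable t : R.
Hypothesis t0 : 0 <= t.
Hypothesis mZ : measurable_fun setT (Z t : T -> borelV R n).

Lemma integral_orthant (f : borelV R n -> \bar R) :
  measurable_fun setT f -> (forall x, (0 <= f x)%E) ->
  (\int[pi]_(x in @orthant R n) f x = \int[pi]_x f x)%E.
Proof.
move=> mf f0; have mO := @orthant_measurable R n.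
rewrite [RHS](_ : _ = \int[pi]_(x in @orthant R n `|` ~` @orthant R n) f x)%E; last by rewrite setUv.
rewrite ge0_integral_setU//=; last 3 first.
- exact: measurableC.
- by rewrite setUv.
- by rewrite disj_set2E setICr.
rewrite [X in (_ + X)%E]null_set_integral ?adde0//; first exact: measurableC.
- exact: measurable_funTS.
- have [pO _] := hpi; have := probability_setC pi mO; rewrite pO subee//.
Qed.

Let K (x : borelV R n) : giry (borelV R n) R := giry_map mZ (P (clip x)).

Lemma transition_measurable : measurable_fun setT K.
Proof.
apply: measurable_giry_codensity => // B mB.
have [_ /(_ t t0 B mB)[mPB _]] := hpi.
rewrite (_ : K ^~ B = fun x => if `[< @orthant R n x >] then P x (Z t @^-1` B) else P 0 (Z t @^-1` B)).
  apply: measurable_fun_if => //.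
  - apply: (@measurable_fun_bool _ _ _ _ true).
    rewrite setTI (_ : _ @^-1` _ = @orthant R n); first exact: orthant_measurable.
    by apply/seteqP; split => x /=; [move/asboolP|move=> /asboolP ->].
  - rewrite setTI (_ : _ @^-1` _ = @orthant R n)//.
    by apply/seteqP; split => x /=; [move/asboolP|move=> /asboolP ->].
by apply/funext => x; rewrite /K /giry_map /pushforward /= /clip; case: asboolP.
Qed.

(** The mixture of the laws of Z t under P x, x distributed as pi, is the bind
    of the Giry monad, and equals pi by invariance. *)
Lemma transition_integral (f : borelV R n -> R) :
  measurable_fun setT f -> (forall x, 0 <= f x <= 1) ->
  measurable_fun setT ((fun x => \int[P (clip x)]_w f (Z t w)) : borelV R n -> R) /\
  \int[pi]_x (\int[P (clip x)]_w f (Z t w)) = \int[pi]_x f x.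
Proof.
move=> mf f01.
have mfE : measurable_fun setT (EFin \o f) by exact/measurable_EFinP.
have f0 x : (0 <= (EFin \o f) x)%E by rewrite lee_fin; have /andP[] := f01 x.
have E x : (giry_int (K x) (EFin \o f) = (\int[P (clip x)]_w f (Z t w))%:E)%E.
  rewrite giry_int_map// /giry_int EFin_Rintegral//.
  apply: (@intg_bounded _ _ _ _ _ 1); first exact: measurableT_comp mf mZ.
  by move=> w; have /andP[? ?] := f01 (Z t w); rewrite ger0_norm.
have mE : measurable_fun setT (fun x => giry_int (K x) (EFin \o f)).
  exact: (measurableT_comp (measurable_giry_int mfE f0) transition_measurable).
split.
  by apply/measurable_EFinP; apply: eq_measurable_fun mE => x _; rewrite E.
rewrite /Rintegral; congr fine.
transitivity (giry_int (giry_bind pi transition_measurable) (EFin \o f)).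
  by rewrite giry_int_bind//; apply: eq_integral => x _; rewrite E.
apply: eq_measure_integral => A mA _.
have [_ /(_ t t0 A mA)[_ E']] := hpi.
transitivity (\int[pi]_(x in @orthant R n) P x (Z t @^-1` A))%E; last exact: E'.
transitivity (giry_int pi (fun x => giry_ev (K x) A)).
  apply: (giry_int_map transition_measurable pi (measurable_giry_ev mA)) => mu.
  exact: measure_ge0.
rewrite /giry_int -integral_orthant//.
- apply: eq_integral => x xO; rewrite /= /giry_ev /K /giry_map /pushforward /= clip_id//.
  by move: xO; rewrite inE.
- exact: (measurableT_comp (measurable_giry_ev mA) transition_measurable).
Qed.

End Invariance.

(** * Measurability of the boundary terms *)

(** With y = k / 2^n, y <= exp y - 1 <= y exp y. *)
Lemma exp_slope_cvg (R : realType) (k : R) :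
  (fun n => (2 : R) ^+ n * (expR (k / 2 ^+ n) - 1)) @ \oo --> k.
Proof.
have h0 : (fun n => k / 2 ^+ n) @ \oo --> (0 : R).
  rewrite (_ : (fun n => _) = geometric k 2^-1); last by apply/funext => n; rewrite /geometric /= exprVn.
  by apply: cvg_geometric; rewrite ger0_norm ?invr_ge0// invf_lt1// ltr1n.
have h1 : (fun n => k * expR (k / 2 ^+ n)) @ \oo --> k.
  have h2 : (fun n => expR (k / 2 ^+ n)) @ \oo --> expR (0 : R).
    exact: (@continuous_cvg _ _ _ _ _ (fun n => k / 2 ^+ n) expR 0 (@continuous_expR R 0) h0).
  have := cvgM (@cvg_cst _ _ _ _ _ : (fun=> k) @ \oo --> k) h2.
  by rewrite expR0 mulr1; apply.
apply: (squeeze_cvgr _ (@cvg_cst _ _ _ _ _ : (fun=> k) @ \oo --> k) h1).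
apply: nearW => n; have e0 : 0 < (2 : R) ^+ n by rewrite exprn_gt0.
set y := k / 2 ^+ n; have -> : k = 2 ^+ n * y by rewrite /y mulrC mulfVK ?gt_eqF.
have a1 : 1 + y <= expR y by exact: expR_ge1Dx.
have a2 : expR y - 1 <= y * expR y.
  have : 1 - y <= expR (- y) by exact: expR_ge1Dx.
  rewrite -(ler_pM2r (expR_gt0 y)) -expRD addNr expR0; lra.
by rewrite -mulrA !ler_pM2l//; apply/andP; split => //; lra.
Qed.

Section BoundaryMeasurability.
Context (R : realType) (d : measure_display) (X : measurableType d).
Variables (p q s t : R) (al be : X -> R -> R).
Hypotheses (p0 : 0 < p) (t0 : 0 < t) (det0 : 0 < p * t - q * s).
Hypothesis al_ge0 : forall x b, 0 <= b -> 0 <= al x b <= al x 0.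
Hypothesis be_ge0 : forall x a, 0 <= a -> 0 <= be x a <= be x 0.
Hypothesis al_cvg : forall x, (fun n => al x n.+1%:R^-1) @ \oo --> al x 0.
Hypothesis be_cvg : forall x, (fun n => be x n.+1%:R^-1) @ \oo --> be x 0.

Definition boundary_form a b x := (a * p + b * s) * al x b + (a * q + b * t) * be x a.

Hypothesis form_meas : forall a b, 0 <= a -> 0 <= b ->
  measurable_fun setT (boundary_form a b).

Let U_meas : measurable_fun setT (fun x => p * al x 0 + q * be x 0).
Proof.
pose h n x := n.+1%:R * boundary_form n.+1%:R^-1 0 x.
apply: (@measurable_fun_cvg _ _ _ _ h).
  by move=> n; apply: measurable_funM => //; exact: form_meas.
move=> x _; have bx := @be_cvg x.
rewrite (_ : h ^~ x = fun n => p * al x 0 + q * be x n.+1%:R^-1); first by cvgs.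
apply/funext => n; rewrite /h /boundary_form.
have N0 : n.+1%:R != 0 :> R by rewrite pnatr_eq0.
by move: N0; set N := n.+1%:R => N0; field.
Qed.

Let V_meas : measurable_fun setT (fun x => s * al x 0 + t * be x 0).
Proof.
pose h n x := n.+1%:R * boundary_form 0 n.+1%:R^-1 x.
apply: (@measurable_fun_cvg _ _ _ _ h).
  by move=> n; apply: measurable_funM => //; exact: form_meas.
move=> x _; have bx := @al_cvg x.
rewrite (_ : h ^~ x = fun n => s * al x n.+1%:R^-1 + t * be x 0); first by cvgs.
apply/funext => n; rewrite /h /boundary_form.
have N0 : n.+1%:R != 0 :> R by rewrite pnatr_eq0.
by move: N0; set N := n.+1%:R => N0; field.
Qed.

(** The functions al x and be x come from a choice for each x, and only
    boundary_form is known to be measurable. Small arguments a or b isolate two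
    independent combinations of al x 0 and be x 0. *)
Lemma boundary_meas0 :
  measurable_fun setT (al ^~ 0) /\ measurable_fun setT (be ^~ 0).
Proof.
have d0 : p * t - q * s != 0 by rewrite gt_eqF.
split.
  rewrite (_ : al ^~ 0 = fun x => (p * t - q * s)^-1 *
      (t * (p * al x 0 + q * be x 0) - q * (s * al x 0 + t * be x 0))).
    by apply: measurable_funM => //; apply: measurable_funB; exact: measurable_funM.
  by apply/funext => x; field.
rewrite (_ : be ^~ 0 = fun x => (p * t - q * s)^-1 *
    (p * (s * al x 0 + t * be x 0) - s * (p * al x 0 + q * be x 0))).
  by apply: measurable_funM => //; apply: measurable_funB; exact: measurable_funM.
by apply/funext => x; field.
Qed.

(** The terms a q * be x a and b s * al x b already appear in boundary_form a 0
    and boundary_form 0 b; once they are removed, al x b is isolated by a large a,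
    be x a being bounded. *)
Lemma boundary_meas b : 0 <= b -> measurable_fun setT (al ^~ b).
Proof.
move=> b0; have [m1 m2] := boundary_meas0.
pose D a x := boundary_form a b x - (boundary_form a 0 x - a * p * al x 0)
   - (boundary_form 0 b x - b * t * be x 0).
have mD a : 0 <= a -> measurable_fun setT (D a).
  move=> a0; apply: measurable_funB; last first.
    by apply: measurable_funB; [exact: form_meas|exact: measurable_funM].
  apply: measurable_funB; first exact: form_meas.
  by apply: measurable_funB; [exact: form_meas|exact: measurable_funM].
have DE a x : D a x = a * p * al x b + b * t * be x a.
  by rewrite /D /boundary_form; ring.
pose h n x := p^-1 * (n.+1%:R^-1 * D n.+1%:R x).
apply: (@measurable_fun_cvg _ _ _ _ h).
  by move=> n; apply: measurable_funM => //; apply: measurable_funM => //; exact: mD.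
move=> x _.
have c0 : (fun n => n.+1%:R^-1 * be x n.+1%:R) @ \oo --> (0 : R).
  have ch : (fun n => n.+1%:R^-1 * be x 0) @ \oo --> (0 : R).
    have := cvgM (@cvg_harmonic R) (@cvg_cst _ _ _ _ _ : (fun=> be x 0) @ \oo --> be x 0).
    by rewrite mul0r; apply.
  apply: (squeeze_cvgr _ (@cvg_cst _ _ _ _ _ : (fun=> 0) @ \oo --> (0 : R)) ch).
  apply: nearW => n; have /andP[h1 h2] := be_ge0 x (ler0n R n.+1).
  by rewrite mulr_ge0 ?invr_ge0//= ler_wpM2l ?invr_ge0.
rewrite (_ : h ^~ x = fun n => al x b + p^-1 * (b * t) * (n.+1%:R^-1 * be x n.+1%:R)); last first.
  apply/funext => n; rewrite /h DE; have N0 : n.+1%:R != 0 :> R by rewrite pnatr_eq0.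
  have p_neq0 : p != 0 by rewrite gt_eqF.
  by move: (n.+1%:R) N0 => N N0; field; rewrite N0.
have := cvgD (@cvg_cst _ _ _ _ _ : (fun=> al x b) @ \oo --> al x b)
  (cvgM (@cvg_cst _ _ _ _ _ : (fun=> p^-1 * (b * t)) @ \oo --> p^-1 * (b * t)) c0).
by rewrite mulr0 addr0; apply.
Qed.

End BoundaryMeasurability.

(** * Stationarity in the mean *)

Section SteadyDrift.
Context (d : measure_display) (T : measurableType d) (R : realType).
Variable P : probability T R.

Definition steady (m : R) (f : T -> R) :=
  [/\ measurable_fun setT f, forall x, 0 <= f x <= 1, intg P f & \int[P]_x f x = m].

Variables (m kap : R) (f1 f0 : T -> R) (g : nat -> nat -> T -> R) (h' : T -> R).
Hypotheses (steady1 : steady m f1) (steady0 : steady m f0).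
Hypothesis steadyg : forall n i, steady m (g n i).

Let c n := expR (kap / 2 ^+ n) - 1.

Hypothesis drift_le : forall n, (2 ^ n)%:R * `|c n| <= `|kap| * expR `|kap|.
Hypothesis drift_cvg : forall x,
  (fun n => f1 x - f0 x - c n * \sum_(0 <= i < 2 ^ n) g n i x) @ \oo --> - h' x.

(** The means of f1 and f0 cancel, and the drift tends to kap * m. *)
Lemma steady_drift_cvg : intg P h' /\ \int[P]_x h' x = kap * m.
Proof.
pose h n x := f1 x - f0 x - c n * \sum_(0 <= i < 2 ^ n) g n i x.
have [m1 b1 i1 E1] := steady1; have [m0 b0 i0 E0] := steady0.
have gi n i : intg P (g n i) by have [] := steadyg n i.
have sumi n : intg P (fun x => \sum_(0 <= i < 2 ^ n) g n i x) by exact: intg_sum.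
have Ei n : \int[P]_x h n x = - (2 ^+ n * c n * m).
  rewrite (RintegralB measurableT (intgB i1 i0) (intgZ _ (sumi n))).
  rewrite (RintegralB measurableT i1 i0) (RintegralZl _ measurableT (sumi n)) Rintegral_sumT//.
  rewrite E1 E0 subrr sub0r (eq_bigr (fun=> m)) => [|i _]; last by have [] := steadyg n i.
  by rewrite sumr_const_nat subn0 -[m *+ _]mulr_natl natrX; ring.
have hi n : intg P (h n) by apply: intgB; [exact: intgB|exact: intgZ].
have hb n x : `|h n x| <= 1 + `|kap| * expR `|kap|.
  apply: le_trans (ler_normB _ _) _; apply: lerD.
    have /andP[? ?] := b1 x; have /andP[? ?] := b0 x.
    by rewrite ler_norml; apply/andP; split; lra.
  apply: le_trans (drift_le n); rewrite normrM mulrC ler_wpM2r//.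
  apply: le_trans (ler_norm_sum _ _ _) _.
  rewrite -[X in _ <= X]mulr1 mulr_natl -[X in _ *+ X]subn0 -sumr_const_nat.
  by apply: ler_sum => i _; have [_ /(_ x)/andP[? ?] _ _] := steadyg n i; rewrite ger0_norm.
have [i cv] := @bounded_cvg_Rintegral _ _ _ P h (fun x => - h' x) _ (fun n => intg_meas (hi n)) hb drift_cvg.
have ih : intg P h'.
  by rewrite (_ : h' = fun x => (-1) * (- h' x)); [exact: intgZ|apply/funext => x; rewrite mulN1r opprK].
have E : \int[P]_x (- h' x) = - \int[P]_x h' x.
  by rewrite -mulN1r -(RintegralZl _ measurableT ih); apply: eq_Rintegral => x _; rewrite mulN1r.
split => //; apply: oppr_inj; rewrite -E; apply: (cvg_unique _ cv) => //.
rewrite (_ : (fun n => _) = fun n => - (2 ^+ n * c n * m)); last by apply/funext => n; exact: Ei.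
exact: (cvgN (cvgM (@exp_slope_cvg R kap) (cvg_cst _))).
Qed.

End SteadyDrift.

Section AdjointRelation.
Context (R : realType) (d : measure_display) (T : measurableType d).
Variables (mu delta : 'cV[R]_2) (Gamma Rfl : 'M[R]_2) (F : R -> set (set T)).
Variables (Z : R -> T -> 'cV[R]_2) (P : 'cV[R]_2 -> probability T R).
Variable pi : probability (borelV R 2) R.
Hypothesis hG : sym_posdef Gamma.
Hypothesis hS : srbm mu Gamma Rfl F Z P.
Hypothesis hpi : invariant_law Z P pi.
Hypothesis hmu : mu = - (Rfl *m delta).

Let p := Rfl 0 0. Let q := Rfl 0 1. Let s := Rfl 1 0. Let t := Rfl 1 1.
Hypotheses (p0 : 0 < p) (t0 : 0 < t) (det0 : 0 < p * t - q * s).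

Let phi a b := \int[pi]_x expcost a b x.
Let state u a b (x : borelV R 2) := \int[P (clip x)]_w expcost a b (Z u w).

Lemma boundary_terms_choice : exists al be : borelV R 2 -> R -> R, forall x,
  [/\ forall b, 0 <= b -> 0 <= al x b <= al x 0,
      forall a, 0 <= a -> 0 <= be x a <= be x 0,
      (fun n => al x n.+1%:R^-1) @ \oo --> al x 0,
      (fun n => be x n.+1%:R^-1) @ \oo --> be x 0 &
      forall a b, 0 <= a -> 0 <= b ->
  (fun n => state 1 a b x - state 0 a b x
    - (expR (kexponent mu Gamma a b / 2 ^+ n) - 1) *
      \sum_(0 <= i < 2 ^ n) state (dyadic R n i) a b x) @ \oo -->
  - ((a * p + b * s) * al x b + (a * q + b * t) * be x a)].
Proof.
have H x : exists ab : (R -> R) * (R -> R),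
  [/\ forall b, 0 <= b -> 0 <= ab.1 b <= ab.1 0,
      forall a, 0 <= a -> 0 <= ab.2 a <= ab.2 0,
      (fun n => ab.1 n.+1%:R^-1) @ \oo --> ab.1 0,
      (fun n => ab.2 n.+1%:R^-1) @ \oo --> ab.2 0 &
      forall a b, 0 <= a -> 0 <= b ->
  (fun n => state 1 a b x - state 0 a b x
    - (expR (kexponent mu Gamma a b / 2 ^+ n) - 1) *
      \sum_(0 <= i < 2 ^ n) state (dyadic R n i) a b x) @ \oo -->
  - ((a * p + b * s) * ab.1 b + (a * q + b * t) * ab.2 a)].
  have [X [Y [hX hY hZ]]] := srbm_decomposition hS (clip_orthant x).
  have [a1 [a2 H]] := boundary_terms hG (srbm_filtration hS) (srbm_adapted hS)
    (@srbm_continuous _ _ _ _ _ _ _ _ _ _ hS) hX hY hZ p0 t0 det0.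
  by exists (a1, a2).
have [f Hf] := choice H.
by exists (fun x => (f x).1), (fun x => (f x).2).
Qed.

Lemma srbm_state_measurable u : 0 <= u -> measurable_fun setT (Z u : T -> borelV R 2).
Proof.
move=> u0 _ B mB; rewrite setTI; have [H _] := srbm_filtration hS.
by have [_ sub] := H u u0; apply: sub; exact: (srbm_adapted hS u0).
Qed.

Lemma expcost_meas a b : measurable_fun setT (expcost a b : borelV R 2 -> R).
Proof.
by move=> _ B mB; rewrite setTI; apply: continuous_borel mB; exact: continuous_expcost.
Qed.

Lemma state_stationary u a b : 0 <= u ->
  steady pi (phi a b) (state u a b).
Proof.
move=> u0; have mZ := srbm_state_measurable u0.
have [m E] := transition_integral hpi u0 mZ (expcost_meas a b) (@expcost01 R a b).
have b01 x : 0 <= state u a b x <= 1.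
  have i : intg (P (clip x)) (fun w => expcost a b (Z u w)).
    apply: (@intg_bounded _ _ _ _ _ 1); first exact: measurableT_comp (expcost_meas a b) mZ.
    by move=> w; have /andP[? ?] := expcost01 a b (Z u w); rewrite ger0_norm.
  apply/andP; split.
    by apply: Rintegral_ge0 => w _; have /andP[] := expcost01 a b (Z u w).
  rewrite -[X in _ <= X](Rintegral_cstT (P (clip x))).
  by apply: (le_Rintegral measurableT i (intg_cst _ _)) => w _; have /andP[] := expcost01 a b (Z u w).
split => //; apply: (@intg_bounded _ _ _ _ _ 1) => // x.
by have /andP[? ?] := b01 x; rewrite ger0_norm.
Qed.

Variables al be : borelV R 2 -> R -> R.
Hypothesis al_ge0 : forall x b, 0 <= b -> 0 <= al x b <= al x 0.
Hypothesis be_ge0 : forall x a, 0 <= a -> 0 <= be x a <= be x 0.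
Hypothesis al_cvg : forall x, (fun n => al x n.+1%:R^-1) @ \oo --> al x 0.
Hypothesis be_cvg : forall x, (fun n => be x n.+1%:R^-1) @ \oo --> be x 0.
Hypothesis form_cvg : forall x a b, 0 <= a -> 0 <= b ->
  (fun n => state 1 a b x - state 0 a b x
    - (expR (kexponent mu Gamma a b / 2 ^+ n) - 1) *
      \sum_(0 <= i < 2 ^ n) state (dyadic R n i) a b x) @ \oo -->
  - ((a * p + b * s) * al x b + (a * q + b * t) * be x a).

(** The means of the bounded functions in boundary_terms converge by dominated
    convergence, and their integrals against pi are known by invariance. *)
Lemma form_integral a b : 0 <= a -> 0 <= b ->
  intg pi (boundary_form p q s t al be a b) /\
  \int[pi]_x boundary_form p q s t al be a b x = kexponent mu Gamma a b * phi a b.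
Proof.
move=> a0 b0; apply: (@steady_drift_cvg _ _ _ pi _ _ (state 1 a b) (state 0 a b)
  (fun n i => state (dyadic R n i) a b)).
- by apply: state_stationary; exact: ler01.
- by apply: state_stationary; exact: lexx.
- by move=> n i; apply: state_stationary; rewrite divr_ge0 ?exprn_ge0.
- exact: (drift_bound mu Gamma a b).
- by move=> x; exact: form_cvg.
Qed.

Lemma form_measurable a b : 0 <= a -> 0 <= b ->
  measurable_fun setT (boundary_form p q s t al be a b).
Proof. by move=> a0 b0; have [i _] := form_integral a0 b0; exact: intg_meas i. Qed.

(* Exchanging the two coordinates turns one boundary term into the other. *)
Let form_swap a b x : boundary_form t s q p be al a b x = boundary_form p q s t al be b a x.
Proof. by rewrite /boundary_form addrC; congr (_ * _ + _ * _); rewrite addrC. Qed.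

Lemma boundary_measurable :
  (forall b, 0 <= b -> measurable_fun setT (al ^~ b)) /\
  (forall a, 0 <= a -> measurable_fun setT (be ^~ a)).
Proof.
split => c c0; first exact: (boundary_meas p0 det0 be_ge0 al_cvg be_cvg form_measurable).
have det0' : 0 < t * p - s * q by rewrite mulrC [s * q]mulrC.
apply: (boundary_meas t0 det0' al_ge0 be_cvg al_cvg _ c0) => a b a0 b0.
by rewrite (_ : boundary_form _ _ _ _ _ _ _ _ = boundary_form p q s t al be b a);
  [exact: form_measurable|apply/funext => x; exact: form_swap].
Qed.

Lemma boundary_intg :
  (forall b, 0 <= b -> intg pi (al ^~ b)) /\ (forall a, 0 <= a -> intg pi (be ^~ a)).
Proof.
have [mal mbe] := boundary_measurable.
have [c1 [c2 dom]] := boundary_domination p0 t0 det0.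
have [i10 _] := form_integral ler01 (lexx 0).
have [i01 _] := form_integral (lexx 0) ler01.
have fi : intg pi (fun x => c1 * boundary_form p q s t al be 1 0 x + c2 * boundary_form p q s t al be 0 1 x).
  by apply: intgD; exact: intgZ.
have bnd x : al x 0 + be x 0 <= c1 * boundary_form p q s t al be 1 0 x + c2 * boundary_form p q s t al be 0 1 x.
  rewrite /boundary_form !mul0r !mul1r !addr0 !add0r; apply: dom.
    exact: al_ge0.
  exact: be_ge0.
split => c c0.
  apply: (intg_le (mal c c0) fi) => x.
  have /andP[h1 h2] := al_ge0 x c0; have /andP[h3 _] := be_ge0 x (lexx 0).
  by rewrite ger0_norm//; apply: le_trans (bnd x); rewrite -[al x c]addr0 lerD.
apply: (intg_le (mbe c c0) fi) => x.
have /andP[h1 h2] := be_ge0 x c0; have /andP[h3 _] := al_ge0 x (lexx 0).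
by rewrite ger0_norm//; apply: le_trans (bnd x); rewrite -[be x c]add0r lerD.
Qed.

Let A b := \int[pi]_x al x b.
Let B a := \int[pi]_x be x a.

Lemma adjoint_identity a b : 0 <= a -> 0 <= b ->
  kexponent mu Gamma a b * phi a b = (a * p + b * s) * A b + (a * q + b * t) * B a.
Proof.
move=> a0 b0; have [_ <-] := form_integral a0 b0; have [ial ibe] := boundary_intg.
have i1 := ial b b0; have i2 := ibe a a0.
rewrite -(RintegralZl _ measurableT i1) -(RintegralZl _ measurableT i2).
by rewrite -(RintegralD measurableT (intgZ _ i1) (intgZ _ i2)).
Qed.

Lemma boundary_mass_ge0 c : 0 <= c -> 0 <= A c <= A 0 /\ 0 <= B c <= B 0.
Proof.
move=> c0; have [ial ibe] := boundary_intg.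
split; apply/andP; split.
- by apply: Rintegral_ge0 => x _; have /andP[] := al_ge0 x c0.
- by apply: (le_Rintegral measurableT (ial _ c0) (ial _ (lexx 0))) => x _; have /andP[] := al_ge0 x c0.
- by apply: Rintegral_ge0 => x _; have /andP[] := be_ge0 x c0.
- by apply: (le_Rintegral measurableT (ibe _ c0) (ibe _ (lexx 0))) => x _; have /andP[] := be_ge0 x c0.
Qed.

Lemma boundary_mass_cvg :
  (fun n => A n.+1%:R^-1) @ \oo --> A 0 /\ (fun n => B n.+1%:R^-1) @ \oo --> B 0.
Proof.
have [ial ibe] := boundary_intg.
have n0 n : 0 <= n.+1%:R^-1 :> R by rewrite invr_ge0.
have [] := @dominated_cvg_Rintegral _ _ _ pi (fun n => al ^~ n.+1%:R^-1) (al ^~ 0) (al ^~ 0)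
  (fun n => intg_meas (ial _ (n0 n))) (ial 0 (lexx 0)) _ al_cvg.
  by move=> n x; have /andP[h1 h2] := al_ge0 x (n0 n); rewrite ger0_norm.
move=> _ c1.
have [] := @dominated_cvg_Rintegral _ _ _ pi (fun n => be ^~ n.+1%:R^-1) (be ^~ 0) (be ^~ 0)
  (fun n => intg_meas (ibe _ (n0 n))) (ibe 0 (lexx 0)) _ be_cvg.
  by move=> n x; have /andP[h1 h2] := be_ge0 x (n0 n); rewrite ger0_norm.
by move=> _ c2.
Qed.

End AdjointRelation.

(** * Laplace transforms of laws on the quadrant *)

(** (1 - exp (- x u)) / x is nonincreasing in x. *)
Lemma chord_exp (R : realType) (a k u : R) : 0 <= a -> a <= k -> 0 <= u ->
  a * (1 - expR (- (k * u))) <= k * (1 - expR (- (a * u))).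
Proof.
move=> a0 ak u0; have -> : expR (- (k * u)) = expR (- (a * u)) * expR (- ((k - a) * u)).
  by rewrite -expRD; congr expR; ring.
have h1 : 1 - (k - a) * u <= expR (- ((k - a) * u)) by exact: expR_ge1Dx.
have h2 : expR (- (a * u)) * (1 + a * u) <= 1.
  by rewrite expRN -ler_pdivlMl ?invr_gt0 ?expR_gt0// invrK mulr1; exact: expR_ge1Dx.
set y := expR (- (a * u)) in h2 *; set z := expR _ in h1 *.
have y0 : 0 <= y by exact: expR_ge0.
have h3 : a * y * (1 - (k - a) * u) <= a * y * z by rewrite ler_wpM2l// mulr_ge0.
have h4 : 0 <= (k - a) * (1 - y * (1 + a * u)) by rewrite mulr_ge0 ?subr_ge0.
lra.
Qed.

Lemma expcostE (R : realType) (a b : R) (x : 'cV[R]_2) : 0 <= a -> 0 <= b ->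
  expcost a b x = expR (- (a * `|x 0 0|)) * expR (- (b * `|x 1 0|)).
Proof.
by move=> a0 b0; rewrite /expcost -expRD -opprD !normrM (ger0_norm a0) (ger0_norm b0).
Qed.

Lemma expcost00 (R : realType) (x : 'cV[R]_2) : expcost (0 : R) 0 x = 1.
Proof. by rewrite /expcost !mul0r normr0 addr0 oppr0 expR0. Qed.

Lemma joint_laplace_of_positive (R : realType) (phi : R -> R -> R) : phi 0 0 = 1 ->
  (forall l : seq (R * R * R),
    (forall x : 'cV[R]_2, 0 <= \sum_(i <- l) i.1.1 * expcost i.1.2 i.2 x) ->
    0 <= \sum_(i <- l) i.1.1 * phi i.1.2 i.2) ->
  joint_laplace phi.
Proof.
move=> one pos.
have e0 (x : 'cV[R]_2) k c : 0 <= c -> 0 <= expR (- (c * `|x k 0|)) <= 1.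
  by move=> c0; rewrite expR_ge0 expR_le1 oppr_le0 mulr_ge0.
split; first exact: one.
- move=> a b _ _; suff H (x : 'cV[R]_2) : 0 <= \sum_(i <- [:: (1, a, b)]) i.1.1 * expcost i.1.2 i.2 x.
    by have := pos _ H; rewrite big_seq1 /= mul1r.
  by rewrite big_seq1 /= mul1r; have /andP[] := expcost01 a b x.
- move=> a a' b b' a0 aa' b0 bb'.
  suff H (x : 'cV[R]_2) : 0 <= \sum_(i <- [:: (1, a, b); (-1, a', b')]) i.1.1 * expcost i.1.2 i.2 x.
    have := pos _ H; rewrite !big_cons big_nil /=; lra.
  suff : expcost a' b' x <= expcost a b x by rewrite !big_cons big_nil /=; lra.
  rewrite !expcostE ?(le_trans _ aa') ?(le_trans _ bb')// ler_pM ?expR_ge0//.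
    by rewrite ler_expR lerN2 ler_wpM2r.
  by rewrite ler_expR lerN2 ler_wpM2r.
- move=> a b a0 b0.
  suff H (x : 'cV[R]_2) : 0 <= \sum_(i <- [:: (1, 0, 0); (1, a, b); (-1, 0, b); (-1, a, 0)]) i.1.1 * expcost i.1.2 i.2 x.
    have := pos _ H; rewrite !big_cons big_nil /= ?one; lra.
  rewrite !big_cons big_nil /= !expcostE// !mul0r oppr0 expR0.
  have /andP[f0 f1] := e0 x 0 a a0; have /andP[g0 g1] := e0 x 1 b b0.
  by move: f0 f1 g0 g1; set f := expR _; set g := expR _ => f0 f1 g0 g1; nra.
- move=> a k b a0 ak b0; have k0 := le_trans a0 ak.
  suff H (x : 'cV[R]_2) : 0 <= \sum_(i <- [:: (k - a, 0, b); (- k, a, b); (a, k, b)]) i.1.1 * expcost i.1.2 i.2 x.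
    have := pos _ H; rewrite !big_cons big_nil /= ?one; lra.
  rewrite !big_cons big_nil /= !expcostE// !mul0r oppr0 expR0.
  have /andP[g0 g1] := e0 x 1 b b0.
  have h := chord_exp a0 ak (normr_ge0 (x 0 0)).
  move: g0 h; set f := expR (- (a * _)); set f' := expR (- (k * _)); set g := expR _ => g0 h.
  have : 0 <= g * (k * (1 - f) - a * (1 - f')) by rewrite mulr_ge0// subr_ge0.
  lra.
- move=> a k b a0 ak b0; have k0 := le_trans a0 ak.
  suff H (x : 'cV[R]_2) : 0 <= \sum_(i <- [:: (k - a, 0, 0); (- k, a, 0); (a, k, 0); (a - k, 0, b); (k, a, b); (- a, k, b)]) i.1.1 * expcost i.1.2 i.2 x.
    have := pos _ H; rewrite !big_cons big_nil /= ?one; lra.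
  rewrite !big_cons big_nil /= !expcostE// !mul0r oppr0 expR0.
  have /andP[g0 g1] := e0 x 1 b b0.
  have h := chord_exp a0 ak (normr_ge0 (x 0 0)).
  move: g1 h; set f := expR (- (a * _)); set f' := expR (- (k * _)); set g := expR _ => g1 h.
  have : 0 <= (1 - g) * (k * (1 - f) - a * (1 - f')) by rewrite mulr_ge0// subr_ge0.
  lra.
- move=> a b a0 b0; have a20 : 0 <= 2 * a by rewrite mulr_ge0.
  suff H (x : 'cV[R]_2) : 0 <= \sum_(i <- [:: (1, 0, b); (-2, a, b); (1, 2 * a, b)]) i.1.1 * expcost i.1.2 i.2 x.
    have := pos _ H; rewrite !big_cons big_nil /= ?one; lra.
  rewrite !big_cons big_nil /= !expcostE// !mul0r oppr0 expR0.
  have /andP[g0 g1] := e0 x 1 b b0.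
  rewrite (_ : - (2 * a * _) = - (a * `|x 0 0|) - (a * `|x 0 0|)); last by ring.
  rewrite [expR (_ - _)]expRD; move: g0; set f := expR (- (a * _)); set g := expR _ => g0.
  have : 0 <= g * (1 - f) ^+ 2 by rewrite mulr_ge0// sqr_ge0.
  lra.
Qed.

Section LaplaceTransform.
Context (R : realType) (pi : probability (borelV R 2) R).

Definition laplace a b := \int[pi]_x expcost a b x.

Lemma expcost_intg a b : intg pi (expcost a b).
Proof.
apply: (@intg_bounded _ _ _ _ _ 1); first exact: expcost_meas.
by move=> x; have /andP[? ?] := expcost01 a b x; rewrite ger0_norm.
Qed.

(** Positivity of the integral, in a form from which each field of joint_laplace
    follows by listing its coefficients and its points. *)
Lemma laplace_combination (l : seq (R * R * R)) :
  (forall x : 'cV[R]_2, 0 <= \sum_(i <- l) i.1.1 * expcost i.1.2 i.2 x) ->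
  0 <= \sum_(i <- l) i.1.1 * laplace i.1.2 i.2.
Proof.
move=> H; rewrite (eq_bigr (fun i => \int[pi]_x (i.1.1 * expcost i.1.2 i.2 x))) => [|i _].
  rewrite -Rintegral_sumT => [|i]; last by apply: intgZ; exact: expcost_intg.
  by apply: Rintegral_ge0 => x _; exact: H.
by rewrite (RintegralZl _ measurableT (expcost_intg _ _)).
Qed.

Lemma joint_laplace_laplace : joint_laplace laplace.
Proof.
apply: joint_laplace_of_positive; last exact: laplace_combination.
by rewrite /laplace -[RHS](Rintegral_cstT pi); apply: eq_Rintegral => x _; exact: expcost00.
Qed.

Lemma laplace_cvg1 : (fun n => laplace n.+1%:R^-1 0) @ \oo --> (1 : R) /\
  (fun n => laplace 0 n.+1%:R^-1) @ \oo --> (1 : R).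
Proof.
have n0 n : 0 <= n.+1%:R^-1 :> R by rewrite invr_ge0.
have E (u : R) : 0 <= u -> (fun n => expR (- (n.+1%:R^-1 * u))) @ \oo --> (1 : R).
  move=> u0; have c : (fun n => 1 - n.+1%:R^-1 * u) @ \oo --> (1 : R).
    have := cvgB (@cvg_cst _ _ _ _ _ : (fun=> 1) @ \oo --> (1 : R))
      (cvgM (@cvg_harmonic R) (@cvg_cst _ _ _ _ _ : (fun=> u) @ \oo --> u)).
    by rewrite mul0r subr0; apply.
  apply: (squeeze_cvgr _ c (@cvg_cst _ _ _ _ _ : (fun=> 1) @ \oo --> (1 : R))).
  apply: nearW => n; rewrite expR_ge1Dx expR_le1 oppr_le0 mulr_ge0//.
have b01 a b x : `|@expcost R a b x| <= 1.
  by have /andP[? ?] := expcost01 a b x; rewrite ger0_norm.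
have one : \int[pi]_x (1 : R) = 1 by exact: Rintegral_cstT.
split.
  have c x : (fun n => expcost n.+1%:R^-1 0 x) @ \oo --> (1 : R).
    rewrite (_ : (fun n => _) = fun n => expR (- (n.+1%:R^-1 * `|x 0 0|))); first exact: E.
    by apply/funext => n; rewrite expcostE// mul0r oppr0 expR0 mulr1.
  have [_] := @bounded_cvg_Rintegral _ _ _ pi (fun n => expcost n.+1%:R^-1 0) (fun=> 1) 1
    (fun n => intg_meas (expcost_intg _ _)) (fun n => @b01 _ _) c.
  by rewrite one; exact.
have c x : (fun n => expcost 0 n.+1%:R^-1 x) @ \oo --> (1 : R).
  rewrite (_ : (fun n => _) = fun n => expR (- (n.+1%:R^-1 * `|x 1 0|))); first exact: E.
  by apply/funext => n; rewrite expcostE// mul0r oppr0 expR0 mul1r.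
have [_] := @bounded_cvg_Rintegral _ _ _ pi (fun n => expcost 0 n.+1%:R^-1) (fun=> 1) 1
  (fun n => intg_meas (expcost_intg _ _)) (fun n => @b01 _ _) c.
by rewrite one; exact.
Qed.

End LaplaceTransform.

(** * The basic adjoint relation *)

Section Normalisation.
Context (R : realType).
Variables (mu delta : 'cV[R]_2) (Gamma Rfl : 'M[R]_2).
Variable pi : probability (borelV R 2) R.
Hypothesis hG : sym_posdef Gamma.
Hypothesis hmu : mu = - (Rfl *m delta).
Let p := Rfl 0 0. Let q := Rfl 0 1. Let s := Rfl 1 0. Let t := Rfl 1 1.
Hypotheses (p0 : 0 < p) (t0 : 0 < t) (det0 : 0 < p * t - q * s).

Lemma kexponentE a b : kexponent mu Gamma a b =
  kquad Gamma a b + delta 0 0 * (a * p + b * s) + delta 1 0 * (a * q + b * t).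
Proof.
have E k : mu k 0 = - (Rfl k 0 * delta 0 0 + Rfl k 1 * delta 1 0).
  by rewrite hmu mxE mul_col2.
by rewrite /kexponent !E /p /q /s /t; ring.
Qed.

(** The relation at (1 / n, 0) and at (0, 1 / n), multiplied by n: in the limit
    the masses of the boundary measures satisfy the linear system solved by
    delta. *)
Lemma boundary_mass_normalised (A B : R -> R) :
  (fun n => A n.+1%:R^-1) @ \oo --> A 0 -> (fun n => B n.+1%:R^-1) @ \oo --> B 0 ->
  (forall a b, 0 <= a -> 0 <= b -> kexponent mu Gamma a b * laplace pi a b =
     (a * p + b * s) * A b + (a * q + b * t) * B a) ->
  A 0 = delta 0 0 /\ B 0 = delta 1 0.
Proof.
move=> cA cB H; have [l1 l2] := laplace_cvg1 pi.
have n0 n : 0 <= n.+1%:R^-1 :> R by rewrite invr_ge0.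
have E1 : p * A 0 + q * B 0 = delta 0 0 * p + delta 1 0 * q.
  have c1 : (fun n => p * A 0 + q * B n.+1%:R^-1) @ \oo --> p * A 0 + q * B 0 by cvgs.
  have hh := @cvg_harmonic R.
  have c2 : (fun n => (Gamma 0 0 / 2 * n.+1%:R^-1 + (delta 0 0 * p + delta 1 0 * q)) * laplace pi n.+1%:R^-1 0)
      @ \oo --> (Gamma 0 0 / 2 * 0 + (delta 0 0 * p + delta 1 0 * q)) * 1.
    by apply: cvgM l1; apply: cvgD; [apply: cvgM; [exact: cvg_cst|exact: hh]|exact: cvg_cst].
  move: c2; rewrite mulr0 add0r mulr1 => c2; apply: (cvg_unique _ c1) => //.
  rewrite (_ : (fun n => _) = fun n => (Gamma 0 0 / 2 * n.+1%:R^-1 + (delta 0 0 * p + delta 1 0 * q)) * laplace pi n.+1%:R^-1 0)//.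
  apply/funext => n; have := H n.+1%:R^-1 0 (n0 n) (lexx 0).
  have N0 : n.+1%:R^-1 != 0 :> R by rewrite invr_eq0 pnatr_eq0.
  rewrite kexponentE /kquad; move: (n.+1%:R^-1) N0 => e e0 He.
  apply: (mulfI e0); rewrite mulrDr mulrA [e * (q * _)]mulrA.
  rewrite !mul0r !addr0 in He; rewrite -He; ring.
have E2 : s * A 0 + t * B 0 = delta 0 0 * s + delta 1 0 * t.
  have c1 : (fun n => s * A n.+1%:R^-1 + t * B 0) @ \oo --> s * A 0 + t * B 0 by cvgs.
  have hh := @cvg_harmonic R.
  have c2 : (fun n => (Gamma 1 1 / 2 * n.+1%:R^-1 + (delta 0 0 * s + delta 1 0 * t)) * laplace pi 0 n.+1%:R^-1)
      @ \oo --> (Gamma 1 1 / 2 * 0 + (delta 0 0 * s + delta 1 0 * t)) * 1.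
    by apply: cvgM l2; apply: cvgD; [apply: cvgM; [exact: cvg_cst|exact: hh]|exact: cvg_cst].
  move: c2; rewrite mulr0 add0r mulr1 => c2; apply: (cvg_unique _ c1) => //.
  rewrite (_ : (fun n => _) = fun n => (Gamma 1 1 / 2 * n.+1%:R^-1 + (delta 0 0 * s + delta 1 0 * t)) * laplace pi 0 n.+1%:R^-1)//.
  apply/funext => n; have := H 0 n.+1%:R^-1 (lexx 0) (n0 n).
  have N0 : n.+1%:R^-1 != 0 :> R by rewrite invr_eq0 pnatr_eq0.
  rewrite kexponentE /kquad; move: (n.+1%:R^-1) N0 => e e0 He.
  apply: (mulfI e0); rewrite mulrDr mulrA [e * (t * _)]mulrA.
  rewrite !mul0r !add0r in He; rewrite -He; ring.
have d0 : p * t - q * s != 0 by rewrite gt_eqF.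
split; apply: (mulfI d0).
  transitivity (t * (p * A 0 + q * B 0) - q * (s * A 0 + t * B 0)); first by ring.
  by rewrite E1 E2; ring.
transitivity (p * (s * A 0 + t * B 0) - s * (p * A 0 + q * B 0)); first by ring.
by rewrite E1 E2; ring.
Qed.

Lemma basic_adjoint_relation : srbm_stationary_distribution mu Gamma Rfl pi ->
  exists A B : R -> R,
  [/\ forall b, 0 <= b -> 0 <= A b <= delta 0 0,
      forall a, 0 <= a -> 0 <= B a <= delta 1 0,
      A 0 = delta 0 0, B 0 = delta 1 0 &
      forall a b, 0 <= a -> 0 <= b -> kexponent mu Gamma a b * laplace pi a b =
        (a * p + b * s) * A b + (a * q + b * t) * B a].
Proof.
move=> [d [T [F [Z [P [hS hpi]]]]]].
have [al [be H]] := boundary_terms_choice hG hS p0 t0 det0.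
have h1 x b : 0 <= b -> 0 <= al x b <= al x 0 by have [h _ _ _ _] := H x; exact: h.
have h2 x a : 0 <= a -> 0 <= be x a <= be x 0 by have [_ h _ _ _] := H x; exact: h.
have h3 x : (fun n => al x n.+1%:R^-1) @ \oo --> al x 0 by have [] := H x.
have h4 x : (fun n => be x n.+1%:R^-1) @ \oo --> be x 0 by have [] := H x.
have h5 x a b a0 b0 := let: And5 _ _ _ _ K := H x in K a b a0 b0.
have [c1 c2] := boundary_mass_cvg hS hpi p0 t0 det0 h1 h2 h3 h4 h5.
have id := adjoint_identity hS hpi p0 t0 det0 h1 h2 h3 h4 h5.
have [A0 B0] := boundary_mass_normalised c1 c2 id.
have bd c c0 := boundary_mass_ge0 hS hpi p0 t0 det0 h1 h2 h3 h4 h5 (c := c) c0.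
exists (fun b => \int[pi]_x al x b), (fun a => \int[pi]_x be x a); split => // c c0.
- by rewrite -A0; have [] := bd c c0.
- by rewrite -B0; have [] := bd c c0.
Qed.

End Normalisation.

(** * Convergence of the scaled Laplace transforms *)

Lemma stationary_laplace_cvg (R : realType) (Gamma Rfl : 'M[R]_2)
    (pi : R -> probability (borelV R 2) R) (x y : R) :
  sym_posdef Gamma -> 0 < Rfl 0 0 -> 0 < Rfl 1 1 ->
  0 < Rfl 0 0 * Rfl 1 1 - Rfl 0 1 * Rfl 1 0 ->
  (forall r, 0 < r < 1 -> srbm_stationary_distribution
     (- (Rfl *m (\col_(k < 2) r ^+ k.+1))) Gamma Rfl (pi r)) ->
  0 <= x -> 0 <= y ->
  let w := - Rfl 1 0 / Rfl 0 0 in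
  (fun r => laplace (pi r) (r * x) (r ^+ 2 * y)) @ (0 : R)^'+ -->
  (1 + Gamma 0 0 / (2 * Rfl 0 0) * x)^-1 *
  (1 + kquad Gamma w 1 / (w * Rfl 0 1 + Rfl 1 1) * y)^-1.
Proof.
move=> hG p0 t0 det0 hpi x0 y0 w.
pose p := Rfl 0 0; pose q := Rfl 0 1; pose s := Rfl 1 0; pose t := Rfl 1 1.
have H r : exists AB : (R -> R) * (R -> R), 0 < r < 1 ->
  [/\ forall b, 0 <= b -> 0 <= AB.1 b <= 1, forall a, 0 <= a -> 0 <= AB.2 a <= 1,
     AB.1 0 = 1, AB.2 0 = 1 &
     forall a b, 0 <= a -> 0 <= b -> kquad Gamma a b * laplace (pi r) a b +
        r * (a * p + b * s) * (laplace (pi r) a b - AB.1 b) +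
        r ^+ 2 * (a * q + b * t) * (laplace (pi r) a b - AB.2 a) = 0].
  have [r01|nr] := boolP (0 < r < 1); last by exists (fun=> 0, fun=> 0).
  have [A [B [A1 B1 A0 B0 id]]] := basic_adjoint_relation hG (erefl _) p0 t0 det0 (hpi r r01).
  move: r01 => /andP[r0 _]; have r2 : 0 < r ^+ 2 by rewrite exprn_gt0.
  rewrite !mxE /= expr1 in A1 B1 A0 B0.
  exists (fun b => A b / r, fun a => B a / r ^+ 2) => _; split => /=.
  - by move=> b b0; have /andP[h1 h2] := A1 b b0; rewrite divr_ge0 ?(ltW r0)//= ler_pdivrMr ?mul1r.
  - by move=> b b0; have /andP[h1 h2] := B1 b b0; rewrite divr_ge0 ?(ltW r2)//= ler_pdivrMr ?mul1r.
  - by rewrite A0 divff ?gt_eqF.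
  - by rewrite B0 divff ?gt_eqF.
  - move=> a b a0 b0; have := id a b a0 b0; rewrite (kexponentE Gamma (erefl _)) !mxE /= expr1.
    rewrite -/p -/q -/s -/t !mulrBr -[_ * (A b / r)]mulrA -[_ * (B a / _)]mulrA.
    have -> : (a * p + b * s) * (A b / r) = r^-1 * ((a * p + b * s) * A b) by ring.
    have -> : (a * q + b * t) * (B a / r ^+ 2) = (r ^+ 2)^-1 * ((a * q + b * t) * B a) by ring.
    rewrite !(mulVKf) ?gt_eqF//; lra.
have [AB HAB] := choice H.
have := @laplace_cvg R (Gamma 0 0) (Gamma 0 1) (Gamma 1 1) p q s t
  (fun a b => @kquad_gt0 _ Gamma a b hG) p0 t0 det0 (fun r => laplace (pi r))
  (fun r => (AB r).1) (fun r => (AB r).2)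
  (fun r _ => joint_laplace_laplace (pi r)).
apply => //.
- by move=> r b r01 b0; have [h _ _ _ _] := HAB r r01; exact: h.
- by move=> r b r01 b0; have [_ h _ _ _] := HAB r r01; exact: h.
- by move=> r r01; have [_ _ h _ _] := HAB r r01; exact: h.
- by move=> r r01; have [_ _ _ h _] := HAB r r01; exact: h.
- by move=> r a b r01 a0 b0; have [_ _ _ _ h] := HAB r r01; exact: h.
Qed.

(** * Bernstein operators and exponential coordinates *)

Section Bernstein.
Variable R : realType.
Implicit Types (u v c : R) (h : nat -> R) (H : nat -> nat -> R).

(** The Bernstein polynomial of degree n with values h j at j / n, as the mean of
    h at the endpoint of a walk of n steps with success probability u; the
    recursion on the first step replaces binomial coefficients. *)
Fixpoint bern n h u : R :=
  if n is m.+1 then u * bern m (fun j => h j.+1) u + (1 - u) * bern m h u else h 0%N.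

Lemma bern_le n h h' u : 0 <= u <= 1 -> (forall j, h j <= h' j) ->
  bern n h u <= bern n h' u.
Proof.
move=> /andP[u0 u1]; elim: n h h' => [|n ih] h h' hh //=.
by apply: lerD; rewrite ler_wpM2l ?subr_ge0//; apply: ih.
Qed.

Lemma bern_lin n c h h' u :
  bern n (fun j => c * h j + h' j) u = c * bern n h u + bern n h' u.
Proof. by elim: n h h' => [|n ih] h h' //=; rewrite !ih; ring. Qed.

Lemma bern_cst n c u : bern n (fun=> c) u = c.
Proof. by elim: n => [|n ih] //=; rewrite !ih; ring. Qed.

(** The second moment of a binomial variable; the shift c makes the induction go
    through. *)
Lemma bern_square n c u :
  bern n (fun j => (j%:R + c) ^+ 2) u = (n%:R * u + c) ^+ 2 + n%:R * (u * (1 - u)).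
Proof.
elim: n c => [|n ih] c /=; first by ring.
have -> : (fun j => (j.+1%:R + c) ^+ 2) = fun j : nat => (j%:R + (c + 1)) ^+ 2.
  by apply/funext => j; rewrite -natr1; ring.
by rewrite !ih -natr1; ring.
Qed.

Lemma bern_deviation n u : 0 <= u <= 1 ->
  bern n.+1 (fun j => (j%:R / n.+1%:R - u) ^+ 2) u <= n.+1%:R^-1.
Proof.
move=> /andP[u0 u1]; set N := n.+1%:R; have N0 : 0 < N :> R by rewrite ltr0n.
have E : (fun j : nat => (j%:R / N - u) ^+ 2) =
    fun j : nat => N^-1 ^+ 2 * (j%:R + - (N * u)) ^+ 2 + 0.
  apply/funext => j; have N1 : N != 0 by rewrite gt_eqF.
  by move: N N0 N1 => N _ N1; field.
have -> : bern n.+1 (fun j => (j%:R / N - u) ^+ 2) u = N^-1 * (u * (1 - u)).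
  rewrite E bern_lin bern_cst bern_square -/N addr0.
  have N1 : N != 0 by rewrite gt_eqF.
  by move: N N1 {N0 E} => N N1; field.
by rewrite ler_piMr ?invr_ge0 ?(ltW N0)//; nra.
Qed.

Definition bern2 n H u v := bern n (fun j => bern n (H j) v) u.

(** Bernstein's argument: the weights concentrate at (u, v), with variance at
    most 1 / n in each coordinate. *)
Lemma bern2_error n H u v c e K : 0 <= u <= 1 -> 0 <= v <= 1 -> 0 <= K ->
  (forall j k, `|H j k - c| <= e +
     K * ((j%:R / n.+1%:R - u) ^+ 2 + (k%:R / n.+1%:R - v) ^+ 2)) ->
  `|bern2 n.+1 H u v - c| <= e + 2 * K / n.+1%:R.
Proof.
move=> u01 v01 K0 hH.
have D := lerD (bern_deviation n u01) (bern_deviation n v01).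
have D' := ler_wpM2l K0 D.
set d1 := bern n.+1 (fun j => (j%:R / n.+1%:R - u) ^+ 2) u in D'.
set d2 := bern n.+1 (fun k => (k%:R / n.+1%:R - v) ^+ 2) v in D'.
have up (s : R) : bern2 n.+1 (fun j k => s * (K * ((j%:R / n.+1%:R - u) ^+ 2
      + (k%:R / n.+1%:R - v) ^+ 2)) + (c + s * e)) u v =
    s * K * (d1 + d2) + (c + s * e).
  rewrite /bern2.
  rewrite (_ : (fun j => _) = fun j : nat => s * K * (j%:R / n.+1%:R - u) ^+ 2 +
     (s * K * d2 + (c + s * e))).
    by rewrite bern_lin bern_cst -/d1; ring.
  apply/funext => j.
  rewrite (_ : (fun k => _) = fun k : nat => s * K * (k%:R / n.+1%:R - v) ^+ 2 +
     (s * K * (j%:R / n.+1%:R - u) ^+ 2 + (c + s * e))).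
    by rewrite bern_lin bern_cst -/d2; ring.
  by apply/funext => k; ring.
have U : bern2 n.+1 H u v <= bern2 n.+1 (fun j k => 1 * (K * ((j%:R / n.+1%:R - u) ^+ 2
      + (k%:R / n.+1%:R - v) ^+ 2)) + (c + 1 * e)) u v.
  apply: bern_le => // j; apply: bern_le => // k.
  by have := hH j k; move: (_ ^+ 2 + _ ^+ 2) => Q; rewrite ler_norml => /andP[_]; lra.
have L : bern2 n.+1 (fun j k => (-1) * (K * ((j%:R / n.+1%:R - u) ^+ 2
      + (k%:R / n.+1%:R - v) ^+ 2)) + (c + (-1) * e)) u v <= bern2 n.+1 H u v.
  apply: bern_le => // j; apply: bern_le => // k.
  by have := hH j k; move: (_ ^+ 2 + _ ^+ 2) => Q; rewrite ler_norml => /andP[+ _]; lra.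
move: U L D'; rewrite !up ler_norml; move: (n.+1%:R^-1) => N' U L D'.
by clear -U L D'; move: d1 d2 U L D' => x1 x2 U L D'; apply/andP; split; lra.
Qed.

End Bernstein.

Section ExponentialCoordinates.
Variable R : realType.

(** Continuity of a function of two real variables, as preservation of limits
    along filters on the real line. *)
Definition jointly_continuous (F : R -> R -> R) : Prop :=
  forall (U : set_system R), ProperFilter U -> forall (a b : R -> R) (l m : R),
    a @ U --> l -> b @ U --> m -> (fun r => F (a r) (b r)) @ U --> F l m.

(** Otherwise there are bad quadruples for all eta = r > 0. Along an ultrafilter
    tending to 0+, a and b converge by boundedness, then so do a' and b' by
    continuity of the logarithm, to the same limits. *)
Lemma exp_unif_cont (F : R -> R -> R) (M e : R) : jointly_continuous F -> 0 < e ->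
  exists2 eta, 0 < eta & forall a b a' b', 0 <= a <= M -> 0 <= b <= M ->
    `|expR (- a') - expR (- a)| <= eta -> `|expR (- b') - expR (- b)| <= eta ->
    `|F a' b' - F a b| <= e.
Proof.
move=> cF e0; apply: contrapT => H.
have bad r : exists z : R * R * R * R, 0 < r ->
    [/\ 0 <= z.1.1.1 <= M, 0 <= z.1.1.2 <= M,
       `|expR (- z.1.2) - expR (- z.1.1.1)| <= r, `|expR (- z.2) - expR (- z.1.1.2)| <= r &
       e < `|F z.1.2 z.2 - F z.1.1.1 z.1.1.2| ].
  apply: contrapT => nb; apply: H; exists r.
    by rewrite ltNge; apply/negP => r0; apply: nb; exists (0, 0, 0, 0) => /lt_geF; rewrite r0.
  move=> a b a' b' aM bM h1 h2; rewrite leNgt; apply/negP => h3.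
  by apply: nb; exists (a, b, a', b').
have [z Hz] := choice bad.
have [U [UU sU]] := ultraFilterLemma (at_right_proper_filter (0 : R)).
have PU := @ultra_proper _ _ UU.
have pos : \forall r \near U, 0 < r by apply: sU; exact: nbhs_right_gt.
have r_to0 : (fun r : R => r) @ U --> (0 : R).
  apply: cvg_trans (_ : (0:R)^'+ --> (0 : R)); last exact: cvg_within.
  by move=> A /sU.
have lim (y y' : R -> R) : (forall r, 0 < r -> 0 <= y r <= M) ->
    (forall r, 0 < r -> `|expR (- y' r) - expR (- y r)| <= r) ->
    exists l : R, y @ U --> l /\ y' @ U --> l.
  move=> y0 yy'.
  have [l yl] : exists l : R, y @ U --> l.
    exists (ulim U y); apply: (@cvg_ulim _ _ UU y M).
    by apply: filterS pos => r /y0/andP[h1 h2]; rewrite ger0_norm.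
  exists l; split => //.
  have cy : (fun r => expR (- y r)) @ U --> expR (- l).
    exact: (@continuous_cvg _ _ _ _ _ (fun r => - y r) expR (- l) (@continuous_expR R _) (cvgN yl)).
  have cy' : (fun r => expR (- y' r)) @ U --> expR (- l).
    have c0 : (fun r => expR (- y' r) - expR (- y r)) @ U --> (0 : R).
      apply: norm_cvg0; apply: (squeeze_cvgr _ (@cvg_cst _ _ _ _ _ : (fun=> 0) @ U --> (0 : R)) r_to0).
      by apply: filterS pos => r r0; rewrite normr_ge0 yy'.
    rewrite (_ : (fun r => expR (- y' r)) =
        fun r => expR (- y r) + (expR (- y' r) - expR (- y r))); last first.
      by apply/funext => r; rewrite addrC subrK.
    by rewrite -[X in _ --> X]addr0; exact: cvgD cy c0.
  have cl : (fun r => ln (expR (- y' r))) @ U --> ln (expR (- l)).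
    exact: @continuous_cvg _ _ _ _ _ _ (@ln R) _ (continuous_ln (expR_gt0 (- l))) cy'.
  rewrite (_ : y' = fun r => - ln (expR (- y' r))).
    by rewrite -[l]opprK -[- l in X in _ --> X]expRK; exact: cvgN cl.
  by apply/funext => r; rewrite expRK opprK.
have [l [al al']] : exists l : R, (fun r => (z r).1.1.1) @ U --> l /\ (fun r => (z r).1.2) @ U --> l.
  by apply: lim => r /Hz[].
have [m [bm bm']] : exists l : R, (fun r => (z r).1.1.2) @ U --> l /\ (fun r => (z r).2) @ U --> l.
  by apply: lim => r /Hz[].
have c1 := cF U PU _ _ _ _ al bm; have c2 := cF U PU _ _ _ _ al' bm'.
have c : (fun r => F (z r).1.2 (z r).2 - F (z r).1.1.1 (z r).1.1.2) @ U --> (0 : R).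
  by rewrite -(subrr (F l m)); exact: cvgB c2 c1.
have : \forall r \near U, `|F (z r).1.2 (z r).2 - F (z r).1.1.1 (z r).1.1.2| < e.
  have h := @cvgr0_norm_lt _ _ _ U _ _ c e e0; exact: h.
move=> small; have [r []] := @filter_ex _ U PU _ (filterI pos small).
by move=> /Hz[_ _ _ _ h1] h2; move: (lt_trans h1 h2); rewrite ltxx.
Qed.

End ExponentialCoordinates.

Section BernsteinApproximation.
Variable R : realType.

(** Bernstein polynomials in exp (- a) and exp (- b). On a + b <= M the error is
    small by exp_unif_cont; elsewhere it is at most 2 C, and the last term is
    at least as large because 1 - exp (- 1) >= 1 / 2. *)
Lemma bernstein_approx (F : R -> R -> R) (C M e : R) : jointly_continuous F ->
  (forall a b, `|F a b| <= C) -> 0 < M -> 0 < e ->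
  exists n H, forall a b, 0 <= a -> 0 <= b ->
    `|bern2 n H (expR (- a)) (expR (- b)) - F a b| <=
    2 * e + 4 * C * (1 - expR (- ((a + b) / M))).
Proof.
move=> cF FC M0 e0; have [eta eta0 He] := exp_unif_cont M cF e0.
have C0 : 0 <= C := le_trans (normr_ge0 _) (FC 0 0).
(* z < exp (- M) keeps the index 0, where ln is meaningless, out of reach *)
pose z := Num.min eta (expR (- M) / 2).
have z0 : 0 < z by rewrite lt_min eta0 divr_gt0 ?expR_gt0.
pose K := 2 * C / z ^+ 2.
have K0 : 0 <= K by rewrite divr_ge0 ?mulr_ge0 ?exprn_ge0// ltW.
pose n := Num.truncn (2 * K / e).
have nK : 2 * K / n.+1%:R <= e.
  rewrite ler_pdivrMr// [e * _]mulrC -ler_pdivrMr//.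
  exact: ltW (Num.Theory.truncnS_gt _).
pose H j k := F (- ln (j%:R / n.+1%:R)) (- ln (k%:R / n.+1%:R)).
exists n.+1, H => a b a0 b0.
have u01 (c : R) : 0 <= c -> 0 <= expR (- c) <= 1.
  by move=> c0; rewrite expR_ge0 expR_le1 oppr_le0.
have tail0 : 0 <= 1 - expR (- ((a + b) / M)).
  by rewrite subr_ge0 expR_le1 oppr_le0 divr_ge0 ?addr_ge0// ltW.
have [abM|abM] := leP (a + b) M; last first.
  have h1 : `|bern2 n.+1 H (expR (- a)) (expR (- b)) - 0| <= C + 2 * 0 / n.+1%:R.
    apply: bern2_error; [exact: u01|exact: u01|exact: lexx|].
    by move=> j k; rewrite subr0 mul0r addr0; exact: FC.
  rewrite subr0 mulr0 mul0r addr0 in h1.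
  have h2 : expR (- ((a + b) / M)) <= 2^-1.
    apply: (@le_trans _ _ (expR (- 1))).
      by rewrite ler_expR lerN2 ler_pdivlMr// mul1r ltW.
    have h : 1 + 1 <= expR 1 :> R by exact: expR_ge1Dx.
    by rewrite expRN lef_pV2 ?posrE ?expR_gt0//; lra.
  apply: le_trans (ler_normB _ _) _; have h3 := FC a b.
  have h4 : 4 * C * 2^-1 <= 4 * C * (1 - expR (- ((a + b) / M))).
    by rewrite ler_wpM2l ?mulr_ge0//; lra.
  lra.
have aM : 0 <= a <= M by rewrite a0; lra.
have bM : 0 <= b <= M by rewrite b0; lra.
suff h : `|bern2 n.+1 H (expR (- a)) (expR (- b)) - F a b| <= e + 2 * K / n.+1%:R.
  apply: (le_trans h); have h4 : 0 <= 4 * C * (1 - expR (- ((a + b) / M))) by rewrite !mulr_ge0.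
  by move: nK h4; set X := 2 * K / _; set Y := 4 * C * _; lra.
apply: bern2_error; [exact: u01|exact: u01|exact: K0|move=> j k].
have near c l : 0 <= c <= M -> `|l%:R / n.+1%:R - expR (- c)| <= z ->
    `|expR (- - ln (l%:R / n.+1%:R)) - expR (- c)| <= eta.
  move: (l%:R / n.+1%:R) => y /andP[_ cM] lz; have l0 : 0 < y.
    have h1 : expR (- M) <= expR (- c) by rewrite ler_expR lerN2.
    have h2 : z <= expR (- M) / 2 by rewrite ge_min lexx orbT.
    have := expR_gt0 (- M); move: lz; rewrite ler_norml => /andP[h _] hM; lra.
  by rewrite opprK lnK ?posrE//; apply: le_trans lz _; rewrite ge_min lexx.
have far (x : R) : z < `|x| -> z ^+ 2 <= x ^+ 2.
  by move=> zx; rewrite -[x ^+ 2]real_normK ?num_real// ler_pXn2r ?nnegrE// ltW.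
have bigK (S : R) : z ^+ 2 <= S -> `|H j k - F a b| <= e + K * S.
  move=> zS; have h : 2 * C <= K * S.
    rewrite /K -mulrA -[X in X <= _]mulr1 ler_wpM2l ?mulr_ge0//.
    by rewrite mulrC ler_pdivlMr ?exprn_gt0// mul1r.
  apply: le_trans (ler_normB _ _) _; have := FC (- ln (j%:R / n.+1%:R)) (- ln (k%:R / n.+1%:R)).
  by have := FC a b; rewrite /H; lra.
have [ja|ja] := leP `|j%:R / n.+1%:R - expR (- a)| z; last first.
  by apply: bigK; apply: le_trans (far _ ja) _; rewrite lerDl sqr_ge0.
have [kb|kb] := leP `|k%:R / n.+1%:R - expR (- b)| z; last first.
  by apply: bigK; apply: le_trans (far _ kb) _; rewrite lerDr sqr_ge0.
apply: le_trans (He _ _ _ _ aM bM (near _ _ aM ja) (near _ _ bM kb)) _.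
by rewrite lerDl mulr_ge0// addr_ge0 ?sqr_ge0.
Qed.

End BernsteinApproximation.

Section OneLaw.
Context (d : measure_display) (T : measurableType d) (R : realType).
Variables (P : probability T R) (U V : T -> R) (F : R -> R -> R) (C : R).
Hypotheses (mU : measurable_fun setT U) (mV : measurable_fun setT V).
Hypotheses (U0 : forall w, 0 <= U w) (V0 : forall w, 0 <= V w).

Lemma bern2_meas n H :
  measurable_fun setT (fun w => bern2 n H (expR (- U w)) (expR (- V w))).
Proof.
have B m (h : nat -> T -> R) (W : T -> R) : measurable_fun setT W ->
    (forall j, measurable_fun setT (h j)) ->
    measurable_fun setT (fun w => bern m (fun j => h j w) (expR (- W w))).
  move=> mW; elim: m h => [|m ih] h mh /=; first exact: mh.
  have me : measurable_fun setT (fun w => expR (- W w)).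
    by apply: measurableT_comp => //; exact: measurableT_comp.
  apply: measurable_funD; apply: measurable_funM => //.
  - by apply: (ih (fun j => h j.+1)).
  - exact: measurable_funB.
  - exact: ih.
by apply: (B n (fun j w => bern n (H j) (expR (- V w)))) => // j; apply: B.
Qed.

Hypothesis cF : jointly_continuous F.
Hypothesis FC : forall a b, `|F a b| <= C.

(** A pointwise limit of Bernstein polynomials in exp (- U) and exp (- V). *)
Lemma jointly_continuous_meas : measurable_fun setT (fun w => F (U w) (V w)).
Proof.
have app (N : nat) := bernstein_approx cF FC (ltr0Sn R N : 0 < N.+1%:R) (divr_gt0 ltr01 (ltr0Sn R N)).
have [n Hn] := choice app.
have [H HH] := choice Hn.
apply: (@measurable_fun_cvg _ _ _ _ (fun N w => bern2 (n N) (H N) (expR (- U w)) (expR (- V w)))).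
  by move=> N; exact: bern2_meas.
move=> w _; have C0 : 0 <= C := le_trans (normr_ge0 _) (FC 0 0).
apply: (@cvg_dist_eps _ _ (fun=> F (U w) (V w)) _ (2 + 4 * C * (U w + V w))); first exact: cvg_cst.
move=> e e0; exists (Num.truncn e^-1) => N nN.
have be : N.+1%:R^-1 <= e :> R.
  rewrite invf_ple ?posrE// ltW// (lt_le_trans (Num.Theory.truncnS_gt _))//.
  by rewrite ler_nat ltnS.
have N0 : 0 <= N.+1%:R^-1 :> R by rewrite invr_ge0.
apply: le_trans (HH N (U w) (V w) (U0 w) (V0 w)) _.
rewrite div1r; have h1 : 1 - expR (- ((U w + V w) / N.+1%:R)) <= (U w + V w) * N.+1%:R^-1.
  by have := expR_ge1Dx (- ((U w + V w) / N.+1%:R)); move: (_ / _) => y; lra.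
have h2 : (U w + V w) * N.+1%:R^-1 <= (U w + V w) * e by rewrite ler_wpM2l// addr_ge0.
have h3 := ler_wpM2l (mulr_ge0 (ler0n R 4) C0) (le_trans h1 h2).
by move: be h3; move: (N.+1%:R^-1) (1 - _) => y y' be h3; lra.
Qed.

Lemma jointly_continuous_intg : intg P (fun w => F (U w) (V w)).
Proof. by apply: (intg_bounded _ (k := C)) => //; exact: jointly_continuous_meas. Qed.

Lemma exp_sum_intg (x y : R) : 0 <= x -> 0 <= y -> intg P (fun w => expR (- (x * U w + y * V w))).
Proof.
move=> x0 y0; apply: (intg_bounded _ (k := 1)).
  apply: measurableT_comp => //; apply: measurableT_comp => //.
  by apply: measurable_funD; exact: measurable_funM.
by move=> w; rewrite ger0_norm ?expR_ge0// expR_le1 oppr_le0 addr_ge0 ?mulr_ge0.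
Qed.

(** U and V are finite: no mass at infinity. *)
Lemma tail_cvg : (fun n => \int[P]_w expR (- (n.+1%:R^-1 * U w + n.+1%:R^-1 * V w))) @ \oo --> (1 : R).
Proof.
rewrite -[X in _ --> X](Rintegral_cstT P).
have n0 n : 0 <= n.+1%:R^-1 :> R by rewrite invr_ge0.
have b n w : `|expR (- (n.+1%:R^-1 * U w + n.+1%:R^-1 * V w))| <= 1.
  by rewrite ger0_norm ?expR_ge0// expR_le1 oppr_le0 addr_ge0 ?mulr_ge0.
have c w : (fun n => expR (- (n.+1%:R^-1 * U w + n.+1%:R^-1 * V w))) @ \oo --> (1 : R).
  have hh := @cvg_harmonic R.
  have c1 : (fun n => - (n.+1%:R^-1 * U w + n.+1%:R^-1 * V w)) @ \oo --> - (0 * U w + 0 * V w).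
    by apply: cvgN; apply: cvgD; (apply: cvgM; [exact: hh|exact: cvg_cst]).
  rewrite -[X in _ --> X]expR0; rewrite !mul0r addr0 oppr0 in c1.
  exact: (@continuous_cvg _ _ _ _ _ _ expR 0 (@continuous_expR R _) c1).
have [_ H] := @bounded_cvg_Rintegral _ _ _ P _ _ 1 (fun n => intg_meas (exp_sum_intg (n0 n) (n0 n))) b c.
exact: H.
Qed.

End OneLaw.

(** * From Laplace transforms to convergence in distribution *)

Section LaplaceContinuity.
Context (R : realType) (I : Type) (G : set_system I) (PG : ProperFilter G).
Context (d : I -> measure_display) (T : forall i, measurableType (d i)).
Variables (P : forall i, probability (T i) R) (U V : forall i, T i -> R).
Context (d' : measure_display) (T' : measurableType d').
Variables (P' : probability T' R) (U' V' : T' -> R).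
Hypotheses (mU : forall i, measurable_fun setT (@U i)) (mV : forall i, measurable_fun setT (@V i)).
Hypotheses (U0 : forall i w, 0 <= @U i w) (V0 : forall i w, 0 <= @V i w).
Hypotheses (mU' : measurable_fun setT U') (mV' : measurable_fun setT V').
Hypotheses (U'0 : forall w, 0 <= U' w) (V'0 : forall w, 0 <= V' w).
Hypothesis lap : forall x y, 0 <= x -> 0 <= y ->
  (fun i => \int[P i]_w expR (- (x * U w + y * V w))) @ G -->
  \int[P']_w expR (- (x * U' w + y * V' w)).

Let ev i (g : R -> R -> R) (w : T i) := g (expR (- U w)) (expR (- V w)).
Let ev' (g : R -> R -> R) (w : T') := g (expR (- U' w)) (expR (- V' w)).

Definition mean_cvg (g : R -> R -> R) :=
  [/\ forall i, intg (P i) (@ev i g), intg P' (ev' g) &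
      (fun i => \int[P i]_w ev g w) @ G --> \int[P']_w ev' g w].

(** Convergence of the means, in a form that is stable under multiplication by
    the variables u = exp (- U) and v = exp (- V). *)
Definition monomially_mean_cvg (g : R -> R -> R) :=
  forall a b : nat, mean_cvg (fun u v => u ^+ a * v ^+ b * g u v).

Lemma mean_cvg_lin (c : R) g h : mean_cvg g -> mean_cvg h ->
  mean_cvg (fun u v => c * g u v + h u v).
Proof.
move=> [g1 g2 g3] [h1 h2 h3]; split.
- by move=> i; apply: intgD => //; exact: intgZ.
- by apply: intgD => //; exact: intgZ.
have E i : \int[P i]_w ev (fun u v => c * g u v + h u v) w =
    c * (\int[P i]_w ev g w) + \int[P i]_w ev h w.
  by rewrite -(RintegralZl _ measurableT (g1 i)) -(RintegralD measurableT (intgZ _ (g1 i)) (h1 i)).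
have -> : \int[P']_w ev' (fun u v => c * g u v + h u v) w =
    c * (\int[P']_w ev' g w) + \int[P']_w ev' h w.
  by rewrite -(RintegralZl _ measurableT g2) -(RintegralD measurableT (intgZ _ g2) h2).
rewrite (_ : (fun i => _) = fun i => c * (\int[P i]_w ev g w) + \int[P i]_w ev h w).
  by apply: cvgD h3; apply: cvgM g3; exact: cvg_cst.
by apply/funext => i; exact: E.
Qed.

Lemma monomial_lin (c : R) g h : monomially_mean_cvg g -> monomially_mean_cvg h ->
  monomially_mean_cvg (fun u v => c * g u v + h u v).
Proof.
move=> Hg Hh a b; rewrite (_ : (fun u v => _) =
  fun u v => c * (u ^+ a * v ^+ b * g u v) + u ^+ a * v ^+ b * h u v).
  exact: mean_cvg_lin.
by apply/funext => u; apply/funext => v; ring.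
Qed.

Lemma monomial_mul g : monomially_mean_cvg g ->
  monomially_mean_cvg (fun u v => u * g u v) /\ monomially_mean_cvg (fun u v => v * g u v).
Proof.
move=> Hg; split => a b.
  rewrite (_ : (fun u v => _) = fun u v => u ^+ a.+1 * v ^+ b * g u v); first exact: Hg.
  by apply/funext => u; apply/funext => v; rewrite exprS; ring.
rewrite (_ : (fun u v => _) = fun u v => u ^+ a * v ^+ b.+1 * g u v); first exact: Hg.
by apply/funext => u; apply/funext => v; rewrite exprS; ring.
Qed.

Lemma monomial_cst c : monomially_mean_cvg (fun _ _ => c).
Proof.
have H1 : monomially_mean_cvg (fun _ _ => 1).
  move=> a b; have a0 : 0 <= a%:R :> R by []; have b0 : 0 <= b%:R :> R by [].
  have E (x y : R) : expR (- x) ^+ a * expR (- y) ^+ b * 1 = expR (- (a%:R * x + b%:R * y)).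
    by rewrite mulr1 -!expRM_natl -expRD !mulrN opprD.
  split.
  - move=> i; rewrite (_ : ev _ = fun w => expR (- (a%:R * U w + b%:R * V w))).
      exact: exp_sum_intg.
    by apply/funext => w; exact: E.
  - rewrite (_ : ev' _ = fun w => expR (- (a%:R * U' w + b%:R * V' w))).
      exact: exp_sum_intg.
    by apply/funext => w; exact: E.
  have := lap a0 b0.
  rewrite (_ : (fun w => expR _) = ev' (fun u v => u ^+ a * v ^+ b * 1)); last first.
    by apply/funext => w; rewrite -E.
  rewrite (_ : (fun i => _) = fun i => \int[P i]_w ev (fun u v => u ^+ a * v ^+ b * 1) w)//.
  by apply/funext => i; apply: eq_Rintegral => w _; rewrite -E.
rewrite (_ : (fun _ _ => c) = fun _ _ : R => (c - 1) * 1 + 1); first exact: monomial_lin.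
by apply/funext => u; apply/funext => v; ring.
Qed.

Lemma monomial_bern n (h : nat -> R -> R -> R) : (forall j, monomially_mean_cvg (h j)) ->
  monomially_mean_cvg (fun u v => bern n (fun j => h j u v) u) /\
  monomially_mean_cvg (fun u v => bern n (fun j => h j u v) v).
Proof.
elim: n h => [|n ih] h Hh /=; first by [].
have [X1 X2] := ih (fun j => h j.+1) (fun j => Hh j.+1); have [Y1 Y2] := ih h Hh.
have [uX _] := monomial_mul X1; have [_ vX] := monomial_mul X2.
have [uY _] := monomial_mul Y1; have [_ vY] := monomial_mul Y2.
split.
  have H := monomial_lin 1 uX (monomial_lin (-1) uY Y1); move: H.
  congr monomially_mean_cvg; apply/funext => u; apply/funext => v; ring.
have H := monomial_lin 1 vX (monomial_lin (-1) vY Y2); move: H.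
congr monomially_mean_cvg; apply/funext => u; apply/funext => v; ring.
Qed.

Lemma bern2_mean_cvg n H : mean_cvg (bern2 n H).
Proof.
have [K _] := monomial_bern n (fun j => (monomial_bern n (fun k => monomial_cst (H j k))).2).
have := K 0%N 0%N; congr mean_cvg.
by apply/funext => u; apply/funext => v; rewrite !expr0 !mul1r.
Qed.

(** The means of Bernstein polynomials converge, and the tightness needed to
    replace F by such a polynomial is the convergence of the Laplace transform
    at the point (1 / N, 1 / N). *)
Lemma laplace_continuity (F : R -> R -> R) (C : R) : jointly_continuous F ->
  (forall a b, `|F a b| <= C) ->
  (fun i => \int[P i]_w F (U w) (V w)) @ G --> \int[P']_w F (U' w) (V' w).
Proof.
move=> cF FC; have C0 : 0 <= C := le_trans (normr_ge0 _) (FC 0 0).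
apply/cvgrPdist_le => eps eps0; pose e := eps / 8.
have e0 : 0 < e by rewrite divr_gt0.
pose tail c := 4 * C * (1 - c).
have [N HN] : exists N : nat, tail (\int[P']_w expR (- (N.+1%:R^-1 * U' w + N.+1%:R^-1 * V' w))) <= e.
  have c1 := tail_cvg P' mU' mV' U'0 V'0.
  have : (fun n => tail (\int[P']_w expR (- (n.+1%:R^-1 * U' w + n.+1%:R^-1 * V' w)))) @ \oo --> tail 1.
    by apply: cvgM; [exact: cvg_cst|apply: cvgB; [exact: cvg_cst|exact: c1]].
  rewrite /tail subrr mulr0 => c2.
  have [N _ HN] := @cvgr_le _ _ _ _ _ _ c2 e e0.
  by exists N; exact: (HN N (leqnn N)).
set s := N.+1%:R^-1 in HN *; have s0 : 0 <= s by rewrite invr_ge0.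
have [n [H HH]] := bernstein_approx cF FC (ltr0Sn R N : 0 < N.+1%:R) e0.
have [b1 b2 b3] := bern2_mean_cvg n H.
have diff dd (TT : measurableType dd) (Q : probability TT R) (X Y : TT -> R) :
    measurable_fun setT X -> measurable_fun setT Y -> (forall w, 0 <= X w) -> (forall w, 0 <= Y w) ->
    intg Q (fun w => bern2 n H (expR (- X w)) (expR (- Y w))) ->
    `|\int[Q]_w F (X w) (Y w) - \int[Q]_w bern2 n H (expR (- X w)) (expR (- Y w))| <=
    2 * e + tail (\int[Q]_w expR (- (s * X w + s * Y w))).
  move=> mX mY X0 Y0 ib.
  have pt w : `|F (X w) (Y w) - bern2 n H (expR (- X w)) (expR (- Y w))| <=
      2 * e + 4 * C * (1 - expR (- (s * X w + s * Y w))).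
    have -> : s * X w + s * Y w = (X w + Y w) / N.+1%:R by rewrite -mulrDr mulrC.
    by rewrite distrC; exact: HH.
  have iF := jointly_continuous_intg Q mX mY X0 Y0 cF FC.
  have ie := exp_sum_intg Q mX mY X0 Y0 s0 s0.
  have it : intg Q (fun w => 2 * e + 4 * C * (1 - expR (- (s * X w + s * Y w)))).
    by apply: intgD; [exact: intg_cst|apply: intgZ; apply: intgB => //; exact: intg_cst].
  rewrite -(RintegralB measurableT iF ib).
  apply: le_trans (le_normr_Rintegral measurableT (intgB iF ib)) _.
  have -> : 2 * e + tail (\int[Q]_w expR (- (s * X w + s * Y w))) =
      \int[Q]_w (2 * e + 4 * C * (1 - expR (- (s * X w + s * Y w)))).
    have i1 : intg Q (fun w => 1 - expR (- (s * X w + s * Y w))) by apply: intgB => //; exact: intg_cst.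
    rewrite (RintegralD measurableT (intg_cst _ _) (intgZ _ i1)) Rintegral_cstT.
    by rewrite (RintegralZl _ measurableT i1) (RintegralB measurableT (intg_cst _ _) ie) Rintegral_cstT.
  apply: (le_Rintegral measurableT _ it) => [|w _]; last exact: pt.
  apply: (intg_le _ it) => [|w]; last by rewrite normr_id; exact: pt.
  by apply: measurableT_comp => //; exact: intg_meas (intgB iF ib).
have D' := diff _ _ P' U' V' mU' mV' U'0 V'0 b2.
have c3 := lap s0 s0.
have c4 : (fun i => tail (\int[P i]_w expR (- (s * U w + s * V w)))) @ G -->
    tail (\int[P']_w expR (- (s * U' w + s * V' w))).
  by apply: cvgM; [exact: cvg_cst|apply: cvgB; [exact: cvg_cst|exact: c3]].
have n1 : \forall i \near G, tail (\int[P i]_w expR (- (s * U w + s * V w))) <= 2 * e.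
  by apply: (cvgr_le _ c4); lra.
have n2 : \forall i \near G, `|\int[P']_w ev' (bern2 n H) w - \int[P i]_w ev (bern2 n H) w| <= e.
  by move/cvgrPdist_le : b3; apply.
apply: filterS2 n1 n2 => i t1 t2.
have D := diff _ _ (P i) (@U i) (@V i) (@mU i) (@mV i) (@U0 i) (@V0 i) (b1 i).
move: D D' t1 t2 HN; rewrite /ev /ev'.
set x1 := (\int[P i]_w F _ _); set x2 := (\int[P i]_w bern2 _ _ _ _).
set y1 := (\int[P']_w F _ _); set y2 := (\int[P']_w bern2 _ _ _ _).
rewrite !ler_norml /e => /andP[? ?] /andP[? ?] ? /andP[? ?] ?.
by apply/andP; split; lra.
Qed.

End LaplaceContinuity.

(** * Independent exponential variables *)

Section ProductLaw.
Context (d1 d2 : measure_display) (T1 : measurableType d1) (T2 : measurableType d2).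
Context (R : realType) (Q1 : probability T1 R) (Q2 : probability T2 R).

Definition product_law : probability (T1 * T2)%type R := (Q1 \x Q2)%E.

Lemma product_law_rect A1 A2 : measurable A1 -> measurable A2 ->
  product_law (A1 `*` A2) = (Q1 A1 * Q2 A2)%E.
Proof. by move=> m1 m2; exact: product_measure1E. Qed.

Lemma product_law_integral (f : T1 -> R) (g : T2 -> R) :
  measurable_fun setT f -> measurable_fun setT g ->
  (forall x, 0 <= f x) -> (forall y, 0 <= g y) ->
  (\int[product_law]_z (f z.1 * g z.2)%:E =
   (\int[Q1]_x (f x)%:E) * (\int[Q2]_y (g y)%:E))%E.
Proof.
move=> mf mg f0 g0.
have mh : measurable_fun setT (fun z : T1 * T2 => (f z.1 * g z.2)%:E).
  by apply/measurable_EFinP; apply: measurable_funM; exact: measurableT_comp.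
have h0 (z : T1 * T2) : (0 <= (f z.1 * g z.2)%:E)%E by rewrite lee_fin mulr_ge0.
have := @fubini_tonelli1 _ _ T1 T2 R Q1 Q2 _ mh h0; rewrite /fubini_F /= => ->.
have G0 : (0 <= \int[Q2]_y (g y)%:E)%E by apply: integral_ge0 => y _; rewrite lee_fin.
rewrite -ge0_integralZr//=; last 2 first.
- exact/measurable_EFinP.
- by move=> x _; rewrite lee_fin.
have mg' : measurable_fun setT (fun y => (g y)%:E) by exact/measurable_EFinP.
apply: eq_integral => x _; rewrite -ge0_integralZl_EFin//.
by move=> y _; rewrite lee_fin.
Qed.

End ProductLaw.

(** The density vanishes on the negative half line. *)
Lemma exponential_law_norm (R : realType) (l : R) (l0 : 0 < l) (A : set R) :
  measurable A -> exponential_law l0 ((fun x => `|x|) @^-1` A) = exponential_law l0 A.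
Proof.
move=> mA.
have mA' : measurable ((fun x : R => `|x|) @^-1` A).
  by rewrite -[X in measurable X]setTI; exact: normr_measurable.
have E (B : set R) : measurable B ->
    exponential_prob l B = (\int[lebesgue_measure]_x (exponential_pdf l x * \1_B x)%:E)%E.
  move=> mB; rewrite /exponential_prob integral_mkcond; apply: eq_integral => x _.
  by rewrite patchE indicE; case: ifP => _; rewrite ?mulr1 ?mulr0.
rewrite [LHS]E// [RHS]E//; apply: eq_integral => x _.
have [x0|x0] := ltP x 0; first by rewrite lt0_exponential_pdf// !mul0r.
congr (_ * _)%:E; rewrite !indicE; congr (nat_of_bool _)%:R.
by apply/idP/idP; rewrite !inE /= ger0_norm.
Qed.

(** The coordinates of a product law; taking their absolute values changes
    nothing in law and makes them nonnegative everywhere. *)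
Lemma independent_exponentials (R : realType) (m : 'I_2 -> R) : (forall k, 0 < m k) ->
  exists (d' : measure_display) (T' : measurableType d') (P' : probability T' R)
    (Zs : 'I_2 -> {RV P' >-> R}),
  [/\ independent2 P' (Zs 0) (Zs 1), forall k, exponential_mean P' (Zs k) (m k),
      forall k w, 0 <= Zs k w &
      forall x y, 0 <= x -> 0 <= y ->
        \int[P']_w expR (- (x * Zs 0 w + y * Zs 1 w)) = (1 + m 0 * x)^-1 * (1 + m 1 * y)^-1].
Proof.
move=> m0; have l0 k : 0 < (m k)^-1 by rewrite invr_gt0.
pose Q0 := exponential_law (l0 0); pose Q1 := exponential_law (l0 1).
pose N (x : R) := `|x|.
pose P' := product_law Q0 Q1.
have mn1 : measurable_fun setT (fun w : measurableTypeR R * measurableTypeR R => `|w.1| : R).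
  by apply: measurableT_comp => //; exact: normr_measurable.
have mn2 : measurable_fun setT (fun w : measurableTypeR R * measurableTypeR R => `|w.2| : R).
  by apply: measurableT_comp => //; exact: normr_measurable.
have [Z0 E0] := mfun_of mn1; have [Z1 E1] := mfun_of mn2.
have mp (A : set R) : measurable A -> measurable (N @^-1` A).
  by move=> mA; rewrite -[X in measurable X]setTI; exact: normr_measurable.
have R0 (A : set R) : Z0 @^-1` A = (N @^-1` A) `*` setT.
  by rewrite E0; apply/seteqP; split => w //= [].
have R1 (A : set R) : Z1 @^-1` A = setT `*` (N @^-1` A).
  by rewrite E1; apply/seteqP; split => w //= [].
have law0 (A : set R) : measurable A -> P' (Z0 @^-1` A) = Q0 A.
  move=> mA; rewrite R0; transitivity (Q0 (N @^-1` A) * Q1 setT)%E.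
    by apply: product_law_rect => //; exact: mp.
  by rewrite (probability_setT Q1) mule1; exact: exponential_law_norm.
have law1 (A : set R) : measurable A -> P' (Z1 @^-1` A) = Q1 A.
  move=> mA; rewrite R1; transitivity (Q0 setT * Q1 (N @^-1` A))%E.
    by apply: product_law_rect => //; exact: mp.
  by rewrite (probability_setT Q0) mul1e; exact: exponential_law_norm.
exists _, _, P', (fun k => if k == 0 then Z0 else Z1); split => /=.
- move=> A B mA mB; rewrite law0// law1// R0 R1 -setXI setIT setTI.
  transitivity (Q0 (N @^-1` A) * Q1 (N @^-1` B))%E.
    by apply: product_law_rect; exact: mp.
  by congr (_ * _)%E; exact: exponential_law_norm.
- move=> k A mA; case: ifPn => [/eqP ->|k0]; first exact: law0.
  have -> : k = 1 by apply/val_inj; case: k k0 => [[|[|]]].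
  exact: law1.
- by move=> k w; case: ifP => _; rewrite ?E0 ?E1.
- move=> x y x0 y0.
  have L a k : 0 <= a -> (\int[exponential_law (l0 k)]_z (expR (- (a * `|z|)))%:E = ((1 + m k * a)^-1)%:E)%E.
    move=> a0; rewrite exponential_laplace//; congr (_%:E).
    have mk1 : 1 + m k * a != 0.
      by rewrite gt_eqF// (lt_le_trans ltr01)// lerDl mulr_ge0// ltW.
    by field; rewrite mk1 gt_eqF.
  rewrite /Rintegral; rewrite [X in fine X](_ : _ = ((1 + m 0 * x)^-1 * (1 + m 1 * y)^-1)%:E)//.
  rewrite EFinM -(L _ 0 x0) -(L _ 1 y0).
  have me a : measurable_fun setT (fun z : measurableTypeR R => expR (- (a * `|z|)) : R).
    apply: measurableT_comp => //.
    by apply: measurableT_comp => //; apply: measurable_funM => //.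
  have := product_law_integral Q0 Q1 (me x) (me y)
    (fun=> expR_ge0 _) (fun=> expR_ge0 _).
  move=> <-; apply: eq_integral => w _; rewrite E0 E1 -expRD.
  by congr (expR _)%:E; rewrite opprD.
Qed.

(** * Scaled vectors *)

Lemma ord2 (i : 'I_2) : i = 0 \/ i = 1.
Proof. by case: i => [[|[|]]]//= ?; [left|right]; exact/val_inj. Qed.

(** m is a variable because the cardinal of a singleton is only provably 1. *)
Lemma det_minor (R : realType) (A : 'M[R]_2) m (f : 'I_m -> 'I_2) (i : 'I_2) :
  m = 1%N -> (forall j, f j = i) -> \det (mxsub f f A) = A i i.
Proof.
by move=> m1; subst m => fi; rewrite det_mx11 mxE fi.
Qed.

Lemma det2 (R : realType) (A : 'M[R]_2) : \det A = A 0 0 * A 1 1 - A 0 1 * A 1 0.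
Proof.
rewrite (expand_det_row _ 0) !big_ord_recl big_ord0 /cofactor !det_mx11 !mxE /= addr0.
have -> : lift 0 0 = 1 :> 'I_2 by apply/val_inj.
have -> : lift 1 0 = 0 :> 'I_2 by apply/val_inj.
have -> : (0 : 'I_2) = ord0 by []. 
by rewrite /bump /=; ring.
Qed.

(** The minors of the two singletons and of the full set of indices. *)
Lemma Pmatrix2 (R : realType) (A : 'M[R]_2) : Pmatrix A ->
  [/\ 0 < A 0 0, 0 < A 1 1 & 0 < A 0 0 * A 1 1 - A 0 1 * A 1 0].
Proof.
move=> PA; have diag i : 0 < A i i.
  have := PA [set i]%SET; rewrite (@det_minor _ A _ _ i) ?cards1// => j.
  by have := enum_valP j; rewrite inE => /eqP.
split; [exact: diag|exact: diag|].
have := PA [set: 'I_2]%SET; set f := @enum_val _ _.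
have f_inj : injective f by exact: enum_val_inj.
have m2 : #|[set: 'I_2]%SET| = 2%N by rewrite cardsT card_ord.
move: f f_inj; rewrite /= m2 => f f_inj; rewrite det2 !mxE.
have n01 : f 0 != f 1 by apply/eqP => /f_inj.
by case: (ord2 (f 0)) n01 => ->; case: (ord2 (f 1)) => ->; rewrite ?eqxx// => _; lra.
Qed.

Definition col2 (R : realType) (a b : R) : 'cV[R]_2 :=
  \col_(k < 2) (if k == 0 then a else b).

Lemma cvg_col2 (R : realType) (X : Type) (U : set_system X) (FU : Filter U)
    (a b : X -> R) (l m : R) :
  a @ U --> l -> b @ U --> m -> (fun x => col2 (a x) (b x)) @ U --> col2 l m.
Proof.
move=> al bm; apply/cvg_ballP => e e0.
have h1 : \forall r \near U, ball l e (a r) by move/cvg_ballP : al; apply.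
have h2 : \forall r \near U, ball m e (b r) by move/cvg_ballP : bm; apply.
by apply: filterS2 h1 h2 => r r1 r2; split => // i j; rewrite !mxE; case: ifP.
Qed.

Lemma jointly_continuous_col2 (R : realType) (f : 'cV[R]_2 -> R) : continuous f ->
  jointly_continuous (fun a b => f (col2 a b)).
Proof.
move=> cf U PU a b l m al bm.
exact: (@continuous_cvg _ _ _ _ _ _ f _ (cf _) (cvg_col2 _ al bm)).
Qed.

Definition scale_col (R : realType) (r : R) (v : 'cV[R]_2) : 'cV[R]_2 :=
  \col_(k < 2) (r ^+ k.+1 * v k 0).

Lemma scale_colE (R : realType) (r : R) v : scale_col r v = col2 (r * v 0 0) (r ^+ 2 * v 1 0).
Proof.
apply/matrixP => k j; rewrite !mxE; have [->|->] := ord2 k; rewrite /= ?expr1.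
  by congr (_ * v _ _); apply/val_inj; case: j => [[|]].
by congr (_ * v _ _); apply/val_inj; case: j => [[|]].
Qed.

Lemma continuous_scale_col (R : realType) (r : R) : continuous (@scale_col R r).
Proof.
move=> v; have FF : Filter (nbhs v) := nbhs_filter v.
rewrite (_ : scale_col r = fun v => col2 (r * v 0 0) (r ^+ 2 * v 1 0)); last first.
  by apply/funext => u; exact: scale_colE.
apply: (@cvg_col2 _ _ (nbhs v) FF).
  by apply: (@cvgM _ _ (nbhs v) FF _ _ _ _ (cvg_cst _)); exact: coord_continuous.
by apply: (@cvgM _ _ (nbhs v) FF _ _ _ _ (cvg_cst _)); exact: coord_continuous.
Qed.

Section WeakConvergence.
Context (R : realType) (d : R -> measure_display) (T : forall r : R, measurableType (d r)).
Variables (P : forall r : R, probability (T r) R) (Z : forall r : R, {RV (P r) >-> borelV R 2}).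

Let U r (w : T r) : R := `|r * (Z r w : 'cV[R]_2) 0 0|.
Let V r (w : T r) : R := `|r ^+ 2 * (Z r w : 'cV[R]_2) 1 0|.

Lemma coord_borel_meas k : measurable_fun setT (fun v : borelV R 2 => (v : 'cV[R]_2) k 0).
Proof.
by move=> _ B mB; rewrite setTI; apply: continuous_borel mB; exact: coord_continuous.
Qed.

Lemma scaled_coord_meas r (c : R) k :
  measurable_fun setT (fun w : T r => `|c * (Z r w : 'cV[R]_2) k 0| : R).
Proof.
apply: measurableT_comp => //; apply: measurable_funM => //.
by apply: (measurableT_comp (coord_borel_meas k)).
Qed.

Lemma scaled_laplace r x y : 0 <= x -> 0 <= y ->
  \int[P r]_w expR (- (x * U w + y * V w)) =
  laplace (distribution (P r) (Z r)) (r * x) (r ^+ 2 * y).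
Proof.
move=> x0 y0; rewrite /laplace /Rintegral; congr fine.
have me : measurable_fun setT (fun v : borelV R 2 => (expcost (r * x) (r ^+ 2 * y) v)%:E).
  by apply/measurable_EFinP; exact: expcost_meas.
rewrite ge0_integral_distribution//; last by move=> v; rewrite lee_fin expR_ge0.
apply: eq_integral => w _ /=; congr (expR (- _))%:E.
by rewrite /U /V !normrM (ger0_norm x0) (ger0_norm y0); ring.
Qed.

(** Almost surely Z r is in the orthant, and the absolute values do nothing. *)
Lemma scaled_expectation r (f : 'cV[R]_2 -> R) (C : R) : 0 < r ->
  distribution (P r) (Z r) (@orthant R 2) = 1%E -> continuous f -> (forall x, `|f x| <= C) ->
  ('E_(P r)[fun w => f (scale_col r (Z r w))] =
   (\int[P r]_w f (col2 (U w) (V w)))%:E)%E.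
Proof.
move=> r0 hO cf fC.
have jc := jointly_continuous_col2 cf.
have iF : intg (P r) (fun w => f (col2 (U w) (V w))).
  exact: (jointly_continuous_intg (P r) (@scaled_coord_meas _ _ _) (@scaled_coord_meas _ _ _)
    (fun=> normr_ge0 _) (fun=> normr_ge0 _) jc (fun a b => fC _)).
rewrite (EFin_Rintegral iF) unlock.
have mS : measurable_fun setT (fun v : borelV R 2 => f (scale_col r v)).
  move=> _ B mB; rewrite setTI; apply: continuous_borel mB => v.
  by apply: (@continuous_comp _ _ _ (scale_col r) f); [exact: continuous_scale_col|exact: cf].
apply: ae_eq_integral => //.
- by apply/measurable_EFinP; apply: (measurableT_comp mS).
- by apply/measurable_EFinP; exact: intg_meas iF.
exists (Z r @^-1` (~` @orthant R 2)); split.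
- by rewrite -[X in measurable X]setTI; apply: measurable_funP => //; apply: measurableC; exact: orthant_measurable.
- apply: (etrans (probability_setC (distribution (P r) (Z r)) (@orthant_measurable R 2))).
  by rewrite [X in (_ - X)%E](_ : _ = 1%E) ?subee//; exact: hO.
move=> w /= nE nO; apply: nE => _; congr (f _)%:E.
by rewrite scale_colE /U /V !ger0_norm// mulr_ge0 ?nO ?exprn_ge0// ltW.
Qed.
End WeakConvergence.

Lemma dot_col2 (R : realType) (M : 'M[R]_2) (a b : R) k :
  dotV (\col_(i < 2) [:: a; b]`_i) (col k M) = a * M 0 k + b * M 1 k.
Proof. by rewrite dotV2 !mxE. Qed.

Theorem corollary2 (R : realType) (Gamma Rfl : 'M[R]_2)
    (hGamma : sym_posdef Gamma) (hR : Pmatrix Rfl)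
    (d : R -> measure_display) (T : forall r : R, measurableType (d r))
    (P : forall r : R, probability (T r) R)
    (Z : forall r : R, {RV (P r) >-> borelV R 2})
    (hZ : forall r : R, 0 < r < 1 ->
       let delta : 'cV[R]_2 := \col_(k < 2) r ^+ k.+1 in
       srbm_stationary_distribution (- (Rfl *m delta)) Gamma Rfl
         (distribution (P r) (Z r))) :
  (exists! w12 : R, w12 * Rfl 0 0 + Rfl 1 0 = 0) /\
  (forall w12 : R, w12 * Rfl 0 0 + Rfl 1 0 = 0 ->
     let u (k : 'I_2) : 'cV[R]_2 :=
       if k == 0 then \col_(i < 2) [:: 1; 0]`_i
       else \col_(i < 2) [:: w12; 1]`_i in
     let m (k : 'I_2) : R :=
       dotV (u k) (Gamma *m u k) / (2 * dotV (u k) (col k Rfl)) in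
     (forall k, 0 < m k) /\
     (exists (d' : measure_display) (T' : measurableType d')
             (P' : probability T' R) (Zstar : 'I_2 -> {RV P' >-> R}),
        [/\ independent2 P' (Zstar 0) (Zstar 1),
            forall k, exponential_mean P' (Zstar k) (m k) &
            cvg_in_distribution (0:R)^'+ P
              (fun r w => \col_(k < 2) (r ^+ k.+1 * (Z r w : 'cV[R]_2) k 0))
              P' (fun w => \col_(k < 2) Zstar k w)])).
Proof.
have [p0 t0 det0] := Pmatrix2 hR; have p_neq0 : Rfl 0 0 != 0 by rewrite gt_eqF.
split.
  exists (- Rfl 1 0 / Rfl 0 0); split; first by field.
  by move=> w hw; apply: (mulIf p_neq0); rewrite mulfVK//; lra.
move=> w hw u m.
have wE : - Rfl 1 0 / Rfl 0 0 = w by apply: (mulIf p_neq0); rewrite mulfVK//; lra.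
have [GT _] := hGamma.
have wq0 : 0 < w * Rfl 0 1 + Rfl 1 1.
  rewrite -wE -(pmulr_rgt0 _ p0); move: det0; congr (0 < _); field.
  exact: p_neq0.
have m0E : m 0 = Gamma 0 0 / (2 * Rfl 0 0).
  rewrite /m /u /= kquadE// dot_col2 /kquad; field; exact: p_neq0.
have m1E : m 1 = kquad Gamma w 1 / (w * Rfl 0 1 + Rfl 1 1).
  rewrite /m /u /= kquadE// dot_col2 mul1r; field.
  by rewrite gt_eqF.
have G0 : 0 < Gamma 0 0.
  have : 0 < kquad Gamma 1 0 by apply: kquad_gt0 => //; rewrite oner_neq0.
  by rewrite /kquad; lra.
have m_gt0 k : 0 < m k.
  have [->|->] := ord2 k.
    by rewrite m0E divr_gt0// mulr_gt0.
  by rewrite m1E divr_gt0// kquad_gt0// oner_neq0 orbT.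
split => //.
have [d' [T' [P' [Zs [ind expo Zs0 lapZs]]]]] := independent_exponentials m_gt0.
exists d', T', P', Zs; split => // f cf [C fC].
have jc := jointly_continuous_col2 cf.
have mZs k : measurable_fun setT (Zs k) by exact: measurable_funP.
have lap x y : 0 <= x -> 0 <= y ->
  (fun r => \int[P r]_w expR (- (x * `|r * (Z r w : 'cV[R]_2) 0 0| +
      y * `|r ^+ 2 * (Z r w : 'cV[R]_2) 1 0|))) @ (0:R)^'+ -->
  \int[P']_w expR (- (x * Zs 0 w + y * Zs 1 w)).
  move=> x0 y0; rewrite lapZs// m0E m1E.
  rewrite (_ : (fun r => _) = fun r => laplace (distribution (P r) (Z r)) (r * x) (r ^+ 2 * y)); last first.
    by apply/funext => r; exact: scaled_laplace.
  have := stationary_laplace_cvg hGamma p0 t0 det0 (fun r r01 => hZ r r01) x0 y0.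
  by rewrite wE.
have PG := at_right_proper_filter (0 : R).
have key := laplace_continuity PG (fun r => @scaled_coord_meas _ _ _ P Z r r 0)
  (fun r => @scaled_coord_meas _ _ _ P Z r (r ^+ 2) 1) (fun r w => normr_ge0 _)
  (fun r w => normr_ge0 _) (mZs 0) (mZs 1) (Zs0 0) (Zs0 1) lap jc (fun a b => fC _).
have -> : ('E_P'[fun w0 => f (\col_(k < 2) Zs k w0)] =
   (\int[P']_w0 f (col2 (Zs 0 w0) (Zs 1 w0)))%:E)%E.
  rewrite EFin_Rintegral ?expectation.unlock; last first.
    exact: jointly_continuous_intg (mZs 0) (mZs 1) (Zs0 0) (Zs0 1) jc (fun a b => fC _).
  apply: eq_integral => w0 _; congr (f _)%:E; apply/matrixP => k j; rewrite !mxE.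
  by have [->|->] := ord2 k; rewrite ?eqxx.
have keyE : (fun r => (\int[P r]_w0 f (col2 `|r * (Z r w0 : 'cV[R]_2) 0 0|
      `|r ^+ 2 * (Z r w0 : 'cV[R]_2) 1 0|))%:E) @ (0:R)^'+ -->
    (\int[P']_w0 f (col2 (Zs 0 w0) (Zs 1 w0)))%:E.
  by apply: cvg_EFin; [exact: nearW|exact: key].
apply: cvg_trans keyE.
apply: near_eq_cvg; near=> r.
have r0 : 0 < r by near: r; exact: nbhs_right_gt.
have r1 : r < 1 by near: r; exact: nbhs_right_lt.
have r01 : 0 < r < 1 by rewrite r0 r1.
have hO : distribution (P r) (Z r) (@orthant R 2) = 1%E.
  by have [? [? [? [? [? [_ [hO _]]]]]]] := hZ r r01.
apply/esym; exact: (@scaled_expectation R d T P Z r f C r0 hO cf fC).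
Unshelve. all: by end_near.
Qed.
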